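(* Let $H$ be a Hopf algebra over a field $k$, let $\mathcal{D}$ be a right $H$-comodule category, and let $\mathcal{C}=\mathcal{D}^{\mathrm{co}H}\subset\mathcal{D}$ be such that $\mathcal{D}/\mathcal{C}$ is an $H$-Galois extension and $\mathcal{D}$ is flat both as a left and as a right $\mathcal{C}$-module. Let $M$ be a $\mathcal{D}$-bimodule. Then there is a spectral sequence $$E_2^{p,q}=H^p(H,H^q(\mathcal{C},M))\Rightarrow H^{p+q}(\mathcal{D},M),$$ natural in $M$, relating the Hochschild-Mitchell cohomologies of $\mathcal{C}$ and $\mathcal{D}$ and the Hochschild cohomology of $H$.
   Context: Throughout $k$ is a field, $\otimes=\otimes_k$, and categories are small. For a $k$-linear category $\mathcal{C}$ with object set $\mathcal{C}_0$, ${}_y\mathcal{C}_x$ denotes the space of morphisms from $x$ to $y$. A left (right) $\mathcal{C}$-module is a $k$-linear covariant (contravariant) functor from $\mathcal{C}$ to $k$-vector spaces; a $\mathcal{C}$-bimodule $M$ is a family $({}_yM_x)_{x,y\in\mathcal{C}_0}$ of $k$-vector spaces with commuting, associative, unital actions ${}_z\mathcal{C}_y\otimes{}_yM_x\to{}_zM_x$ and ${}_yM_x\otimes{}_x\mathcal{C}_w\to{}_yM_w$, i.e. a left module over $\mathcal{C}^e=\mathcal{C}\boxtimes\mathcal{C}^{op}$. Tensor product of bimodules: ${}_y(M\otimes_{\mathcal{C}}N)_x=\big(\bigoplus_{z\in\mathcal{C}_0}{}_yM_z\otimes{}_zN_x\big)/\langle m.f\otimes n-m\otimes f.n\rangle$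 (and similarly for a right module tensored with a left module). Hochschild-Mitchell cohomology $H^\bullet(\mathcal{C},M)$ is the cohomology of the complex $C^n(\mathcal{C},M)=\prod_{(x_{n+1},\dots,x_1)}\mathrm{Hom}_k({}_{x_{n+1}}\mathcal{C}_{x_n}\otimes\cdots\otimes{}_{x_2}\mathcal{C}_{x_1},{}_{x_{n+1}}M_{x_1})$, $C^0=\prod_x{}_xM_x$, with the usual Hochschild differential; equivalently $\mathrm{Ext}^\bullet_{\mathcal{C}^e}(\mathcal{C},M)$. In particular $H^0(\mathcal{C},M)=\{(m_x)_x\in\prod_x{}_xM_x: f.m_x=m_y.f\ \ \forall f\in{}_y\mathcal{C}_x\}$. A right $H$-comodule category is a $k$-linear category $\mathcal{D}$ such that every ${}_y\mathcal{D}_x$ is a right $H$-comodule (coaction $f\mapsto f_{(0)}\otimes f_{(1)}$), every ${}_x\mathcal{D}_x$ is an $H$-comodule algebra and compositions are $H$-comodule maps (tensor products having the standard coaction). $\mathcal{D}^{\mathrm{co}H}$ is the subcategory with the same objects and morphisms ${}_y\mathcal{D}_x^{\mathrm{co}H}=\{f: f_{(0)}\otimes f_{(1)}=f\otimes 1\}$. For $\mathcal{C}=\mathcal{D}^{\mathrm{co}H}$, the extension $\mathcal{D}/\mathcal{C}$ is $H$-Galois if the maps ${}_x\beta_y:{}_x(\mathcal{D}\otimes_{\mathcal{C}}\mathcal{D})_y\to{}_x\mathcal{D}_y\otimes H$, $f\otimes_{\mathcal{C}}g\mapsto f g_{(0)}\otimes g_{(1)}$, are isomorphisms for all objects $x,y$.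 $\mathcal{D}$ is flat as a left (right) $\mathcal{C}$-module if all the left modules ${}_{-}\mathcal{D}_y$ (right modules ${}_y\mathcal{D}_{-}$) are flat, i.e. tensoring with them over $\mathcal{C}$ is exact. $\mathcal{D}$-bimodules are regarded as $\mathcal{C}$-bimodules by restriction. The right $H$-module structure on $H^q(\mathcal{C},M)$: write ${}_x\beta_x^{-1}({}_x1_x\otimes h)=\sum_i r_{i,x}(h)\otimes_{\mathcal{C}}l_{i,x}(h)$ with $r_{i,x}(h)\in{}_x\mathcal{D}_{y_i}$, $l_{i,x}(h)\in{}_{y_i}\mathcal{D}_x$; on $H^0(\mathcal{C},M)$ the action is $((m)\cdot h)_x=\sum_i r_{i,x}(h)\,m_{y_i}\,l_{i,x}(h)$. This makes $M\mapsto H^0(\mathcal{C},M)$ a functor from $\mathcal{D}$-bimodules to right $H$-modules, and under the flatness hypothesis $H^q(\mathcal{C},M)$ is its $q$-th right derived functor at $M$, which gives its $H$-module structure. For a right $H$-module $N$, $H^p(H,N)$ is the Hochschild cohomology of $H$ with coefficients in $N$, viewed as an $H$-bimodule with left action through the counit; it equals $\mathrm{Ext}^p_H(k,N)$ in the category of right $H$-modules, $k$ being the trivial module. *)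

(* Defs.v *)
From HB Require Import structures.
From mathcomp Require Import all_boot all_algebra.
From mathcomp Require Import finmap boolp monalg.

Set Implicit Arguments.
Unset Strict Implicit.
Unset Printing Implicit Defensive.

Import GRing.Theory.
Local Open Scope ring_scope.
Local Open Scope quotient_scope.

Section Subquotients.
Variable k : fieldType.

Definition zerop (V : lmodType k) : {pred V} := fun v => v == 0.

Fact zerop_submod (V : lmodType k) : GRing.submod_closed (@zerop V).
Proof.
split; first by rewrite unfold_in eqxx.
by move=> a u v; rewrite !unfold_in => /eqP-> /eqP->; rewrite scaler0 addr0.
Qed.
HB.instance Definition _ (V : lmodType k) :=
  GRing.isSubmodClosed.Build k V (@zerop V) (@zerop_submod V).

Definition kerp (V W : lmodType k) (f : {linear V -> W}) : {pred V} :=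
  fun v => f v == 0.

Fact kerp_submod V W f : GRing.submod_closed (@kerp V W f).
Proof.
split; first by rewrite unfold_in linear0 eqxx.
by move=> a u v; rewrite !unfold_in linearP => /eqP-> /eqP->;
  rewrite scaler0 addr0.
Qed.
HB.instance Definition _ V W f :=
  GRing.isSubmodClosed.Build k V (@kerp V W f) (kerp_submod f).

Definition imp (V W : lmodType k) (f : {linear V -> W}) : {pred W} :=
  fun w => `[< exists v, w = f v >].

Fact imp_submod V W f : GRing.submod_closed (@imp V W f).
Proof.
split; first by apply/asboolP; exists 0; rewrite linear0.
move=> a u v /asboolP[x ->] /asboolP[y ->]; apply/asboolP.
by exists (a *: x + y); rewrite linearP.
Qed.
HB.instance Definition _ V W f :=
  GRing.isSubmodClosed.Build k W (@imp V W f) (imp_submod f).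

Definition spanp (V : lmodType k) (X : V -> Prop) : {pred V} :=
  fun v => `[< forall S : submodClosed V, (forall x, X x -> x \in S) -> v \in S >].

Fact spanp_submod V X : GRing.submod_closed (@spanp V X).
Proof.
split; first by apply/asboolP => S _; apply: rpred0.
move=> a u v /asboolP hu /asboolP hv; apply/asboolP => S hS.
by apply: rpredD; [apply: rpredZ; apply: hu | apply: hv].
Qed.
HB.instance Definition _ V X :=
  GRing.isSubmodClosed.Build k V (@spanp V X) (spanp_submod X).

Section Sub.
Variables (V : lmodType k) (S : submodClosed V).
Definition subm : predArgType := {v : V | v \in S}.
HB.instance Definition _ := SubChoice.on subm.
HB.instance Definition _ := [SubChoice_isSubLmodule of subm by <:].
End Sub.

(* V / S; the quotient of the library is only a zmodType *)
Section Quo.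
Variables (V : lmodType k) (S : submodClosed V).
Definition zpred : {pred V} := [pred v in S].
Fact zpred_zmod : GRing.zmod_closed zpred.
Proof.
split=> [|u v]; rewrite !inE ?rpred0 // => hu hv.
by rewrite rpredD // -scaleN1r rpredZ.
Qed.
HB.instance Definition _ := GRing.isZmodClosed.Build V zpred zpred_zmod.

Definition quom := Quotient.quot zpred.
HB.instance Definition _ := GRing.Zmodule.on quom.
HB.instance Definition _ := EqQuotient.on quom.

Definition quom_pi (v : V) : quom := \pi_quom v.
Definition quom_repr (x : quom) : V := repr x.

Lemma quom_reprK x : quom_pi (quom_repr x) = x. Proof. exact: reprK. Qed.

Lemma quom_eq u v : (quom_pi u = quom_pi v) <-> (u - v \in S).
Proof. by rewrite -[u - v \in S]/(u - v \in zpred) Quotient.idealrBE; split => /eqP. Qed.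

Lemma quom_piD u v : quom_pi (u + v) = quom_pi u + quom_pi v.
Proof. exact: (raddfD (\pi_(Quotient.quot zpred))). Qed.

Definition quom_scale (a : k) (x : quom) : quom := quom_pi (a *: quom_repr x).

Lemma quom_piZ a v : quom_pi (a *: v) = quom_scale a (quom_pi v).
Proof.
apply/quom_eq; rewrite -scalerBr; apply/rpredZ/quom_eq.
by rewrite quom_reprK.
Qed.

Fact quom_scaleA a b x : quom_scale a (quom_scale b x) = quom_scale (a * b) x.
Proof. by rewrite -[x]quom_reprK -!quom_piZ scalerA. Qed.
Fact quom_scale1 : left_id 1 quom_scale.
Proof. by move=> x; rewrite -[x]quom_reprK -!quom_piZ scale1r. Qed.
Fact quom_scaleDr : right_distributive quom_scale +%R.
Proof.
move=> a x y; rewrite -[x]quom_reprK -[y]quom_reprK.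
by rewrite -quom_piD -!quom_piZ -quom_piD scalerDr.
Qed.
Fact quom_scaleDl x : {morph quom_scale^~ x : a b / a + b}.
Proof.
by move=> a b; rewrite -[x]quom_reprK -!quom_piZ -quom_piD scalerDl.
Qed.
HB.instance Definition _ := GRing.Zmodule_isLmodule.Build k quom
  quom_scaleA quom_scale1 quom_scaleDr quom_scaleDl.

Fact quom_pi_linear : linear quom_pi.
Proof. by move=> a u v; rewrite quom_piD quom_piZ. Qed.
HB.instance Definition _ := GRing.isLinear.Build k V quom _ quom_pi quom_pi_linear.
End Quo.

(* S / (S :&: T) *)
Section Subquo.
Variables (V : lmodType k) (S T : submodClosed V).

Definition comapp : {pred subm S} := fun v => val v \in T.
Fact comapp_submod : GRing.submod_closed comapp.
Proof.
split=> [|a u v hu hv]; first by rewrite -[_ \in _]/(val 0 \in T) raddf0 rpred0.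
by rewrite -[_ \in _]/(val (a *: u + v) \in T) linearP; apply/rpredD/hv/rpredZ/hu.
Qed.
HB.instance Definition _ := GRing.isSubmodClosed.Build k (subm S) comapp comapp_submod.

Definition subquo : lmodType k := quom comapp.

(* junk value 0 when v is not in S *)
Definition cls (v : V) : subquo :=
  if insub v is Some w then quom_pi comapp w else 0.

Definition rep (x : subquo) : V := val (quom_repr x).

Lemma repP x : rep x \in S. Proof. exact: valP. Qed.

Lemma repK x : cls (rep x) = x.
Proof. by rewrite /cls /rep valK; apply: quom_reprK. Qed.

Lemma subB (R : submodClosed V) u v : u \in R -> v \in R -> u - v \in R.
Proof. by move=> hu hv; rewrite rpredD // -scaleN1r rpredZ. Qed.

Lemma comappE (u : subm S) : (u \in comapp) = (val u \in T). Proof. by []. Qed.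

Lemma clsP u v : u \in S -> v \in S -> (cls u = cls v) <-> (u - v \in T).
Proof.
move=> hu hv; rewrite /cls !insubT /=; split.
  by move/quom_eq; rewrite comappE raddfB.
by move=> h; apply/quom_eq; rewrite comappE raddfB.
Qed.

Lemma clsL a u v : u \in S -> v \in S -> cls (a *: u + v) = a *: cls u + cls v.
Proof.
move=> hu hv; have huv : a *: u + v \in S by rewrite rpredD ?rpredZ.
rewrite /cls !insubT /= -linearP; congr quom_pi.
by apply: val_inj; rewrite linearP.
Qed.
End Subquo.

(* the map S / (S :&: T) -> S' / (S' :&: T') induced by g *)
Section SubquoMap.
Variables (V V' : lmodType k) (S T : submodClosed V) (S' T' : submodClosed V').
Variable g : {linear V -> V'}.
Hypothesis gS : forall v, v \in S -> g v \in S'.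
Hypothesis gT : forall v, v \in T -> g v \in T'.

Definition subquo_map of (forall v, v \in S -> g v \in S') &
  (forall v, v \in T -> g v \in T') : subquo S T -> subquo S' T' :=
  fun x => cls S' T' (g (rep x)).

Lemma subquo_mapE v : v \in S -> subquo_map gS gT (cls S T v) = cls S' T' (g v).
Proof.
move=> hv; have hr := repP (cls S T v).
apply/(clsP T' (gS hr) (gS hv)); rewrite -linearB; apply/gT.
by apply/(clsP T hr hv); rewrite repK.
Qed.

Fact subquo_map_linear : linear (subquo_map gS gT).
Proof.
move=> a x y; rewrite -[x]repK -[y]repK -clsL ?repP // !subquo_mapE ?repP //;
  last by rewrite rpredD ?rpredZ ?repP.
by rewrite linearP clsL // gS ?repP.
Qed.
HB.instance Definition _ := GRing.isLinear.Build k (subquo S T) (subquo S' T') _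
  (subquo_map gS gT) subquo_map_linear.
End SubquoMap.

End Subquotients.

Definition bilin (k : fieldType) (U V W : lmodType k) (f : U -> V -> W) : Prop :=
  (forall u, linear (f u)) /\ (forall v, linear (f^~ v)).

Lemma bilinl (k : fieldType) (U V W : lmodType k) (f : U -> V -> W) :
  bilin f -> forall a u u' v, f (a *: u + u') v = a *: f u v + f u' v.
Proof. by case=> _ h a u u' v; apply: h. Qed.

Lemma bilinr (k : fieldType) (U V W : lmodType k) (f : U -> V -> W) :
  bilin f -> forall a u v v', f u (a *: v + v') = a *: f u v + f u v'.
Proof. by case=> h _ a u v v'; apply: h. Qed.

(* dtens M N is the direct sum of the tensor products M i (x) N i, i : I,
   as the free module on triples (i, m, n) modulo the bilinearity relations *)
Section DirectSumOfTensors.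
Variables (k : fieldType) (I : Type) (M N : I -> lmodType k).

Definition dgen : Type := {classic {i : I & (M i * N i)%type}}.
Definition dfree : lmodType k := {malg k[dgen]}.
Definition dU (i : I) (m : M i) (n : N i) : dfree :=
  << (existT _ i (m, n) : dgen) >>.

Inductive dtens_rel : dfree -> Prop :=
| dtens_rel_l i (a : k) (m m' : M i) (n : N i) :
    dtens_rel (dU (a *: m + m') n - (a *: dU m n + dU m' n))
| dtens_rel_r i (a : k) (m : M i) (n n' : N i) :
    dtens_rel (dU m (a *: n + n') - (a *: dU m n + dU m n')).

Definition dtens : lmodType k := quom (spanp dtens_rel).

Definition dpure (i : I) (m : M i) (n : N i) : dtens :=
  quom_pi (spanp dtens_rel) (dU m n).

(* Sweedler-type notation: if t is the sum of the m_j (x) n_j then dlift g t is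
   the sum of the g m_j n_j.  It is defined through a chosen decomposition of t
   and is independent of that choice as soon as g is bilinear (dlift_pure,
   dlift_linear). *)
Section Lift.
Variables (U : lmodType k) (g : forall i, M i -> N i -> U).

Definition flift (f : dfree) : U :=
  \sum_(x <- msupp f) f@_x *: g (projT2 x).1 (projT2 x).2.
Definition dlift (t : dtens) : U := flift (quom_repr t).
End Lift.
End DirectSumOfTensors.

Definition tens (k : fieldType) (V W : lmodType k) : lmodType k :=
  dtens (fun _ : unit => V) (fun _ : unit => W).
Definition tpure (k : fieldType) (V W : lmodType k) (v : V) (w : W) : tens V W :=
  @dpure k unit (fun _ => V) (fun _ => W) tt v w.
Notation "v ⊗ w" := (tpure v w) (at level 40, left associativity).
Definition tlift (k : fieldType) (V W U : lmodType k) (t : tens V W)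
  (g : V -> W -> U) : U := dlift (fun _ : unit => g) t.

Section LiftTheory.
Variables (k : fieldType) (I : Type) (M N : I -> lmodType k) (U : lmodType k).
Variable g : forall i, M i -> N i -> U.
Hypothesis gbil : forall i, bilin (@g i).

Lemma fliftE (f : dfree M N) (d : {fset dgen M N}) : (msupp f `<=` d)%fset ->
  flift g f = \sum_(x <- d) f@_x *: g (projT2 x).1 (projT2 x).2.
Proof.
move=> hd; rewrite /flift; apply: big_fset_incl => // x _.
by rewrite -mcoeff_eq0 => /eqP->; rewrite scale0r.
Qed.

Lemma flift_linear : linear (flift g : dfree M N -> U).
Proof.
move=> a u v; pose d := (msupp u `|` msupp v)%fset.
rewrite (@fliftE u d) ?(@fliftE v d) ?(@fliftE (a *: u + v) d)
  ?fsubsetUl ?fsubsetUr //; last first.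
  apply: fsubset_trans (msuppD_le _ _) _.
  by apply: fsetSU; apply: msuppZ_le.
rewrite scaler_sumr -big_split /=; apply: eq_bigr => x _.
by rewrite mcoeffD mcoeffZ scalerDl scalerA.
Qed.
HB.instance Definition _ := GRing.isLinear.Build k (dfree M N) U _
  (flift g : dfree M N -> U) flift_linear.

Lemma flift_dU i m n : flift g (@dU k I M N i m n) = g m n.
Proof.
rewrite (@fliftE _ [fset (existT _ i (m, n) : dgen M N)]%fset) ?msuppU_le //.
by rewrite big_seq_fset1 mcoeffUU scale1r.
Qed.

Lemma flift_rel f : f \in spanp (@dtens_rel k I M N) -> flift g f = 0.
Proof.
move=> /asboolP /(_ (kerp (flift g : {linear dfree M N -> U}))) h.
apply/eqP; apply: h => {f} _ [i a m m' n|i a m n n']; rewrite unfold_in;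
  rewrite linearB linearP /= !flift_dU; case: (@gbil i) => g1 g2.
  by rewrite (g2 n a m m') subrr.
by rewrite (g1 m a n n') subrr.
Qed.

Lemma dlift_pi f : dlift g (quom_pi (spanp (@dtens_rel k I M N)) f) = flift g f.
Proof.
apply/eqP; rewrite -subr_eq0 /dlift -linearB; apply/eqP/flift_rel.
by apply/quom_eq; rewrite quom_reprK.
Qed.

Lemma dlift_pure i m n : dlift g (@dpure k I M N i m n) = g m n.
Proof. by rewrite dlift_pi flift_dU. Qed.

Lemma dlift_linear : linear (dlift g : dtens M N -> U).
Proof.
move=> a x y; rewrite -[x]quom_reprK -[y]quom_reprK.
by rewrite -[X in dlift _ X]linearP !dlift_pi linearP.
Qed.

End LiftTheory.

Lemma dpure_bilin (k : fieldType) (I : Type) (M N : I -> lmodType k) i :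
  bilin (@dpure k I M N i).
Proof.
split=> [m a n n'|n a m m']; rewrite /dpure -[RHS]linearP; apply/quom_eq;
  apply/asboolP => S; apply; [exact: dtens_rel_r | exact: dtens_rel_l].
Qed.

Lemma tlift_pure (k : fieldType) (V W U : lmodType k) (g : V -> W -> U) v w :
  bilin g -> tlift (v ⊗ w) g = g v w.
Proof. by move=> gb; rewrite /tlift dlift_pure. Qed.

Lemma tpure_bilin (k : fieldType) (V W : lmodType k) : bilin (@tpure k V W).
Proof. exact: (@dpure_bilin k unit (fun _ => V) (fun _ => W) tt). Qed.

(* hom x y is the space of morphisms from x to y *)
Record klcat (k : fieldType) := KLCat {
  ob :> Type;
  hom : ob -> ob -> lmodType k;
  idm : forall x, hom x x;
  comp : forall x y z, hom y z -> hom x y -> hom x z;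
  comp_bilin : forall x y z, bilin (@comp x y z);
  compA : forall w x y z (f : hom y z) (g : hom x y) (h : hom w x),
    comp f (comp g h) = comp (comp f g) h;
  comp1m : forall x y (f : hom x y), comp (idm y) f = f;
  compm1 : forall x y (f : hom x y), comp f (idm x) = f }.

Section Modules.
Variables (k : fieldType) (C : klcat k).

Record lmodule := LModule {
  lsp :> C -> lmodType k;
  lact : forall y z, hom y z -> lsp y -> lsp z;
  lact_bilin : forall y z, bilin (@lact y z);
  lactA : forall x y z (f : hom y z) (g : hom x y) m,
    lact f (lact g m) = lact (comp f g) m;
  lact1 : forall y m, lact (idm y) m = m }.

Record rmodule := RModule {
  rsp :> C -> lmodType k;
  ract : forall y z, rsp z -> hom y z -> rsp y;
  ract_bilin : forall y z, bilin (@ract y z);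
  ractA : forall x y z m (f : hom y z) (g : hom x y),
    ract (ract m f) g = ract m (comp f g);
  ract1 : forall y m, ract m (idm y) = m }.

Record rmodule_hom (M N : rmodule) := RModuleHom {
  rhom :> forall z, {linear M z -> N z};
  rhom_ract : forall y z m (f : hom y z),
    rhom y (ract m f) = ract (rhom z m) f }.

Record lmodule_hom (M N : lmodule) := LModuleHom {
  lhom :> forall z, {linear M z -> N z};
  lhom_lact : forall y z (f : hom y z) m,
    lhom z (lact f m) = lact f (lhom y m) }.

(* bsp x y is the component written _yM_x *)
Record bimod := Bimod {
  bsp :> C -> C -> lmodType k;
  bl : forall x y z, hom y z -> bsp x y -> bsp x z;
  br : forall w x y, bsp x y -> hom w x -> bsp w y;
  bl_bilin : forall x y z, bilin (@bl x y z);
  br_bilin : forall w x y, bilin (@br w x y);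
  blA : forall w x y z (f : hom y z) (g : hom x y) (m : bsp w x),
    bl f (bl g m) = bl (comp f g) m;
  brA : forall v w x y (m : bsp x y) (f : hom w x) (g : hom v w),
    br (br m f) g = br m (comp f g);
  bl1 : forall x y (m : bsp x y), bl (idm y) m = m;
  br1 : forall x y (m : bsp x y), br m (idm x) = m;
  blr : forall w x y z (f : hom y z) (m : bsp x y) (g : hom w x),
    bl f (br m g) = br (bl f m) g }.

Record bimod_hom (M N : bimod) := BimodHom {
  bhom :> forall x y, {linear M x y -> N x y};
  bhom_bl : forall x y z (f : hom y z) (m : M x y),
    bhom x z (bl f m) = bl f (bhom x y m);
  bhom_br : forall w x y (m : M x y) (f : hom w x),
    bhom w y (br m f) = br (bhom x y m) f }.

End Modules.

Section TensorOverCategory.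
Variables (k : fieldType) (C : klcat k).

Inductive ctens_rel (M : rmodule C) (N : lmodule C) : dtens M N -> Prop :=
  CTensRel y z (m : M z) (f : hom y z) (n : N y) :
    ctens_rel (dpure (ract m f) n - dpure m (lact f n)).

Definition ctens (M : rmodule C) (N : lmodule C) : lmodType k :=
  quom (spanp (@ctens_rel M N)).

Definition cpure (M : rmodule C) (N : lmodule C) z (m : M z) (n : N z) :
  ctens M N := quom_pi (spanp (@ctens_rel M N)) (dpure m n).

(* if t is the sum of the m_j (x) n_j then clift t g is the sum of the g m_j n_j;
   meaningful when g is bilinear and C-balanced *)
Definition clift (M : rmodule C) (N : lmodule C) (U : lmodType k)
  (t : ctens M N) (g : forall z, M z -> N z -> U) : U := dlift g (quom_repr t).

Definition ctens_mapl (M M' : rmodule C) (N : lmodule C) (f : rmodule_hom M M')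
  (t : ctens M N) : ctens M' N := clift t (fun z m n => cpure (f z m) n).
Definition ctens_mapr (M : rmodule C) (N N' : lmodule C) (f : lmodule_hom N N')
  (t : ctens M N) : ctens M N' := clift t (fun z m n => cpure m (f z n)).

Definition exact_at (A B D : Type) (o : D) (f : A -> B) (g : B -> D) : Prop :=
  forall b, g b = o <-> exists a, b = f a.

Definition lflat (N : lmodule C) : Prop :=
  forall (M' M M'' : rmodule C) (f : rmodule_hom M' M) (g : rmodule_hom M M''),
    (forall z, exact_at 0 (f z) (g z)) ->
    exact_at 0 (ctens_mapl (N := N) f) (ctens_mapl (N := N) g).

Definition rflat (M : rmodule C) : Prop :=
  forall (N' N N'' : lmodule C) (f : lmodule_hom N' N) (g : lmodule_hom N N''),
    (forall z, exact_at 0 (f z) (g z)) ->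
    exact_at 0 (ctens_mapr (M := M) f) (ctens_mapr (M := M) g).

End TensorOverCategory.

Section HochschildMitchell.
Variables (k : fieldType) (C : klcat k).

(* chain n x z: composable (f_n, ..., f_1) with f_1 starting at x and f_n ending
   at z *)
Inductive chain : nat -> C -> C -> Type :=
| cnil x : chain 0%N x x
| ccons n x y z (f : hom y z) (c : chain n x y) : chain n.+1 x z.

(* slot_comb a c c' c'': the three chains agree except in one slot, where the
   entries f, f', f'' satisfy f'' = a f + f' *)
Inductive slot_comb (a : k) :
    forall n x z, chain n x z -> chain n x z -> chain n x z -> Prop :=
| slot_here n x y z (f f' : hom y z) (c : chain n x y) :
    slot_comb a (ccons f c) (ccons f' c) (ccons (a *: f + f') c)
| slot_there n x y z (f : hom y z) (c c' c'' : chain n x y) :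
    slot_comb a c c' c'' ->
    slot_comb a (ccons f c) (ccons f c') (ccons f c'').

Definition multilinear n (M : C -> C -> lmodType k)
    (F : forall x z, chain n x z -> M x z) : Prop :=
  forall a x z (c c' c'' : chain n x z),
    slot_comb a c c' c'' -> F x z c'' = a *: F x z c + F x z c'.

Section Cochains.
Variables (n : nat) (M : bimod C).

(* C^n(C, M) *)
Record coch := Coch {
  cofun :> forall x z, chain n x z -> M x z;
  cofunP : multilinear cofun }.

Lemma cochP (F G : coch) : (forall x z (c : chain n x z), F x z c = G x z c) -> F = G.
Proof.
case: F G => F Fm [G Gm] /= e.
have eFG : F = G by apply: functional_extensionality_dep => x;
  apply: functional_extensionality_dep => z; apply: functional_extensionality_dep.
by case: _ / eFG Gm {e} => Gm; congr Coch; apply: Prop_irrelevance.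
Qed.

HB.instance Definition _ := gen_eqMixin coch.
HB.instance Definition _ := gen_choiceMixin coch.

Fact coch0_subproof : multilinear (fun x z (_ : chain n x z) => 0 : M x z).
Proof. by move=> a x z c c' c'' _; rewrite scaler0 addr0. Qed.
Fact cochN_subproof (F : coch) : multilinear (fun x z c => - F x z c).
Proof.
by move=> a x z c c' c'' h; rewrite (cofunP F h) opprD scalerN.
Qed.
Fact cochD_subproof (F G : coch) : multilinear (fun x z c => F x z c + G x z c).
Proof.
by move=> a x z c c' c'' h; rewrite (cofunP F h) (cofunP G h) scalerDr addrACA.
Qed.
Fact cochZ_subproof b (F : coch) : multilinear (fun x z c => b *: F x z c).
Proof.
by move=> a x z c c' c'' h; rewrite (cofunP F h) scalerDr !scalerA mulrC.
Qed.

Definition coch0 := Coch coch0_subproof.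
Definition cochN F := Coch (cochN_subproof F).
Definition cochD F G := Coch (cochD_subproof F G).
Definition cochZ b F := Coch (cochZ_subproof b F).

Fact cochDA : associative cochD.
Proof. by move=> F G H; apply: cochP => x z c /=; rewrite addrA. Qed.
Fact cochDC : commutative cochD.
Proof. by move=> F G; apply: cochP => x z c /=; rewrite addrC. Qed.
Fact coch0D : left_id coch0 cochD.
Proof. by move=> F; apply: cochP => x z c /=; rewrite add0r. Qed.
Fact cochND : left_inverse coch0 cochN cochD.
Proof. by move=> F; apply: cochP => x z c /=; rewrite addNr. Qed.
HB.instance Definition _ := GRing.isZmodule.Build coch cochDA cochDC coch0D cochND.

Fact cochZA a b F : cochZ a (cochZ b F) = cochZ (a * b) F.
Proof. by apply: cochP => x z c /=; rewrite scalerA. Qed.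
Fact coch1Z : left_id 1 cochZ.
Proof. by move=> F; apply: cochP => x z c /=; rewrite scale1r. Qed.
Fact cochZDr : right_distributive cochZ +%R.
Proof. by move=> a F G; apply: cochP => x z c /=; rewrite scalerDr. Qed.
Fact cochZDl F : {morph cochZ^~ F : a b / a + b}.
Proof. by move=> a b; apply: cochP => x z c /=; rewrite scalerDl. Qed.
HB.instance Definition _ := GRing.Zmodule_isLmodule.Build k coch
  cochZA coch1Z cochZDr cochZDl.
End Cochains.

(* For c = (f_n, ..., f_1) with n > 0:
   first_face c K = K f_n (f_(n-1), ..., f_1),
   inner_faces c K = sum over 0 < i < n of (-1)^i K(c_i), c_i being c with its
     i-th and (i+1)-st entries from the left composed,
   last_face c K = K (f_n, ..., f_2) f_1;
   they are 0 on empty chains. *)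
Section Faces.
Variable (V : zmodType).

Definition first_face n x z (c : chain n x z) :
    (forall y, hom y z -> chain n.-1 x y -> V) -> V :=
  match c in chain n x z
    return (forall y, hom y z -> chain n.-1 x y -> V) -> V with
  | cnil _ => fun _ => 0
  | ccons _ _ _ _ f c' => fun K => K _ f c'
  end.

Fixpoint inner_faces n x z (c : chain n x z) : (chain n.-1 x z -> V) -> V :=
  match c in chain n x z return (chain n.-1 x z -> V) -> V with
  | cnil _ => fun _ => 0
  | ccons n0 x0 y0 z0 f c1 =>
    (match c1 in chain m x1 y1
       return ((chain m.-1 x1 y1 -> V) -> V) ->
              hom y1 z0 -> (chain m x1 z0 -> V) -> V with
     | cnil _ => fun _ _ _ => 0
     | ccons _ _ _ _ g c2 => fun rec f K =>
         - K (ccons (comp f g) c2) - rec (fun c' => K (ccons f c'))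
     end) (inner_faces c1) f
  end.

Fixpoint last_face n x z (c : chain n x z) :
    (forall y, chain n.-1 y z -> hom x y -> V) -> V :=
  match c in chain n x z
    return (forall y, chain n.-1 y z -> hom x y -> V) -> V with
  | cnil _ => fun _ => 0
  | ccons n0 x0 y0 z0 f c1 =>
    (match c1 in chain m x1 y1
       return ((forall y, chain m.-1 y y1 -> hom x1 y -> V) -> V) ->
              hom y1 z0 -> (forall y, chain m y z0 -> hom x1 y -> V) -> V with
     | cnil x1 => fun _ f K => K _ (cnil z0) f
     | ccons _ _ _ _ g c2 => fun rec f K =>
         rec (fun y c' h => K y (ccons f c') h)
     end) (last_face c1) f
  end.

Lemma inner_faces2 n w x y z (f : hom y z) (g : hom x y) (c : chain n w x)
    (K : chain n.+1 w z -> V) :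
  inner_faces (ccons f (ccons g c)) K =
  - K (ccons (comp f g) c) - inner_faces (ccons g c) (fun c' => K (ccons f c')).
Proof. by []. Qed.

Lemma last_face2 n w x y z (f : hom y z) (g : hom x y) (c : chain n w x)
    (K : forall y', chain n.+1 y' z -> hom w y' -> V) :
  last_face (ccons f (ccons g c)) K =
  last_face (ccons g c) (fun y' c' h => K y' (ccons f c') h).
Proof. by []. Qed.
End Faces.
Arguments inner_faces : simpl never.
Arguments last_face : simpl never.

Section FacesTheory.
Variables (V : lmodType k) (a : k).

Lemma inner_faces_combK n x z (c : chain n x z) (K K' K'' : chain n.-1 x z -> V) :
  (forall c', K'' c' = a *: K c' + K' c') ->
  inner_faces c K'' = a *: inner_faces c K + inner_faces c K'.
Proof.
elim: c K K' K'' => [x0|m x0 y0 z0 f c1 IH] K K' K'' hK.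
  by rewrite /inner_faces scaler0 addr0.
case: c1 f K K' K'' hK IH => [y1|m1 x1 y1 z1 g c2] f K K' K'' hK IH.
  by rewrite /inner_faces scaler0 addr0.
rewrite !inner_faces2 hK (IH (fun c' => K (ccons f c')) (fun c' => K' (ccons f c')))
  => [|c']; last by rewrite hK.
by rewrite !opprD scalerDr !scalerN addrACA.
Qed.

Lemma first_face_combK n x z (c : chain n x z)
    (K K' K'' : forall y, hom y z -> chain n.-1 x y -> V) :
  (forall y f d, K'' y f d = a *: K y f d + K' y f d) ->
  first_face c K'' = a *: first_face c K + first_face c K'.
Proof.
case: c K K' K'' => [x0|m x0 y0 z0 f c1] K K' K'' hK /=; last exact: hK.
by rewrite scaler0 addr0.
Qed.

Lemma last_face_combK n x z (c : chain n x z)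
    (K K' K'' : forall y, chain n.-1 y z -> hom x y -> V) :
  (forall y c' h, K'' y c' h = a *: K y c' h + K' y c' h) ->
  last_face c K'' = a *: last_face c K + last_face c K'.
Proof.
elim: c K K' K'' => [x0|m x0 y0 z0 f c1 IH] K K' K'' hK.
  by rewrite /last_face scaler0 addr0.
case: c1 f K K' K'' hK IH => [y1|m1 x1 y1 z1 g c2] f K K' K'' hK IH.
  exact: hK.
by rewrite !last_face2; apply: IH.
Qed.

Lemma first_face_comb n x z (c c' c'' : chain n x z)
    (K : forall y, hom y z -> chain n.-1 x y -> V) :
  slot_comb a c c' c'' ->
  (forall y f f' d, K y (a *: f + f') d = a *: K y f d + K y f' d) ->
  (forall y f d d' d'', slot_comb a d d' d'' -> K y f d'' = a *: K y f d + K y f d') ->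
  first_face c'' K = a *: first_face c K + first_face c' K.
Proof.
by move=> h; case: h K => {n x z c c' c''} [n x y z f f' c|n x y z f c c' c'' h] K hf hc;
  [apply: hf | apply: hc].
Qed.

Lemma inner_faces_comb n x z (c c' c'' : chain n x z) (K : chain n.-1 x z -> V) :
  slot_comb a c c' c'' ->
  (forall d d' d'', slot_comb a d d' d'' -> K d'' = a *: K d + K d') ->
  inner_faces c'' K = a *: inner_faces c K + inner_faces c' K.
Proof.
move=> h; elim: h K => {n x z c c' c''}
  [n x y z f f' c|n x y z f c c' c'' h IH] K hK.
  case: c f f' K hK => [x0|m x0 y0 z0 g c2] f f' K hK.
    by rewrite /inner_faces scaler0 addr0.
  rewrite !inner_faces2; have -> : comp (a *: f + f') g = a *: comp f g + comp f' g.
    exact: (bilinl (@comp_bilin k C _ _ _)).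
  rewrite (hK _ _ _ (slot_here a _ _ _)).
  rewrite (@inner_faces_combK _ _ _ (ccons g c2) (fun c' => K (ccons f c'))
     (fun c' => K (ccons f' c'))) => [|c']; last exact/hK/slot_here.
  by rewrite !opprD scalerDr !scalerN addrACA.
case: h f K hK IH => {n x y c c' c''}
  [n x y w g g' c|n x y w g c c' c'' h] f K hK IH.
  rewrite !inner_faces2; have -> : comp f (a *: g + g') = a *: comp f g + comp f g'.
    exact: (bilinr (@comp_bilin k C _ _ _)).
  rewrite (hK _ _ _ (slot_here a _ _ _)).
  have := IH (fun c' => K (ccons f c')); move=> ->; last first.
    by move=> *; apply/hK/slot_there.
  by rewrite !opprD scalerDr !scalerN addrACA.
rewrite !inner_faces2 (hK _ _ _ (slot_there (comp f g) h)).
have := IH (fun c' => K (ccons f c')); move=> ->; last first.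
  by move=> *; apply/hK/slot_there.
by rewrite !opprD scalerDr !scalerN addrACA.
Qed.

Lemma last_face_comb n x z (c c' c'' : chain n x z)
    (K : forall y, chain n.-1 y z -> hom x y -> V) :
  slot_comb a c c' c'' ->
  (forall y d d' d'' f, slot_comb a d d' d'' -> K y d'' f = a *: K y d f + K y d' f) ->
  (forall y d f f', K y d (a *: f + f') = a *: K y d f + K y d f') ->
  last_face c'' K = a *: last_face c K + last_face c' K.
Proof.
move=> h; elim: h K => {n x z c c' c''}
  [n x y z f f' c|n x y z f c c' c'' h IH] K hK hK'.
  case: c f f' K hK hK' => [x0|m x0 y0 z0 g c2] f f' K hK hK'.
    exact: hK'.
  apply: (@last_face_combK _ _ _ (ccons g c2) (fun y c' h => K y (ccons f c') h)
     (fun y c' h => K y (ccons f' c') h)) => y' c' h.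
  exact/hK/slot_here.
case: h f K hK hK' IH => {n x y c c' c''}
  [n x y w g g' c|n x y w g c c' c'' h] f K hK hK' IH;
  rewrite !last_face2; apply: (IH (fun y c' h => K y (ccons f c') h)) => *;
  by [apply: hK' | apply/hK/slot_there].
Qed.
End FacesTheory.

Section FacesMap.
Variables (V W : lmodType k) (p : {linear V -> W}).

Lemma first_face_map n x z (c : chain n x z)
    (K : forall y, hom y z -> chain n.-1 x y -> V)
    (K' : forall y, hom y z -> chain n.-1 x y -> W) :
  (forall y f d, K' y f d = p (K y f d)) ->
  first_face c K' = p (first_face c K).
Proof.
case: c K K' => [x0|m x0 y z0 f c] K K' hK /=; last exact: hK.
by rewrite linear0.
Qed.

Lemma inner_faces_map n x z (c : chain n x z)
    (K : chain n.-1 x z -> V) (K' : chain n.-1 x z -> W) :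
  (forall d, K' d = p (K d)) -> inner_faces c K' = p (inner_faces c K).
Proof.
elim: c K K' => [x0|m x0 y0 z0 f c1 IH] K K' hK.
  by rewrite /inner_faces linear0.
case: c1 f K K' hK IH => [y1|m1 x1 y1 z1 g c2] f K K' hK IH.
  by rewrite /inner_faces linear0.
rewrite !inner_faces2 hK linearB linearN (IH (fun c' => K (ccons f c'))) //.
Qed.

Lemma last_face_map n x z (c : chain n x z)
    (K : forall y, chain n.-1 y z -> hom x y -> V)
    (K' : forall y, chain n.-1 y z -> hom x y -> W) :
  (forall y d f, K' y d f = p (K y d f)) -> last_face c K' = p (last_face c K).
Proof.
elim: c K K' => [x0|m x0 y0 z0 f c1 IH] K K' hK.
  by rewrite /last_face linear0.
case: c1 f K K' hK IH => [y1|m1 x1 y1 z1 g c2] f K K' hK IH; first exact: hK.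
by rewrite !last_face2; apply: IH.
Qed.
End FacesMap.

Section Differential.
Variables (n : nat) (M : bimod C).

(* the Hochschild differential of F at (f_(n+1), ..., f_1) *)
Definition diff_fun (F : forall x z, chain n x z -> M x z) x z
    (c : chain n.+1 x z) : M x z :=
  first_face c (fun y f c' => bl f (F x y c'))
  + inner_faces c (F x z)
  + (-1) ^+ n.+1 *: last_face c (fun y c' f => br (F y z c') f).

Lemma diff_combE (V : lmodType k) (a b : k) (u u' v v' w w' : V) :
  (a *: u + u') + (a *: v + v') + b *: (a *: w + w') =
  a *: (u + v + b *: w) + (u' + v' + b *: w').
Proof.
rewrite !scalerDr !scalerA [b * a]mulrC.
by rewrite [a *: u + u' + _]addrACA [LHS]addrACA.
Qed.

Fact diff_subproof (F : coch n M) : multilinear (diff_fun F).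
Proof.
move=> a x z c c' c'' h; rewrite /diff_fun.
rewrite (first_face_comb h); first 1 last.
- by move=> y f f' d; exact: (bilinl (@bl_bilin k C M _ _ _)).
- move=> y f d d' d'' hd; rewrite (cofunP F hd).
  exact: (bilinr (@bl_bilin k C M _ _ _)).
rewrite (inner_faces_comb h); last by move=> d d' d'' hd; apply: cofunP hd.
rewrite (last_face_comb h); first 1 last.
- move=> y d d' d'' f hd; rewrite (cofunP F hd).
  exact: (bilinl (@br_bilin k C M _ _ _)).
- by move=> y d f f'; exact: (bilinr (@br_bilin k C M _ _ _)).
exact: diff_combE.
Qed.

Definition diff (F : coch n M) : coch n.+1 M := Coch (diff_subproof F).

Fact diff_linear : linear diff.
Proof.
move=> a F G; apply: cochP => x z c /=; rewrite /diff_fun.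
rewrite (@first_face_combK (M x z) a _ _ _ c (fun y f c' => bl f (F x y c'))
  (fun y f c' => bl f (G x y c'))); last first.
  by move=> y f d; exact: (bilinr (@bl_bilin k C M _ _ _)).
rewrite (@inner_faces_combK (M x z) a _ _ _ c (F x z) (G x z)) //.
rewrite (@last_face_combK (M x z) a _ _ _ c (fun y c' f => br (F y z c') f)
  (fun y c' f => br (G y z c') f)); first exact: diff_combE.
by move=> y f d; exact: (bilinl (@br_bilin k C M _ _ _)).
Qed.
HB.instance Definition _ := GRing.isLinear.Build k (coch n M) (coch n.+1 M) _
  diff diff_linear.
End Differential.

Definition bound n (M : bimod C) : submodClosed (coch n M) :=
  match n with
  | 0 => @zerop k (coch 0%N M)
  | m.+1 => imp (@diff m M : {linear coch m M -> coch m.+1 M})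
  end.

(* H^n(C, M) *)
Definition HM n (M : bimod C) : lmodType k :=
  subquo (kerp (@diff n M : {linear coch n M -> coch n.+1 M})) (bound n M).

Section Functoriality.
Variables (M N : bimod C) (phi : bimod_hom M N).

Fact coch_map_subproof n (F : coch n M) :
  multilinear (fun x z c => phi x z (F x z c)).
Proof. by move=> a x z c c' c'' h; rewrite (cofunP F h) linearP. Qed.

Definition coch_map n (F : coch n M) : coch n N := Coch (coch_map_subproof F).

Fact coch_map_linear n : linear (@coch_map n).
Proof. by move=> a F G; apply: cochP => x z c /=; rewrite linearP. Qed.
HB.instance Definition _ n := GRing.isLinear.Build k (coch n M) (coch n N) _
  (@coch_map n) (@coch_map_linear n).

Lemma diff_coch_map n (F : coch n M) : diff (coch_map F) = coch_map (diff F).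
Proof.
apply: cochP => x z c /=; rewrite /diff_fun !linearD linearZ /=.
rewrite (@first_face_map _ _ (phi x z) _ _ _ c (fun y f c' => bl f (F x y c')));
  last by move=> y f d; rewrite bhom_bl.
rewrite (@inner_faces_map _ _ (phi x z) _ _ _ c (F x z)) //.
rewrite (@last_face_map _ _ (phi x z) _ _ _ c (fun y c' f => br (F y z c') f)) //.
by move=> y d f; rewrite bhom_br.
Qed.

Fact coch_map_ker n (F : coch n M) :
  F \in kerp (@diff n M : {linear coch n M -> coch n.+1 M}) ->
  coch_map F \in kerp (@diff n N : {linear coch n N -> coch n.+1 N}).
Proof.
move=> /eqP h; apply/eqP.
by rewrite -[LHS]/(diff (coch_map F)) diff_coch_map h linear0.
Qed.

Fact coch_map_bound n (F : coch n M) :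
  F \in bound n M -> coch_map F \in bound n N.
Proof.
case: n F => [|n] F; first by move=> /eqP->; apply/eqP; rewrite linear0.
move=> /asboolP[G ->]; apply/asboolP; exists (coch_map G).
by rewrite -[RHS]/(diff (coch_map G)) diff_coch_map.
Qed.

Definition HMmap n : {linear HM n M -> HM n N} :=
  @subquo_map k _ _ _ _ _ _ (@coch_map n : {linear coch n M -> coch n N})
    (@coch_map_ker n) (@coch_map_bound n).
End Functoriality.

End HochschildMitchell.

Section HopfAlgebras.
Variable k : fieldType.

Record hopf := Hopf {
  halg :> algType k;
  delta : {linear halg -> tens halg halg};
  eps : {linear halg -> k^o};
  antipode : {linear halg -> halg};
  deltaA : forall h,
    tlift (delta h) (fun a b => tlift (delta a) (fun a1 a2 => (a1 ⊗ a2) ⊗ b)) =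
    tlift (delta h) (fun a b => tlift (delta b) (fun b1 b2 => (a ⊗ b1) ⊗ b2));
  eps_deltal : forall h, tlift (delta h) (fun a b => eps a *: b) = h;
  eps_deltar : forall h, tlift (delta h) (fun a b => eps b *: a) = h;
  deltaM : forall g h, delta (g * h) =
    tlift (delta g) (fun g1 g2 => tlift (delta h) (fun h1 h2 =>
      (g1 * h1) ⊗ (g2 * h2)));
  delta1 : delta 1 = 1 ⊗ 1;
  epsM : forall g h, eps (g * h) = eps g * eps h;
  eps1 : eps 1 = 1;
  antipodel : forall h, tlift (delta h) (fun a b => antipode a * b) = eps h *: 1;
  antipoder : forall h, tlift (delta h) (fun a b => a * antipode b) = eps h *: 1 }.
Arguments delta {_}.
Arguments eps {_}.
Arguments antipode {_}.

Fact mul_bilin (A : algType k) : bilin (fun a b : A => a * b).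
Proof.
split=> [u a v w|v a u w] /=; first by rewrite mulrDr scalerAr.
by rewrite mulrDl scalerAl.
Qed.

Definition algcat (A : algType k) : klcat k :=
  @KLCat k unit (fun _ _ => A) (fun _ => 1) (fun _ _ _ f g => f * g)
    (fun _ _ _ => mul_bilin A) (fun _ _ _ _ => @mulrA A)
    (fun _ _ => @mul1r A) (fun _ _ => @mulr1 A).

Section RightAction.
Variables (H : hopf) (V : lmodType k).

Record right_action (act : V -> H -> V) : Prop := RightAction {
  ract_bil : bilin act;
  ract_mul : forall v g h, act (act v g) h = act v (g * h);
  ract_one : forall v, act v 1 = v }.

Variable act : V -> H -> V.
Hypothesis actP : right_action act.

Fact eps_bilin : bilin (fun (h : H) (v : V) => (eps h : k) *: v).
Proof.
split=> [h a v w|v a g h] /=; last by rewrite linearP scalerDl scalerA.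
by rewrite scalerDr !scalerA mulrC.
Qed.
Fact eps_actA (g h : H) (v : V) :
  (eps g : k) *: ((eps h : k) *: v) = (eps (g * h) : k) *: v.
Proof. by rewrite epsM scalerA. Qed.
Fact eps_act1 (v : V) : (eps (1 : H) : k) *: v = v.
Proof. by rewrite eps1 scale1r. Qed.
Fact eps_act_comm (g : H) (v : V) (h : H) :
  (eps g : k) *: act v h = act ((eps g : k) *: v) h.
Proof.
rewrite -[_ *: v in RHS]addr0 (bilinl (ract_bil actP)).
have -> : act 0 h = 0; last by rewrite addr0.
have := bilinl (ract_bil actP) (-1) 0 0 h.
by rewrite scaler0 addr0 scaleN1r addNr.
Qed.

Definition Hbimod : bimod (algcat H) :=
  @Bimod k (algcat H) (fun _ _ => V) (fun _ _ _ h v => (eps (h : H) : k) *: v)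
    (fun _ _ _ => act) (fun _ _ _ => eps_bilin) (fun _ _ _ => ract_bil actP)
    (fun _ _ _ _ => eps_actA) (fun _ _ _ _ => ract_mul actP)
    (fun _ _ => eps_act1) (fun _ _ => ract_one actP)
    (fun _ _ _ _ => eps_act_comm).
End RightAction.

Section HbimodHom.
Variables (H : hopf) (V W : lmodType k) (actV : V -> H -> V) (actW : W -> H -> W).
Variables (pV : right_action actV) (pW : right_action actW).
Variable f : {linear V -> W}.
Hypothesis fH : forall v h, f (actV v h) = actW (f v) h.

Fact Hbimod_hom_bl (h : H) v : f ((eps h : k) *: v) = (eps h : k) *: f v.
Proof. exact: linearZ. Qed.

Definition Hbimod_hom : bimod_hom (Hbimod pV) (Hbimod pW) :=
  @BimodHom k (algcat H) (Hbimod pV) (Hbimod pW) (fun _ _ => f)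
    (fun _ _ _ => Hbimod_hom_bl) (fun _ _ _ => fH).
End HbimodHom.

End HopfAlgebras.
Arguments delta {k _}.
Arguments eps {k _}.
Arguments antipode {k _}.

Section ComoduleCategories.
Variables (k : fieldType) (H : hopf k).

Record comodcat := ComodCat {
  ccat :> klcat k;
  coact : forall x y : ccat, {linear hom x y -> tens (hom x y) H};
  coactA : forall x y (f : hom x y),
    tlift (coact x y f) (fun f0 f1 => tlift (coact x y f0) (fun a b => (a ⊗ b) ⊗ f1)) =
    tlift (coact x y f) (fun f0 f1 => tlift (delta f1) (fun a b => (f0 ⊗ a) ⊗ b));
  coact_eps : forall x y (f : hom x y),
    tlift (coact x y f) (fun f0 f1 => (eps f1 : k) *: f0) = f;
  coact_idm : forall x, coact x x (idm x) = idm x ⊗ 1;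
  coact_comp : forall x y z (f : hom y z) (g : hom x y),
    coact x z (comp f g) =
    tlift (coact y z f) (fun f0 f1 => tlift (coact x y g) (fun g0 g1 =>
      comp f0 g0 ⊗ (f1 * g1))) }.

Variable D : comodcat.

Definition coinvp (x y : D) : {pred hom x y} :=
  fun f => coact x y f == f ⊗ 1.

Fact coinvp_submod x y : GRing.submod_closed (@coinvp x y).
Proof.
have tb := @tpure_bilin k (hom x y) H; split=> [|a f g].
  rewrite unfold_in linear0; apply/eqP.
  by have /= := bilinl tb (-1) 0 0 1; rewrite scaler0 addr0 scaleN1r addNr.
rewrite !unfold_in => /eqP hf /eqP hg; apply/eqP.
by rewrite linearP hf hg (bilinl tb).
Qed.
HB.instance Definition _ x y :=
  GRing.isSubmodClosed.Build k (hom x y) (@coinvp x y) (@coinvp_submod x y).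

Fact coinv_idm x : idm x \in @coinvp x x.
Proof. by apply/eqP; rewrite coact_idm. Qed.

Fact coinv_comp x y z (f : hom y z) (g : hom x y) :
  f \in @coinvp y z -> g \in @coinvp x y -> comp f g \in @coinvp x z.
Proof.
move=> /eqP hf /eqP hg; apply/eqP; rewrite coact_comp hf hg.
have tb := @tpure_bilin k (hom x z) H.
have cb := @comp_bilin k D x y z.
have e (f0 : hom y z) (f1 : H) : tlift (g ⊗ (1 : H)) (fun g0 g1 => comp f0 g0 ⊗ (f1 * g1)) =
    comp f0 g ⊗ (f1 * 1).
  rewrite tlift_pure //; split=> [u a v w|v a u w] /=.
    by rewrite mulrDr -scalerAr (bilinr tb).
  by rewrite (bilinr cb) (bilinl tb).
rewrite (_ : (fun f0 f1 => _) = (fun f0 f1 => comp f0 g ⊗ (f1 * 1))); last first.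
  by apply: functional_extensionality_dep => f0;
     apply: functional_extensionality_dep => f1.
rewrite tlift_pure ?mulr1 //; split=> [u a v w|v a u w] /=.
  by rewrite mulrDl -scalerAl (bilinr tb).
by rewrite (bilinl cb) (bilinl tb).
Qed.

Definition coinv_hom x y : lmodType k := subm (@coinvp x y).
Definition coinv_id x : coinv_hom x x := exist _ (idm x) (coinv_idm x).
Definition coinv_cp x y z (f : coinv_hom y z) (g : coinv_hom x y) : coinv_hom x z :=
  exist _ (comp (val f) (val g)) (coinv_comp (valP f) (valP g)).

Fact coinv_cp_bilin x y z : bilin (@coinv_cp x y z).
Proof.
split=> [u a v w|v a u w]; apply: val_inj; rewrite [RHS]linearP.
  rewrite -[LHS]/(comp (val u) (val (a *: v + w))) linearP.
  exact: (bilinr (@comp_bilin k D x y z)).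
rewrite -[LHS]/(comp (val (a *: u + w)) (val v)) linearP.
exact: (bilinl (@comp_bilin k D x y z)).
Qed.
Fact coinv_cpA w x y z (f : coinv_hom y z) (g : coinv_hom x y) (h : coinv_hom w x) :
  coinv_cp f (coinv_cp g h) = coinv_cp (coinv_cp f g) h.
Proof. by apply: val_inj; apply: compA. Qed.
Fact coinv_cp1m x y (f : coinv_hom x y) : coinv_cp (coinv_id y) f = f.
Proof. by apply: val_inj; apply: comp1m. Qed.
Fact coinv_cpm1 x y (f : coinv_hom x y) : coinv_cp f (coinv_id x) = f.
Proof. by apply: val_inj; apply: compm1. Qed.

(* the subcategory of coinvariants D^coH *)
Definition coinv : klcat k :=
  KLCat coinv_cp_bilin coinv_cpA coinv_cp1m coinv_cpm1.

(* the left coinv-module z |-> hom y z and the right one z |-> hom z x *)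
Section Representables.

Fact cov_bilin w (y z : D) : bilin (fun (f : coinv_hom y z) (m : hom w y) => comp (val f) m).
Proof.
split=> [u a v t|v a u t] /=; first exact: (bilinr (@comp_bilin k D w y z)).
rewrite -[LHS]/(comp (val (a *: u + t)) v) linearP.
exact: (bilinl (@comp_bilin k D w y z)).
Qed.
Fact contra_bilin w (y z : D) : bilin (fun (m : hom z w) (f : coinv_hom y z) => comp m (val f)).
Proof.
split=> [u a v t|v a u t] /=; last exact: (bilinl (@comp_bilin k D y z w)).
rewrite -[LHS]/(comp u (val (a *: v + t))) linearP.
exact: (bilinr (@comp_bilin k D y z w)).
Qed.

Definition cov (y : D) : lmodule coinv :=
  @LModule k coinv (fun z : D => hom y z)
    (fun (w z : D) (f : coinv_hom w z) (m : hom y w) => comp (val f) m)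
    (@cov_bilin y) (fun (u v w : D) (f : coinv_hom v w) (g : coinv_hom u v) m =>
       compA (val f) (val g) m)
    (fun _ m => comp1m m).

Definition contra (x : D) : rmodule coinv :=
  @RModule k coinv (fun z : D => hom z x)
    (fun (y z : D) (m : hom z x) (f : coinv_hom y z) => comp m (val f))
    (@contra_bilin x) (fun (u v w : D) m (f : coinv_hom v w) (g : coinv_hom u v) =>
       esym (compA m (val f) (val g)))
    (fun _ m => compm1 m).
End Representables.

(* the component at (x, y) of D (x)_coinv D is ctens (contra x) (cov y) *)
Definition galois_map (x y : D) (t : ctens (contra x) (cov y)) : tens (hom y x) H :=
  clift t (fun (z : D) (f : hom z x) (g : hom y z) =>
    tlift (coact y z g) (fun g0 g1 => comp f g0 ⊗ g1)).

Definition galois : Prop := forall x y, bijective (@galois_map x y).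

Definition left_flat : Prop := forall y, lflat (cov y).
Definition right_flat : Prop := forall x, rflat (contra x).

Section Restriction.
Variable M : bimod D.

Fact restr_bl_bilin x y z :
  bilin (fun (f : coinv_hom y z) (m : M x y) => bl (val f) m).
Proof.
split=> [u a v t|v a u t] /=; first exact: (bilinr (@bl_bilin k D M x y z)).
rewrite -[LHS]/(bl (val (a *: u + t)) v) linearP.
exact: (bilinl (@bl_bilin k D M x y z)).
Qed.
Fact restr_br_bilin w x y :
  bilin (fun (m : M x y) (f : coinv_hom w x) => br m (val f)).
Proof.
split=> [u a v t|v a u t] /=; last exact: (bilinl (@br_bilin k D M w x y)).
rewrite -[LHS]/(br u (val (a *: v + t))) linearP.
exact: (bilinr (@br_bilin k D M w x y)).
Qed.

Definition restr : bimod coinv :=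
  @Bimod k coinv (fun x y => M x y)
    (fun (x y z : D) (f : coinv_hom y z) (m : M x y) => bl (val f) m)
    (fun (w x y : D) (m : M x y) (f : coinv_hom w x) => br m (val f)) restr_bl_bilin restr_br_bilin
    (fun (w x y z : D) (f : coinv_hom y z) (g : coinv_hom x y) m =>
       blA (val f) (val g) m)
    (fun (v w x y : D) m (f : coinv_hom w x) (g : coinv_hom v w) =>
       brA m (val f) (val g))
    (fun _ _ m => bl1 m) (fun _ _ m => br1 m)
    (fun (w x y z : D) (f : coinv_hom y z) m (g : coinv_hom w x) =>
       blr (val f) m (val g)).
End Restriction.

Definition restr_hom (M N : bimod D) (phi : bimod_hom M N) :
    bimod_hom (restr M) (restr N) :=
  @BimodHom k coinv (restr M) (restr N) (fun x y => phi x y)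
    (fun (x y z : D) (f : coinv_hom y z) m => bhom_bl phi (val f) m)
    (fun (w x y : D) m (f : coinv_hom w x) => bhom_br phi m (val f)).

(* degree 0 cochains are the families (m_x)_x *)
Definition coch0_val (M : bimod D) (m : coch 0%N (restr M)) (x : D) : M x x :=
  m x x (@cnil k coinv x).

(* For m in H^0(coinv, M): the relation m' = m . h, where
   (m . h)_x = sum_i r_(i,x)(h) m_(y_i) l_(i,x)(h) and
   sum_i r_(i,x)(h) (x) l_(i,x)(h) is the preimage of 1_x (x) h under galois_map.
   Only used for m in H^0(coinv, M), where the map r (x) l |-> r m l is balanced. *)
Definition H0_act (M : bimod D) (m : coch 0%N (restr M)) (h : H)
    (m' : coch 0%N (restr M)) : Prop :=
  forall x : D, exists2 t : ctens (contra x) (cov x),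
    galois_map t = idm x ⊗ h &
    coch0_val m' x = clift t (fun (y : D) (r : hom y x) (l : hom x y) =>
      bl r (br (coch0_val m y) l)).

End ComoduleCategories.

Section InjectiveResolutions.
Variables (k : fieldType) (D : klcat k).

Definition injective_bimod (J : bimod D) : Prop :=
  forall (M N : bimod D) (i : bimod_hom M N) (f : bimod_hom M J),
    (forall x y, injective (i x y)) ->
    exists g : bimod_hom N J, forall x y m, g x y (i x y m) = f x y m.

Record injres (M : bimod D) := InjRes {
  ir_bimod :> nat -> bimod D;
  ir_injective : forall j, injective_bimod (ir_bimod j);
  ir_aug : bimod_hom M (ir_bimod 0%N);
  ir_diff : forall j, bimod_hom (ir_bimod j) (ir_bimod j.+1);
  ir_aug_inj : forall x y, injective (ir_aug x y);
  ir_exact0 : forall x y, exact_at 0 (ir_aug x y) (ir_diff 0%N x y);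
  ir_exactS : forall j x y, exact_at 0 (ir_diff j x y) (ir_diff j.+1 x y) }.
End InjectiveResolutions.

Section DerivedAction.
Variables (k : fieldType) (H : hopf k) (D : comodcat H).

Notation C := (coinv D).

(* Staircases in the double complex C^i(C, I^j): for a cocycle F of C^q(C, M),
   staircase (aug F) u says that u, an element of H^0(C, I^q) killed by the
   differential of I, corresponds to F under the isomorphism (through the total
   complex, up to a sign depending only on q) of H^q(C, M) with the q-th
   cohomology of H^0(C, I), which is the q-th right derived functor of H^0(C, -)
   at M.  Since the action of H is linear, the sign does not matter. *)
Inductive staircase (M : bimod D) (I : injres M) :
    forall i j, coch i (restr (I j)) ->
    forall m, coch 0%N (restr (I m)) -> Prop :=
| stair_end j (u : coch 0%N (restr (I j))) : staircase u u
| stair_step i j (w : coch i (restr (I j))) m (u : coch 0%N (restr (I m))) :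
    staircase (coch_map (restr_hom (ir_diff I j)) w) u ->
    staircase (diff w) u.

(* The right H-module structure of the H^q(C, M), as the right derived functors
   of the functor H^0(C, -) from D-bimodules to right H-modules: the action is
   transported from the cohomology of H^0(C, I), for any injective resolution I
   of M.  By dact_injres and dact_derived there is at most one such structure. *)
Record derived_action := DerivedAction {
  dact : forall q (M : bimod D), HM q (restr M) -> H -> HM q (restr M);
  dactP : forall q M, right_action (@dact q M);
  dact_natural : forall q (M N : bimod D) (phi : bimod_hom M N) v h,
    HMmap (restr_hom phi) q (dact v h) = dact (HMmap (restr_hom phi) q v) h;
  dact_injres : forall M : bimod D, inhabited (injres M);
  dact_derived : forall (M : bimod D) (I : injres M) q (v : HM q (restr M)) (h : H),
    exists (F G : coch q (restr M)) (u u' : coch 0%N (restr (I q))),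
      [/\ diff F = 0 /\ diff G = 0,
          v = cls _ _ F /\ dact v h = cls _ _ G,
          staircase (coch_map (restr_hom (ir_aug I)) F) u,
          staircase (coch_map (restr_hom (ir_aug I)) G) u' &
          H0_act u h u'] }.

End DerivedAction.

Section SpectralSequences.
Variable k : fieldType.

(* First quadrant cohomological spectral sequences; the pages are the
   ss_page r, r >= 2.  The differentials are given as matrices: ss_d r p q p' q'
   is the component from bidegree (p, q) to (p', q'), which is 0 unless
   (p', q') = (p + r, q - r + 1). *)
Record spectral_sequence (E2 : nat -> nat -> lmodType k) (A : nat -> lmodType k) :=
  SpectralSequence {
  ss_page : nat -> nat -> nat -> lmodType k;
  ss_d : forall r p q p' q', {linear ss_page r p q -> ss_page r p' q'};
  ss_d_bideg : forall r p q p' q', (2 <= r)%N ->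
    ~ (p' = p + r /\ q' + r = q.+1)%N -> forall v, ss_d r p q p' q' v = 0;
  ss_d_sq : forall r p q p' q' p'' q'' v, (2 <= r)%N ->
    ss_d r p' q' p'' q'' (ss_d r p q p' q' v) = 0;
  (* the next page is the homology; truncated subtraction is harmless by
     ss_d_bideg *)
  ss_next : forall r p q, {linear ss_page r.+1 p q ->
    subquo (kerp (ss_d r p q (p + r)%N (q.+1 - r)%N))
           (imp (ss_d r (p - r)%N (q + r.-1)%N p q))};
  ss_next_bij : forall r p q, (2 <= r)%N -> bijective (ss_next r p q);
  ss_second : forall p q, {linear ss_page 2%N p q -> E2 p q};
  ss_second_bij : forall p q, bijective (ss_second p q);
  (* convergence to A; ss_page (p + q).+2 p q is the stable value at (p, q) *)
  ss_fil : forall n, nat -> submodClosed (A n);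
  ss_fil0 : forall n v, v \in ss_fil n 0%N;
  ss_filS : forall n p v, v \in ss_fil n p.+1 -> v \in ss_fil n p;
  ss_fil_end : forall n v, v \in ss_fil n n.+1 -> v = 0;
  ss_gr : forall p q, {linear
    subquo (ss_fil (p + q)%N p) (ss_fil (p + q)%N p.+1) ->
    ss_page (p + q).+2%N p q};
  ss_gr_bij : forall p q, bijective (ss_gr p q) }.

Section Morphisms.
Variables (E2 E2' : nat -> nat -> lmodType k) (A A' : nat -> lmodType k).
Variables (S : spectral_sequence E2 A) (S' : spectral_sequence E2' A').
Variable a : forall p q, {linear E2 p q -> E2' p q}.
Variable b : forall n, {linear A n -> A' n}.

(* f is a morphism of spectral sequences given by a on the second page and
   compatible with b on the abutment *)
Record ss_morphism
    (f : forall r p q, {linear ss_page S r p q -> ss_page S' r p q}) : Prop :=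
  SSMorphism {
  ssm_d : forall r p q p' q' v, (2 <= r)%N ->
    f r p' q' (ss_d S r p q p' q' v) = ss_d S' r p q p' q' (f r p q v);
  ssm_next : forall r p q w v, (2 <= r)%N ->
    v \in kerp (ss_d S r p q (p + r)%N (q.+1 - r)%N) ->
    ss_next S r p q w = cls _ _ v ->
    ss_next S' r p q (f r.+1 p q w) = cls _ _ (f r p q v);
  ssm_second : forall p q v,
    ss_second S' p q (f 2%N p q v) = a p q (ss_second S p q v);
  ssm_fil : forall n p v, v \in ss_fil S n p -> b n v \in ss_fil S' n p;
  ssm_gr : forall p q v, v \in ss_fil S (p + q)%N p ->
    f (p + q).+2%N p q (ss_gr S p q (cls _ _ v)) =
    ss_gr S' p q (cls _ _ (b (p + q)%N v)) }.
End Morphisms.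
End SpectralSequences.

Section E2Page.
Variables (k : fieldType) (H : hopf k) (D : comodcat H) (R : derived_action D).

(* H^p(H, H^q(coinv D, M)) *)
Definition E2 (M : bimod D) (p q : nat) : lmodType k :=
  HM p (Hbimod (dactP R q M)).

Definition E2map (M N : bimod D) (phi : bimod_hom M N) p q :
    {linear E2 M p q -> E2 N p q} :=
  HMmap (Hbimod_hom (dactP R q M) (dactP R q N) (dact_natural R (q := q) phi)) p.
End E2Page.

(* Main.v *)
Require Import Defs.
From HB Require Import structures.
From mathcomp Require Import all_boot all_algebra.
From mathcomp Require Import finmap boolp classical_sets monalg.
(* all_algebra has its own hom *)
Import Defs.

(** The spectral sequence is that of the composite of the functors H^0(C, -),
from D-bimodules to right H-modules, and Hom_H(k, -).  Let I be an injective
resolution of the D-bimodule M.  The Galois condition gives the action of H on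
H^0(C, M) and the identity

  sum f_(0) (m . h f_(1)) = (m . h) f   for all f in D,

whence the H-invariants of H^0(C, M) are H^0(D, M).  Filter by p the double
complex C^p(H, H^0(C, I^q)).  Taking cohomology in the direction of q first
gives H^p(H, H^q(C, M)), because injective D-bimodules are C-acyclic; taking it
in the direction of p first gives H^0(D, I^q), hence H^n(D, M), because
H^0(C, I^q) is H-acyclic.

N is acyclic as soon as its embedding into the coinduced bimodule Hom_k(C, N) has
a bimodule retraction: applied to a cocycle evaluated at chains with one more
entry on the right, the retraction gives a primitive of that cocycle.  Since
every injective D-bimodule is a retract of a cofree one E, such retractions are
needed only for E: over C, the components of E are dual to the left modules
hom a -, and flatness makes these duals injective right C-modules; over H,
H^0(C, E) is itself coinduced. *)

Set Implicit Arguments.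
Unset Strict Implicit.
Unset Printing Implicit Defensive.

Import GRing.Theory.
Local Open Scope ring_scope.

(** * Linear algebra *)

(** Write tau(h) for the preimage of 1 ⊗ h under the Galois map. The preimage of f ⊗ h is then f
    tau(h), while tau(h) f is mapped to sum f_(0) ⊗ h f_(1); inserting m between the two tensor
    factors turns this into the stated identity. The same identity makes H^0(C, E) coinduced for E
    cofree: at h = 1 it reads m(g, f) = sum (m . f_(1))(g f_(0), 1), so that m is encoded by a
    function of g f_(0) and f_(1).

    The difficulty is that the action of H on H^q(C, M) is defined only through injective
    resolutions. Classes have to be carried between cochains of C, central families in I and the
    total complex, each time by choices that are not canonical. Every comparison is therefore a
    linear relation between cocycles, which becomes a bijective linear map only on cohomology.

    Since k is a field, every linear map f has a linear g with f g f = f. Applied to the values of a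
    cochain, g keeps it multilinear, so that exactness of coefficients passes to cochains. *)

Section LinearMaps.
Variable k : fieldType.

Fact mklin_subproof (U V : lmodType k) (f : U -> V) (fl : linear f) :
  {g : {linear U -> V} | forall u, g u = f u}.
Proof. by exists (HB.pack_for {linear U -> V} f (GRing.isLinear.Build k U V _ f fl)). Qed.
(* opaque, so that simplification does not unfold the maps defined with it *)
Definition mklin (U V : lmodType k) (f : U -> V) (fl : linear f) : {linear U -> V} :=
  sval (mklin_subproof fl).
Lemma mklinE (U V : lmodType k) (f : U -> V) (fl : linear f) u : mklin fl u = f u.
Proof. exact: (svalP (mklin_subproof fl)). Qed.

(** Uniqueness is asked only at 0, because a difference of two values at [u] is a value at 0. Maps
    that depend on arbitrary choices are obtained from their graphs in this way. *)
Lemma linrel_map (U W : lmodType k) (r : U -> W -> Prop) :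
  (forall u, exists w, r u w) ->
  (forall a u u' w w', r u w -> r u' w' -> r (a *: u + u') (a *: w + w')) ->
  (forall w, r 0 w -> w = 0) ->
  exists f : {linear U -> W}, forall u w, r u w <-> f u = w.
Proof.
move=> rt rl r0.
have ru u w w' : r u w -> r u w' -> w = w'.
  move=> h h'; have := rl (-1) _ _ _ _ h' h.
  by rewrite !scaleN1r addNr => /r0 /eqP; rewrite addrC subr_eq0 => /eqP.
pose f u := sval (cid (rt u)); have fP u : r u (f u) by rewrite /f; case: cid.
have fl : linear f by move=> a u v; apply: ru (fP _) _; apply: rl.
exists (mklin fl) => u w; rewrite mklinE; split=> [h|<-]; last exact: fP.
exact: ru (fP u) h.
Qed.

(** Zorn's lemma also asks for the union of the empty chain, so containing 0 cannot be part of the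
    property; this is why the last clause allows [u = 0] separately. *)
Lemma complement (V : lmodType k) (S : submodClosed V) :
  exists X : set V,
    [/\ forall a u v, X u -> X v -> X (a *: u + v),
        forall u, X u -> u \in S -> u = 0 &
        forall v, exists u, (X u \/ u = 0) /\ v - u \in S].
Proof.
pose P (X : set V) := (forall a u v, X u -> X v -> X (a *: u + v)) /\
  (forall u, X u -> u \in S -> u = 0).
have [|X [[Xl X0] Xm]] := @Zorn_bigcup V P.
  move=> F FP Ft; split=> [a u v [A FA Au] [B FB Bv]|u [A FA Au]]; last first.
    by case: (FP _ FA) => _; apply.
  have [AB|BA] := Ft _ _ FA FB.
    by exists B => //; case: (FP _ FB) => + _; apply=> //; apply: AB.
  by exists A => //; case: (FP _ FA) => + _; apply=> //; apply: BA.
exists X; split=> // v; apply: contrapT => nv.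
pose X' : set V := fun w => exists a x, (X x \/ x = 0) /\ w = a *: v + x.
have Xl' a u w : (X u \/ u = 0) -> (X w \/ w = 0) -> (X (a *: u + w) \/ a *: u + w = 0).
  case=> [hu|->] [hw|->]; rewrite ?scaler0 ?addr0 ?add0r; [left|left|left|right] => //.
    exact: Xl.
  (* As 0 need not lie in [X], its closure property gives a multiple only in the form of a
     combination of two members. *)
  have -> : a *: u = (a - 1) *: u + u by rewrite scalerBl scale1r subrK.
  exact: Xl.
apply: (Xm X'); last first.
  split=> [a u w [b [x [hx ->]]] [c [y [hy ->]]]|u [a [x [hx ->]]] hS].
    exists (a * b + c), (a *: x + y); split; first exact: Xl'.
    by rewrite scalerDl scalerDr -scalerA addrACA.
  case: (eqVneq a 0) hS => [->|a0] hS.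
    rewrite scale0r add0r in hS *; by case: hx => [hx|->//]; apply: X0.
  (* If [a *: v + x] were in [S] with [a] nonzero, dividing by [a] would decompose [v] modulo
     [S]. *)
  case: nv; exists (- a^-1 *: x); split.
    by rewrite -[_ *: x]addr0; apply: Xl' => //; right.
  suff -> : v - - a^-1 *: x = a^-1 *: (a *: v + x) by apply: rpredZ.
  by rewrite scaleNr opprK scalerDr scalerA mulVf // scale1r.
split=> [x hx|sub]; first by exists 0, x; rewrite scale0r add0r; split; [left|].
case: nv; exists v; rewrite subrr rpred0; split=> //; left; apply: sub.
by exists 1, 0; rewrite scale1r addr0; split; [right|].
Qed.

Lemma projector (V : lmodType k) (S : submodClosed V) :
  exists p : {linear V -> V}, (forall v, p v \in S) /\ (forall v, v \in S -> p v = v).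
Proof.
have [X [Xl X0 Xt]] := complement S.
have [|a u u' w w' [hw hu] [hw' hu']|w [hw hX]|p hp] :=
  @linrel_map V V (fun v s => s \in S /\ (X (v - s) \/ v - s = 0)).
- move=> v; have [u [hu hv]] := Xt v; exists (v - u); split=> //.
  by rewrite opprB addrC subrK.
- split; first by rewrite rpredD ?rpredZ.
  have -> : a *: u + u' - (a *: w + w') = a *: (u - w) + (u' - w').
    by rewrite scalerBr opprD addrACA.
  case: hu hu' => [hu|->] [hu'|->]; rewrite ?scaler0 ?addr0 ?add0r;
    [left|left|left|right] => //; first exact: Xl.
  have -> : a *: (u - w) = (a - 1) *: (u - w) + (u - w) by rewrite scalerBl scale1r subrK.
  exact: Xl.
- move: hX; rewrite sub0r => -[hX|/eqP]; last by rewrite oppr_eq0 => /eqP.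
  by apply/eqP; rewrite -oppr_eq0; apply/eqP; apply: X0; rewrite // -scaleN1r rpredZ.
exists p; split=> v; first by have /hp[] := erefl (p v).
by move=> hv; apply/hp; rewrite subrr; split=> //; right.
Qed.

(** With [p] a projector onto the kernel, the preimage [v - p v] of [f v] depends only on [f v],
    hence linearly; a projector onto the image extends the choice to all of [W]. *)
Lemma gen_inverse (V W : lmodType k) (f : {linear V -> W}) :
  exists g : {linear W -> V}, forall v, f (g (f v)) = f v.
Proof.
have [p [pk pid]] := projector (kerp f); have [q [qi qid]] := projector (imp f).
have [w|a u u' w w' [v [hv ->]] [v' [hv' ->]]|w [v [hv ->]]|g hg] :=
  @linrel_map W V (fun w x => exists v, q w = f v /\ x = v - p v).
- by have /asboolP[v hv] := qi w; exists (v - p v), v.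
- exists (a *: v + v'); split; first by rewrite !linearP hv hv'.
  by rewrite linearP scalerBr opprD addrACA.
- by rewrite pid ?subrr //; apply/eqP; rewrite -hv linear0.
exists g => v; have /hg[v' [hv' ->]] := erefl (g (f v)).
have /eqP h := pk v'; rewrite linearB h subr0 -hv' qid //.
by apply/asboolP; exists v.
Qed.

Lemma gen_inverse_inj (V W : lmodType k) (f : {linear V -> W}) :
  injective f -> exists g : {linear W -> V}, cancel f g.
Proof. by move=> fi; have [g gP] := gen_inverse f; exists g => v; apply: fi. Qed.

Lemma linear_inv (V W : lmodType k) (f : {linear V -> W}) :
  bijective f -> exists g : {linear W -> V}, cancel f g /\ cancel g f.
Proof.
move=> fb; have [g gK] := gen_inverse_inj (bij_inj fb); exists g; split=> // w.
by have [h _ hK] := fb; rewrite -[w]hK gK.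
Qed.

Lemma cls0 (V : lmodType k) (S T : submodClosed V) : cls S T 0 = 0.
Proof.
have := clsL T 1 (rpred0 S) (rpred0 S).
by rewrite !scale1r addr0 => /eqP; rewrite -subr_eq0 opprD addNKr oppr_eq0 => /eqP.
Qed.

Lemma cls_eq0 (V : lmodType k) (S T : submodClosed V) v : v \in S ->
  cls S T v = 0 <-> v \in T.
Proof. by move=> hv; rewrite -(cls0 S T) clsP ?rpred0 // subr0. Qed.

Lemma cls_surj (V : lmodType k) (S T : submodClosed V) (x : subquo S T) :
  exists2 v, v \in S & x = cls S T v.
Proof. by exists (rep x); rewrite ?repK ?repP. Qed.

Definition linrel (V W : lmodType k) (r : V -> W -> Prop) : Prop :=
  forall a v v' w w', r v w -> r v' w' -> r (a *: v + v') (a *: w + w').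

Lemma subquo_rel_map (V W : lmodType k) (S T : submodClosed V) (r : V -> W -> Prop) :
  linrel r ->
  (forall v, v \in S -> exists w, r v w) ->
  (forall v w, v \in S -> v \in T -> r v w -> w = 0) ->
  exists f : {linear subquo S T -> W}, forall v w, v \in S -> r v w -> f (cls S T v) = w.
Proof.
move=> rl rt r0.
have [x|a u u' w w' [v [hv -> hr]] [v' [hv' -> hr']]|w [v [hv e hr]]|f hf] :=
  @linrel_map (subquo S T) W (fun x w => exists v, [/\ v \in S, x = cls S T v & r v w]).
- by have [v hv ->] := cls_surj x; have [w hw] := rt v hv; exists w, v.
- exists (a *: v + v'); rewrite clsL //; split=> //; first by rewrite rpredD ?rpredZ.
  exact: rl.
- by apply: r0 (hv) _ hr; apply/(cls_eq0 T hv).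
by exists f => v w hv hr; apply/hf; exists v.
Qed.

(** [r] may relate one element to many. The last hypothesis, read from left to right, makes the
    class of [w] depend only on that of [v]; from right to left it gives injectivity. The next page,
    the graded pieces of the limit, the second page and the abutment are all identified with this
    lemma. *)
Lemma subquo_rel_bij (V W : lmodType k) (S T : submodClosed V)
    (S' T' : submodClosed W) (r : V -> W -> Prop) :
  linrel r ->
  (forall v, v \in S -> exists w, r v w) ->
  (forall w, w \in S' -> exists2 v, v \in S & r v w) ->
  (forall v w, r v w -> w \in S') ->
  (forall v w, v \in S -> r v w -> (v \in T <-> w \in T')) ->
  exists2 f : {linear subquo S T -> subquo S' T'}, bijective f &
    forall v w, v \in S -> r v w -> f (cls S T v) = cls S' T' w.
Proof.
move=> rl rt rs rS rT.
have [a v v' ? ? [w hw ->] [w' hw' ->]|v hv|v ? hv hT [w hw ->]|f hf] :=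
  @subquo_rel_map V (subquo S' T') S T (fun v y => exists2 w, r v w & y = cls S' T' w).
- exists (a *: w + w'); first exact: rl.
  by rewrite clsL ?(rS _ _ hw) ?(rS _ _ hw').
- by have [w hw] := rt v hv; exists (cls S' T' w), w.
- by apply/(cls_eq0 T' (rS _ _ hw))/(rT _ _ hv hw).
have fE v w : v \in S -> r v w -> f (cls S T v) = cls S' T' w.
  by move=> hv hw; apply: hf => //; exists w.
exists f => //.
have fi x : f x = 0 -> x = 0.
  have [v hv ->] := cls_surj x; have [w hw] := rt v hv.
  rewrite (fE _ _ hv hw) => /(cls_eq0 T' (rS _ _ hw)) h.
  by apply/(cls_eq0 T hv)/(rT _ _ hv hw).
have fs y : exists x, f x = y.
  have [w hw ->] := cls_surj y; have [v hv h] := rs w hw.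
  by exists (cls S T v); apply: fE.
exists (fun y => sval (cid (fs y))) => [x|y]; case: cid => //= z hz.
by apply/eqP; rewrite -subr_eq0; apply/eqP/fi; rewrite linearB hz subrr.
Qed.

Section DependentProducts.
Variables (I : Type) (T : I -> lmodType k).
Definition dprod : Type := forall i, T i.
HB.instance Definition _ := gen_eqMixin dprod.
HB.instance Definition _ := gen_choiceMixin dprod.

Lemma dprodP (f g : dprod) : (forall i, f i = g i) -> f = g.
Proof. exact: functional_extensionality_dep. Qed.

Let add (f g : dprod) : dprod := fun i => f i + g i.
Let opp (f : dprod) : dprod := fun i => - f i.
Let zero : dprod := fun i => 0.
Let scale (a : k) (f : dprod) : dprod := fun i => a *: f i.
Fact dprod_addA : associative add.
Proof. by move=> f g h; apply: dprodP => i; apply: addrA. Qed.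
Fact dprod_addC : commutative add.
Proof. by move=> f g; apply: dprodP => i; apply: addrC. Qed.
Fact dprod_add0 : left_id zero add.
Proof. by move=> f; apply: dprodP => i; apply: add0r. Qed.
Fact dprod_addN : left_inverse zero opp add.
Proof. by move=> f; apply: dprodP => i; apply: addNr. Qed.
HB.instance Definition _ := GRing.isZmodule.Build dprod
  dprod_addA dprod_addC dprod_add0 dprod_addN.
Fact dprod_scaleA a b f : scale a (scale b f) = scale (a * b) f.
Proof. by apply: dprodP => i; apply: scalerA. Qed.
Fact dprod_scale1 : left_id 1 scale.
Proof. by move=> f; apply: dprodP => i; apply: scale1r. Qed.
Fact dprod_scaleDr : right_distributive scale +%R.
Proof. by move=> a f g; apply: dprodP => i; apply: scalerDr. Qed.
Fact dprod_scaleDl f : {morph scale^~ f : a b / a + b}.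
Proof. by move=> a b; apply: dprodP => i; apply: scalerDl. Qed.
HB.instance Definition _ := GRing.Zmodule_isLmodule.Build k dprod
  dprod_scaleA dprod_scale1 dprod_scaleDr dprod_scaleDl.

Lemma dprodD (f g : dprod) i : (f + g) i = f i + g i. Proof. by []. Qed.
Lemma dprodZ a (f : dprod) i : (a *: f) i = a *: f i. Proof. by []. Qed.
Lemma dprod0 i : (0 : dprod) i = 0. Proof. by []. Qed.
End DependentProducts.

End LinearMaps.

(** * Double complexes *)

Section DoubleComplexes.
Variable k : fieldType.

Record dcplx := DCplx {
  dK :> nat -> nat -> lmodType k;
  dh : forall p j, {linear dK p j -> dK p.+1 j};
  dv : forall p j, {linear dK p j -> dK p j.+1};
  dhh : forall p j x, dh p.+1 j (dh p j x) = 0;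
  dvv : forall p j x, dv p j.+1 (dv p j x) = 0;
  dhv : forall p j x, dh p j.+1 (dv p j x) = dv p.+1 j (dh p j x) }.
Arguments dh {d p j}.
Arguments dv {d p j}.

(** * Staircases in a double complex *)

Section Staircases.
Variable K : dcplx.

(** The sign that [dv] carries in the total complex is left out, as in [staircase]. The end [u] thus
    represents the class of [x] up to a sign that depends only on the bidegree, which affects
    neither linearity nor vanishing. *)
Inductive stair : forall i j, K i j -> forall m, K 0%N m -> Prop :=
| stair0 j (u : K 0%N j) : stair u u
| stairS i j (w : K i j) m (u : K 0%N m) : stair (dv w) u -> stair (dh w) u.

Definition rows_exact := forall p j (x : K p.+1 j), dh x = 0 -> exists y, x = dh y.
Definition cols_exact := forall p j (x : K p j.+1), dv x = 0 -> exists y, x = dv y.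

(* For x killed by dh and dv: x is a boundary of the total complex. *)
Definition negligible i j : K i j -> Prop :=
  match i return K i j -> Prop with
  | 0%N => match j return K 0%N j -> Prop with
         | 0%N => fun x => x = 0
         | j'.+1 => fun x => exists2 y : K 0%N j', dh y = 0 & x = dv y
         end
  | i'.+1 => fun x => exists2 y : K i' j, dv y = 0 & x = dh y
  end.

Lemma stair_deg i j (x : K i j) m (u : K 0%N m) : stair x u -> (i + j = m)%N.
Proof. by elim=> {i j x m u} // i j w m u _; rewrite addnS. Qed.

Lemma stair_cocycle i j (x : K i j) m (u : K 0%N m) : stair x u ->
  dh x = 0 -> dv x = 0 -> dh u = 0 /\ dv u = 0.
Proof.
elim=> {i j x m u} // i j w m u _ IH _ hv; apply: IH; last exact: dvv.
by rewrite dhv.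
Qed.

Lemma stair_exists i j (x : K i j) m : rows_exact -> (i + j = m)%N ->
  dh x = 0 -> dv x = 0 -> exists u : K 0%N m, stair x u.
Proof.
move=> rex; elim: i j x => [|i IH] j x e hx vx.
  by rewrite add0n in e; case: _ / e; exists x; apply: stair0.
have [w ew] := rex _ _ _ hx; have [|||u hu] := IH _ (dv w).
- by rewrite addnS -addSn.
- by rewrite dhv -ew.
- exact: dvv.
by exists u; rewrite ew; apply: stairS.
Qed.

(** One step replaces [dh w] by [dv w], which agree up to sign modulo the total boundary of [w]. If
    [w] is in column 0, a witness [y] on one side gives [w - y] on the other; further right,
    exactness moves the witness by one column. *)
Lemma stair_negligible i j (x : K i j) m (u : K 0%N m) :
  rows_exact -> cols_exact -> stair x u -> negligible x <-> negligible u.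
Proof.
move=> rex cex; elim=> {i j x m u} // i j w m u _ <-.
case: i w => [|i] w /=; split=> -[y hy e].
- by exists (w - y); rewrite linearB ?e ?subrr // hy subr0.
- by exists (w - y); rewrite linearB ?e ?subrr // hy subr0.
- have [|z hz] := rex _ _ (w - y); first by rewrite linearB e subrr.
  exists (dv z); first exact: dvv.
  by rewrite dhv -hz linearB hy subr0.
- have [z hz] := cex _ _ _ hy; exists (w - dh z).
    by rewrite linearB e hz dhv subrr.
  by rewrite linearB dhh subr0.
Qed.

Section Coaugmented.
Variable (B : nat -> lmodType k) (dB : forall p, {linear B p -> B p.+1}).
Variable e : forall p, {linear B p -> K p 0%N}.
Hypothesis edB : forall p x, e p.+1 (dB p x) = dh (e p x).
Hypothesis eker : forall p x, dv x = 0 <-> exists b, x = e p b.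
Hypothesis einj : forall p, injective (e p).

(** The staircase is prolonged at its start. Above row 0, [x] is some [dv w], and [dh w] starts a
    longer staircase one row lower; on row 0 the cocycles of [dv] come from [B]. *)
Lemma stair_surj i j (x : K i j) m (u : K 0%N m) : cols_exact -> stair x u ->
  dh x = 0 -> dv x = 0 -> exists2 b : B m, dB m b = 0 & stair (e m b) u.
Proof.
move=> cex; elim: j i x => [|j IH] i x hs hx vx; have em := stair_deg hs.
  rewrite addn0 in em; case: m / em u hs => u hs.
  have /eker[b eb] := vx; exists b; last by rewrite -eb.
  by apply: (@einj i.+1); rewrite edB -eb hx linear0.
have [w ew] := cex _ _ _ vx; apply: (IH i.+1 (dh w)).
- by apply: stairS; rewrite -ew.
- exact: dhh.
- by rewrite -dhv -ew.
Qed.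

Lemma stair_aug_exists m (b : B m) : rows_exact -> dB m b = 0 ->
  exists u : K 0%N m, [/\ stair (e m b) u, dh u = 0 & dv u = 0].
Proof.
move=> rex hb; have hbh : dh (e m b) = 0 by rewrite -edB hb linear0.
have hbv : dv (e m b) = 0 by apply/eker; exists b.
have [u hu] := stair_exists rex (addn0 m) hbh hbv.
by exists u; have [] := stair_cocycle hu hbh hbv.
Qed.

Lemma negligible_aug0 (b : B 0%N) : negligible (e 0 b) <-> b = 0.
Proof. by split=> /= [h|->]; [apply: (@einj 0); rewrite h linear0|rewrite linear0]. Qed.

Lemma negligible_augS p (b : B p.+1) : negligible (e p.+1 b) <-> exists b', b = dB p b'.
Proof.
split=> /= [[y /eker[b' ->]]|[b' ->]].
  by rewrite -edB => /einj->; exists b'.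
by exists (e p b'); [apply/eker; exists b'|rewrite edB].
Qed.
End Coaugmented.

(** In column 0 the two ends are equal, but their degrees [j] and [m] are different variables;
    quantifying over predicates in all degrees expresses this equality without a cast. *)
Lemma stair_inv i j (x : K i j) m (u : K 0%N m) : stair x u ->
  match i return K i j -> Prop with
  | 0%N => fun x => forall Q : (forall m, K 0%N m -> Prop), Q j x -> Q m u
  | i'.+1 => fun x => exists2 w : K i' j, x = dh w & stair (dv w) u
  end x.
Proof. by case=> {i j x m u} // i j w m u h; exists w. Qed.

Lemma stair0_eq j (x u : K 0%N j) : stair x u -> u = x.
Proof.
move=> /stair_inv /(_ (fun m u => forall e : m = j, ecast n (K 0%N n) e u = x)).
move/(_ _ erefl) => -> // e; by rewrite (eq_irrelevance e erefl).
Qed.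

Lemma stair_linear i j (x x' : K i j) m (u u' : K 0%N m) a : stair x u -> stair x' u' ->
  stair (a *: x + x') (a *: u + u').
Proof.
elim: i j x x' => [|i IH] j x x' h h'.
  have e := stair_deg h; rewrite add0n in e; case: m / e u u' h h' => u u' h h'.
  by rewrite (stair0_eq h) (stair0_eq h'); apply: stair0.
have [w -> hw] := stair_inv h; have [w' -> hw'] := stair_inv h'.
by rewrite -linearP; apply: stairS; rewrite linearP; apply: IH.
Qed.
End Staircases.

Lemma stair_map (K K' : dcplx) (f : forall p j, {linear K p j -> K' p j}) :
  (forall p j x, f p.+1 j (dh x) = dh (f p j x)) ->
  (forall p j x, f p j.+1 (dv x) = dv (f p j x)) ->
  forall i j (x : K i j) m (u : K 0%N m), stair x u -> stair (f i j x) (f 0%N m u).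
Proof.
move=> fh fv i j x m u; elim=> {i j x m u} [j u|i j w m u h IH]; first exact: stair0.
by rewrite fh; apply: stairS; rewrite -fv.
Qed.

(** * The total complex and its filtration by columns *)

Section Total.
Variable K : dcplx.

Definition tot : lmodType k := dprod (fun p => dprod (fun j => K p j) : lmodType k).

Definition tdh (x : tot) : tot := fun p =>
  match p return dprod (fun j => K p j) with
  | 0%N => 0
  | p'.+1 => fun j => dh (x p' j)
  end.
Definition tdv (x : tot) : tot := fun p j =>
  match j return K p j with
  | 0%N => 0
  | j'.+1 => (-1) ^+ p *: dv (x p j')
  end.
Definition td_fun (x : tot) : tot := tdh x + tdv x.

Lemma totP (x y : tot) : (forall p j, x p j = y p j) -> x = y.
Proof. by move=> h; apply: dprodP => p; apply: dprodP. Qed.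

Lemma totD (x y : tot) p j : (x + y) p j = x p j + y p j. Proof. by []. Qed.
Lemma totZ a (x : tot) p j : (a *: x) p j = a *: x p j. Proof. by []. Qed.
Lemma totN (x : tot) p j : (- x) p j = - x p j. Proof. by []. Qed.
Lemma tot0 p j : (0 : tot) p j = 0. Proof. by []. Qed.

Fact td_linear : linear td_fun.
Proof.
move=> a x y; apply: totP => p j; rewrite !(totD, totZ) scalerDr addrACA; congr (_ + _).
  by case: p => [|p] /=; rewrite ?dprod0 ?scaler0 ?addr0 // linearP.
by case: j => [|j] /=; rewrite ?scaler0 ?addr0 // linearP scalerDr !scalerA mulrC.
Qed.
Definition td : {linear tot -> tot} := mklin td_linear.

Lemma tdE x p j : td x p j = tdh x p j + tdv x p j.
Proof. by rewrite /td mklinE. Qed.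

Lemma td_sq x : td (td x) = 0.
Proof.
have hh p j : dh (tdh x p j) = 0 by case: p => [|p] /=; rewrite ?dprod0 ?linear0 ?dhh.
have vv p j : dv (tdv x p j) = 0.
  by case: j => [|j] /=; rewrite ?linear0 // linearZ /= dvv scaler0.
apply: totP => p j; rewrite tdE.
case: p => [|p]; case: j => [|j] /=; rewrite ?dprod0 ?addr0 ?add0r ?tdE //=.
- by rewrite linearD /= vv addr0 ?dprod0 ?linear0 ?scaler0.
- by rewrite linearD /= hh add0r linear0.
rewrite !linearD /= hh vv add0r scaler0 addr0 linearZ /= dhv exprS mulN1r scaleNr.
by rewrite subrr.
Qed.

(* deg n.+1 is the part of total degree n, and deg 0 = 0. *)
Definition deg (n : nat) : {pred tot} :=
  fun x => `[< forall p j, (p + j).+1 <> n -> x p j = 0 >].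
Fact deg_submod n : GRing.submod_closed (deg n).
Proof.
split; first exact/asboolP.
move=> a u v /asboolP hu /asboolP hv; apply/asboolP => p j h.
by rewrite totD totZ hu // hv // scaler0 addr0.
Qed.
HB.instance Definition _ n := GRing.isSubmodClosed.Build k tot (deg n) (deg_submod n).

Definition hfil (m : nat) : {pred tot} :=
  fun x => `[< forall p j, (p < m)%N -> x p j = 0 >].
Fact hfil_submod m : GRing.submod_closed (hfil m).
Proof.
split; first exact/asboolP.
move=> a u v /asboolP hu /asboolP hv; apply/asboolP => p j h.
by rewrite totD totZ hu // hv // scaler0 addr0.
Qed.
HB.instance Definition _ m := GRing.isSubmodClosed.Build k tot (hfil m) (hfil_submod m).

Lemma deg_td n x : x \in deg n -> td x \in deg n.+1.
Proof.
move=> /asboolP h; apply/asboolP => p j hpj; rewrite tdE.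
case: p j hpj => [|p] [|j] hpj /=; rewrite ?dprod0 ?addr0 ?add0r //.
- by rewrite h ?linear0 ?scaler0 // => e; apply: hpj; rewrite -e addnS.
- by rewrite h ?linear0 // => e; apply: hpj; rewrite -e addSn.
rewrite h ?linear0 ?h ?linear0 ?scaler0 ?addr0 //; first by move=> e; apply: hpj; rewrite -e addnS.
by move=> e; apply: hpj; rewrite -e addSn addnS.
Qed.

Lemma deg0 x : x \in deg 0 -> x = 0.
Proof. by move=> /asboolP h; apply: totP => p j; rewrite h. Qed.

Lemma hfil_td m x : x \in hfil m -> td x \in hfil m.
Proof.
move=> /asboolP h; apply/asboolP => p j hp; rewrite tdE.
case: p hp => [|p] hp; case: j => [|j] /=; rewrite ?dprod0 ?addr0 ?add0r //.
- by rewrite h ?linear0 ?scaler0.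
- by rewrite h ?linear0 // ltnW.
by rewrite h ?linear0 ?h ?linear0 ?scaler0 ?addr0 // ltnW.
Qed.

Lemma hfil0 x : x \in hfil 0. Proof. exact/asboolP. Qed.
Lemma hfilS m x : x \in hfil m.+1 -> x \in hfil m.
Proof. by move=> /asboolP h; apply/asboolP => p j hp; rewrite h // ltnW. Qed.
Lemma hfil_end n x : x \in deg n -> x \in hfil n -> x = 0.
Proof.
move=> /asboolP hd /asboolP hf; apply: totP => p j; rewrite tot0.
case: (ltnP p n) => hp; first exact: hf.
by apply: hd => e; move: hp; rewrite -e ltnNge leq_addr.
Qed.

Lemma single_exists p0 j0 (u : K p0 j0) : exists t : tot,
  t p0 j0 = u /\ forall p j, (p, j) <> (p0, j0) -> t p j = 0.
Proof.
exists (fun p j => match p0 =P p, j0 =P j with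
  | ReflectT e, ReflectT e' => ecast n (K n j) e (ecast m (K p0 m) e' u)
  | _, _ => 0 end); split=> [|p j h].
  case: (p0 =P p0) => // e; case: (j0 =P j0) => // e'.
  by rewrite (eq_irrelevance e erefl) (eq_irrelevance e' erefl).
by case: (p0 =P p) => // e; case: (j0 =P j) => // e'; case: h; rewrite e e'.
Qed.

Definition in_col0 (x : tot) := forall p j, x p.+1 j = 0.

(** The columns of [x] are cleared from the right. In the last nonzero column the condition on
    [td x] makes the entries cocycles of [dh], hence boundaries, and subtracting the total boundary
    of their primitives empties that column. *)
Lemma collapse n x : rows_exact K -> x \in deg n.+1 -> in_col0 (td x) ->
  exists2 y, y \in deg n & in_col0 (x - td y).
Proof.
move=> rex hx; have: exists m, forall p j, (m < p)%N -> x p j = 0.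
  exists n => p j hp; move/asboolP: hx; apply=> -[e]; move: hp.
  by rewrite -e ltnNge leq_addr.
case=> m; elim: m x hx => [|m IH] x hx hm dx.
  by exists 0; rewrite ?rpred0 // linear0 subr0 => p j; apply: hm.
(* [y] lives in column [m] and its [dh] is column [m.+1] of [x]. It is chosen to be 0 wherever [x]
   is, which keeps it homogeneous of the right degree. *)
have [y hy] : exists y : tot, forall p j,
    if p == m then dh (y p j) = x p.+1 j /\ (x p.+1 j = 0 -> y p j = 0) else y p j = 0.
  have h p : exists y : dprod (fun j => K p j), forall j, if p == m then
      dh (y j) = x p.+1 j /\ (x p.+1 j = 0 -> y j = 0) else y j = 0.
    have h j : exists y : K p j, if p == m then
      dh y = x p.+1 j /\ (x p.+1 j = 0 -> y = 0) else y = 0.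
      case: eqP => [->|_]; last by exists 0.
      have [x0|x0] := pselect (x m.+1 j = 0); first by exists 0; rewrite x0 linear0.
      have [|y hy] := rex m j (x m.+1 j); last by exists y.
      have := dx m.+1 j; rewrite tdE /=; case: j {x0} => [|j] /=; rewrite ?addr0 //.
      by rewrite (hm m.+2) // linear0 scaler0 addr0.
    exists (fun j => sval (cid (h j))) => j; by case: cid.
  exists (fun p => sval (cid (h p))) => p; by case: cid.
have hyd : y \in deg n.
  apply/asboolP => p j hpj; have := hy p j; case: eqP => [_ [_ h]|//].
  by apply: h; move/asboolP: hx; apply; rewrite addSn => -[e]; apply: hpj.
have hyp p j : (m < p)%N -> td y p j = if p == m.+1 then x p j else 0.
  case: p => // p hp; rewrite tdE /= eqSS.
  have h0 : tdv y p.+1 j = 0.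
    case: j => //= j; have := hy p.+1 j; rewrite gtn_eqF // => ->.
    by rewrite linear0 scaler0.
  by rewrite h0 addr0; have := hy p j; case: eqP => [_ []|_ ->]; rewrite ?linear0.
have [|p j hp|p j|z hz hzc] := IH (x - td y).
- by rewrite subB ?deg_td.
- rewrite totD totN hyp //; case: eqP => [_|/eqP hp']; first by rewrite subrr.
  by rewrite hm ?subr0 // ltn_neqAle eq_sym hp'.
- by rewrite linearB td_sq subr0.
exists (y + z); first by rewrite rpredD.
suff -> : x - td (y + z) = x - td y - td z by [].
by rewrite [td _]linearD opprD addrA.
Qed.

Definition is_col0 n (u : K 0%N n) (t : tot) : Prop :=
  t 0%N n = u /\ forall p j, (p, j) <> (0%N, n) -> t p j = 0.

Lemma is_col0_deg n (u : K 0%N n) t : is_col0 u t -> t \in deg n.+1.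
Proof.
by move=> [_ h]; apply/asboolP => p j hpj; apply: h => -[ep ej]; apply: hpj; rewrite ep ej.
Qed.

Lemma is_col0_cocycle n (u : K 0%N n) t : is_col0 u t -> dh u = 0 -> dv u = 0 -> td t = 0.
Proof.
move=> [e h] hu vu; apply: totP => p j; rewrite tdE tot0.
have -> : tdh t p j = 0.
  case: p => [|p] //=; case: ((p, j) =P (0%N, n)) => [[-> ->]|/h->]; rewrite ?linear0 //.
  by rewrite e.
rewrite add0r; case: j => [|j] //=.
case: ((p, j) =P (0%N, n)) => [[-> ->]|/h->]; rewrite ?linear0 ?scaler0 //.
by rewrite e vu scaler0.
Qed.

Lemma is_col0_linear n a (u u' : K 0%N n) t t' : is_col0 u t -> is_col0 u' t' ->
  is_col0 (a *: u + u') (a *: t + t').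
Proof.
move=> [e h] [e' h']; split=> [|p j hpj]; first by rewrite totD totZ e e'.
by rewrite totD totZ h // h' // scaler0 addr0.
Qed.

Lemma in_col0_is n t : t \in deg n.+1 -> in_col0 t -> is_col0 (t 0%N n) t.
Proof.
move=> /asboolP hd h; split=> // -[|p] j hpj; last exact: h.
by apply: hd => -[e]; apply: hpj; rewrite -e.
Qed.

Lemma collapse_cocycle n t : rows_exact K -> t \in deg n.+1 -> td t = 0 ->
  exists y, exists2 u : K 0%N n, y \in deg n /\ is_col0 u (t - td y) &
    dh u = 0 /\ dv u = 0.
Proof.
move=> rex ht h; have [|y hy hc] := collapse rex ht; first by rewrite h.
have hs : t - td y \in deg n.+1 by rewrite subB ?deg_td.
exists y; exists ((t - td y) 0%N n); first by split=> //; apply: in_col0_is.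
have hd : td (t - td y) = 0 by rewrite linearB td_sq h subrr.
have := hd; move/(congr1 (fun z : tot => z 1%N n)); rewrite tdE /=.
have -> : tdv (t - td y) 1%N n = 0.
  by case: n {ht hy hs} => //= n; rewrite hc linear0 scaler0.
rewrite addr0 => ->; split=> //.
have := hd; move/(congr1 (fun z : tot => z 0%N n.+1)); rewrite tdE /=.
by rewrite dprod0 add0r expr0 scale1r.
Qed.

(** In positive degree, a primitive of [t] has its boundary in column 0, so [collapse] moves the
    primitive itself into column 0; there the vanishing of [t] in column 1 becomes [dh y = 0]. *)
Lemma is_col0_negligible n (u : K 0%N n) t : rows_exact K -> is_col0 u t ->
  negligible u <-> exists2 y, y \in deg n & t = td y.
Proof.
move=> rex hut; split; last first.
  case=> y hy e; case: n u hut hy => [|n] u [e' h] hy.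
    by rewrite /= -e' e (deg0 hy) linear0.
  have [|z hz hc] := collapse rex hy; first by rewrite -e => p j; apply: h.
  have et : t = td (y - td z) by rewrite linearB td_sq subr0.
  exists ((y - td z) 0%N n).
    have := h 1%N n; rewrite et tdE /= => <- //.
    by case: n {u e' h hy hz et} => [|n] /=; rewrite ?addr0 // hc linear0 scaler0 addr0.
  by rewrite -e' et tdE /= expr0 scale1r dprod0 add0r.
case: n u hut => [|n] u [e h] /= => [u0|[v hv hu]].
  exists 0; first exact: rpred0.
  rewrite linear0; apply: totP => p j.
  by case: ((p, j) =P (0%N, 0%N)) => [[-> ->]|/h//]; rewrite e u0.
have [y hy] := single_exists v; have hyd := is_col0_deg hy.
exists y => //; case: hy => ey hy; apply: totP => p j; rewrite tdE.
case: ((p, j) =P (0%N, n.+1)) => [[-> ->]|hpj].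
  by rewrite e hu /= ey dprod0 add0r expr0 scale1r.
rewrite h //.
have -> : tdh y p j = 0.
  case: p hpj => [|p] hpj //=.
  case: ((p, j) =P (0%N, n)) => [[-> ->]|/hy->]; rewrite ?linear0 //.
  by rewrite ey.
rewrite add0r; case: j hpj => [|j] hpj //=.
case: ((p, j) =P (0%N, n)) => [[ep ej]|/hy->]; last by rewrite linear0 scaler0.
by case: hpj; rewrite ep ej.
Qed.
End Total.
Arguments deg : clear implicits.
Arguments hfil : clear implicits.

Section TotalMap.
Variables (K K' : dcplx) (f : forall p j, {linear K p j -> K' p j}).
Hypothesis fh : forall p j x, f p.+1 j (dh x) = dh (f p j x).
Hypothesis fv : forall p j x, f p j.+1 (dv x) = dv (f p j x).

Definition tmap_fun (x : tot K) : tot K' := fun p j => f p j (x p j).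
Fact tmap_linear : linear tmap_fun.
Proof. by move=> a x y; apply: totP => p j; rewrite /tmap_fun linearP. Qed.
Definition tmap : {linear tot K -> tot K'} := mklin tmap_linear.

Lemma tmapE x p j : tmap x p j = f p j (x p j).
Proof. by rewrite /tmap mklinE. Qed.

Lemma tmap_td x : tmap (td K x) = td K' (tmap x).
Proof.
apply: totP => p j; rewrite tmapE !tdE linearD; congr (_ + _).
  by case: p => [|p] /=; rewrite ?dprod0 ?linear0 // fh tmapE.
by case: j => [|j] /=; rewrite ?linear0 // linearZ fv tmapE.
Qed.

Lemma tmap_deg n x : x \in deg K n -> tmap x \in deg K' n.
Proof. by move=> /asboolP h; apply/asboolP => p j hp; rewrite tmapE h ?linear0. Qed.

Lemma tmap_hfil m x : x \in hfil K m -> tmap x \in hfil K' m.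
Proof. by move=> /asboolP h; apply/asboolP => p j hp; rewrite tmapE h ?linear0. Qed.

Lemma tmap_is_col0 n (u : K 0%N n) t : is_col0 u t -> is_col0 (f 0 n u) (tmap t).
Proof.
move=> [e h]; split=> [|p j hpj]; first by rewrite tmapE e.
by rewrite tmapE h ?linear0.
Qed.
End TotalMap.
End DoubleComplexes.
Arguments dh {k d p j}.
Arguments dv {k d p j}.
Arguments deg {k} K n.
Arguments hfil {k} K m.

(** * The spectral sequence of a double complex *)

Section TotalSpectralSequence.
Variable k : fieldType.

Section Pages.
Variable K : dcplx k.
Notation d := (td K).

(** The classical Z_r^p of a filtered complex. For r > 0, [ssB] is d Z_(r-1)^(p-r+1) +
    Z_(r-1)^(p+1), so that the quotient is the usual page r. *)
Definition ssZ r p n : {pred tot K} := fun x =>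
  [&& x \in deg K n.+1, x \in hfil K p & d x \in hfil K (p + r)].
Lemma ssZP r p n x : reflect [/\ x \in deg K n.+1, x \in hfil K p & d x \in hfil K (p + r)]
  (x \in ssZ r p n).
Proof. exact: and3P. Qed.
Fact ssZ_submod r p n : GRing.submod_closed (ssZ r p n).
Proof.
split; first by apply/ssZP; rewrite linear0 !rpred0.
move=> a u v /ssZP[? ? ?] /ssZP[? ? ?].
by apply/ssZP; rewrite linearP !rpredD ?rpredZ.
Qed.
HB.instance Definition _ r p n :=
  GRing.isSubmodClosed.Build k (tot K) (ssZ r p n) (ssZ_submod r p n).

(* If p < r the truncated subtraction imposes no condition on y: hfil K 0 is
   everything. *)
Definition ssB r p n : {pred tot K} := fun x =>
  (x \in ssZ r p n) && `[< exists y, [/\ y \in deg K n, y \in hfil K (p.+1 - r),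
     d y \in hfil K p & x - d y \in hfil K p.+1] >].
Lemma ssBP r p n x : x \in ssZ r p n -> x \in ssB r p n <->
  exists y, [/\ y \in deg K n, y \in hfil K (p.+1 - r),
     d y \in hfil K p & x - d y \in hfil K p.+1].
Proof. by move=> hx; rewrite unfold_in hx; split=> [/asboolP|h]; last exact/asboolP. Qed.
Lemma ssB_ssZ r p n x : x \in ssB r p n -> x \in ssZ r p n.
Proof. by case/andP. Qed.
Fact ssB_submod r p n : GRing.submod_closed (ssB r p n).
Proof.
split=> [|a u v].
  apply/ssBP; first exact: rpred0.
  by exists 0; rewrite linear0 subr0 !rpred0.
move=> hu' hv'; have hu := ssB_ssZ hu'; have hv := ssB_ssZ hv'.
have [y [y1 y2 y3 y4]] := (ssBP hu).1 hu'.
have [z [z1 z2 z3 z4]] := (ssBP hv).1 hv'.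
apply/ssBP; first by rewrite rpredD ?rpredZ.
exists (a *: y + z).
rewrite linearP opprD addrACA -scalerBr.
by split; rewrite rpredD ?rpredZ.
Qed.
HB.instance Definition _ r p n :=
  GRing.isSubmodClosed.Build k (tot K) (ssB r p n) (ssB_submod r p n).

Definition page r p q : lmodType k := subquo (ssZ r p (p + q)) (ssB r p (p + q)).
Notation pcl r p q := (cls (ssZ r p (p + q)) (ssB r p (p + q))).

Lemma hfil_le m n x : (m <= n)%N -> x \in hfil K n -> x \in hfil K m.
Proof. by move=> h /asboolP hx; apply/asboolP => p j hp; apply/hx/(leq_trans hp). Qed.

Lemma in_ssB r p n x : x \in ssZ r p n -> x \in hfil K p.+1 -> x \in ssB r p n.
Proof.
move=> hx hf; apply/ssBP => //; exists 0; rewrite linear0 subr0 !rpred0.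
by split.
Qed.

Definition bideg r p q p' q' := (p' = p + r /\ q' + r = q.+1)%N.

Lemma bideg_total r p q p' q' : bideg r p q p' q' -> (p' + q' = (p + q).+1)%N.
Proof. by move=> [-> e]; rewrite -addnA [(r + _)%N]addnC e addnS. Qed.

Lemma ssZ_d r p q p' q' x : bideg r p q p' q' -> x \in ssZ r p (p + q) ->
  d x \in ssZ r p' (p' + q').
Proof.
move=> h /ssZP[h1 _ h3]; apply/ssZP; rewrite td_sq rpred0 (bideg_total h).
by case: h => -> _; split=> //; apply: deg_td.
Qed.

Lemma ssB_d r p q p' q' x : bideg r p q p' q' -> x \in ssB r p (p + q) ->
  d x \in ssB r p' (p' + q').
Proof.
move=> h hB; have hZ : x \in ssZ r p (p + q) by apply: ssB_ssZ.
have [y [y1 y2 y3 y4]] := (ssBP hZ).1 hB.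
apply/(ssBP (ssZ_d h hZ)); exists (x - d y).
rewrite linearB td_sq subr0 subrr rpred0 (bideg_total h).
have /ssZP[hx1 hx2 hx3] := hZ; case: h => -> _.
by rewrite subB ?deg_td // -addSn addnK.
Qed.

Lemma page_d_exists r p q p' q' : exists D : {linear page r p q -> page r p' q'},
  (bideg r p q p' q' -> forall x, x \in ssZ r p (p + q) ->
     D (pcl r p q x) = pcl r p' q' (d x)) /\
  (~ bideg r p q p' q' -> forall x, D x = 0).
Proof.
have [h|h] := pselect (bideg r p q p' q').
  exists (subquo_map (g := d) (@ssZ_d _ _ _ _ _ ^~ h) (@ssB_d _ _ _ _ _ ^~ h)).
  by split=> // _ x hx; rewrite /= subquo_mapE.
by exists \0.
Qed.
Definition page_d r p q p' q' : {linear page r p q -> page r p' q'} :=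
  sval (cid (page_d_exists r p q p' q')).

Lemma page_dE r p q p' q' x : bideg r p q p' q' -> x \in ssZ r p (p + q) ->
  page_d r p q p' q' (pcl r p q x) = pcl r p' q' (d x).
Proof. by move=> h hx; rewrite /page_d; case: cid => D [/= + _]; apply. Qed.

Lemma page_d0 r p q p' q' x : ~ bideg r p q p' q' -> page_d r p q p' q' x = 0.
Proof. by move=> h; rewrite /page_d; case: cid => D [_ /=]; apply. Qed.

Lemma page_d_sq r p q p' q' p'' q'' x :
  page_d r p' q' p'' q'' (page_d r p q p' q' x) = 0.
Proof.
have [h|h] := pselect (bideg r p q p' q'); last by rewrite (page_d0 _ h) linear0.
have [h'|h'] := pselect (bideg r p' q' p'' q''); last by rewrite (page_d0 _ h').
have [v hv ->] := cls_surj x.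
by rewrite !page_dE // ?td_sq ?cls0 //; apply: ssZ_d hv.
Qed.

(** Induced by the inclusion of Z_(r+1) into Z_r. When the target or the source of a differential
    would leave the first quadrant, the truncated indices do not satisfy [bideg], and the claim
    holds for degree reasons. *)
Lemma page_next_exists r p q : exists N : {linear page r.+1 p q ->
    subquo (kerp (page_d r p q (p + r)%N (q.+1 - r)%N))
           (imp (page_d r (p - r)%N (q + r.-1)%N p q))},
  (2 <= r)%N -> bijective N /\ forall x, x \in ssZ r.+1 p (p + q) ->
    N (pcl r.+1 p q x) = cls _ _ (pcl r p q x).
Proof.
case: (leqP 2 r) => hr; last by exists \0.
have r0 : (0 < r)%N by apply: ltnW.
have ZS x : x \in ssZ r.+1 p (p + q) -> x \in ssZ r p (p + q).
  move=> /ssZP[h1 h2 h3]; apply/ssZP; split=> //.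
  by apply: hfil_le h3; rewrite leq_add2l.
have hdeg : (r <= q.+1)%N -> bideg r p q (p + r) (q.+1 - r).
  by move=> h; split=> //; rewrite subnK.
have hdeg' : (r <= p)%N -> bideg r (p - r) (q + r.-1) p q.
  by move=> h; split; rewrite ?subnK // -addnS prednK.
have [|v hv|w hw|v w [hv ->]|v w _ [hv ->]|N Nb NE] :=
  @subquo_rel_bij k (tot K) (page r p q) (ssZ r.+1 p (p + q)) (ssB r.+1 p (p + q))
    (kerp (page_d r p q (p + r)%N (q.+1 - r)%N))
    (imp (page_d r (p - r)%N (q + r.-1)%N p q))
    (fun v w => v \in ssZ r.+1 p (p + q) /\ w = pcl r p q v).
- move=> a v v' _ _ [hv ->] [hv' ->]; rewrite clsL ?ZS //; split=> //.
  by rewrite rpredD ?rpredZ.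
- by exists (pcl r p q v).
- have [z hz ez] := cls_surj w; have /ssZP[hz1 hz2 hz3] := hz.
  case: (leqP r q.+1) => hrq.
    move: hw; rewrite ez => /eqP; rewrite (page_dE (hdeg hrq) hz) => /cls_eq0.
    have hdz := ssZ_d (hdeg hrq) hz; move=> /(_ hdz) /(ssBP hdz).
    (* If the class of [d z] vanishes on page r, then [d z - d y] is one level deeper for some [y]
       of level [p.+1]. Hence [z - y] lies in Z_(r+1), and it has the same class as [z] on page
       r. *)
    rewrite (bideg_total (hdeg hrq)) => -[y [y1 y2 y3 y4]].
    rewrite -addSn addnK in y2.
    have hy : y \in ssZ r p (p + q).
      by apply/ssZP; split=> //; apply: hfilS.
    exists (z - y); last first.
      split; first by apply/ssZP; rewrite linearB addnS subB // subB // hfilS.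
      apply/(clsP _ hz (subB hz hy)).
      by rewrite opprB addrC subrK in_ssB.
    by apply/ssZP; rewrite linearB addnS subB // subB // hfilS.
  (* Here [r > q.+1], so the filtration level of [d z] exceeds its total degree. *)
  have dz0 : d z = 0.
    apply: (@hfil_end _ _ (p + q).+2); first exact: deg_td.
    by apply: hfil_le hz3; rewrite -!addnS leq_add2l.
  have hz' : z \in ssZ r.+1 p (p + q) by apply/ssZP; rewrite dz0 rpred0.
  by exists z.
- have [h1 h2 h3] := ssZP _ _ _ _ hv.
  apply/eqP; case: (leqP r q.+1) => hrq; last first.
    apply: page_d0 => -[_ e]; have hq : (q.+1 - r = 0)%N by apply/eqP/ltnW.
    by move: hrq; rewrite -e hq add0n ltnn.
  have hb := hdeg hrq; rewrite page_dE ?ZS //.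
  have hdz := ssZ_d hb (ZS _ hv); apply/(cls_eq0 _ hdz)/in_ssB => //.
  by rewrite -addnS.
- have [h1 h2 h3] := ssZP _ _ _ _ hv.
  split=> [/(ssBP hv)[y [y1 y2 y3 y4]]|/asboolP[x ex]].
    (* For [r > p] no differential arrives. The primitive [y] is then under no filtration condition
       on page r either, so the class of [v] is already 0 there. *)
    case: (leqP r p) => hrp; last first.
      suff -> : pcl r p q v = 0 by apply: rpred0.
      apply/(cls_eq0 _ (ZS _ hv))/(ssBP (ZS _ hv)); exists y; split=> //.
      by apply: hfil_le (hfil0 y); rewrite leqn0 subn_eq0.
    have hb := hdeg' hrp.
    have hy : y \in ssZ r (p - r) (p - r + (q + r.-1)).
      by apply/ssZP; rewrite -(bideg_total hb) subnK.
    have hdy := ssZ_d hb hy.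
    apply/asboolP; exists (pcl r (p - r) (q + r.-1) y).
    rewrite page_dE //; apply/(clsP _ (ZS _ hv) hdy)/in_ssB => //.
    by apply: subB => //; apply: ZS.
  apply/(ssBP hv); rewrite subSS; case: (leqP r p) => hrp; last first.
    move: ex; rewrite page_d0 => [/(cls_eq0 _ (ZS _ hv))|[e _]]; last first.
      by move: hrp; rewrite e ltnNge leq_addl.
    move=> /(ssBP (ZS _ hv))[y [y1 y2 y3 y4]]; exists y; split=> //.
    by apply: hfil_le y2; rewrite leq_sub.
  have hb := hdeg' hrp; have [y hy ey] := cls_surj x.
  have /ssZP[hy1 hy2 hy3] := hy; have hdy := ssZ_d hb hy.
  move: ex; rewrite ey page_dE // => /(clsP _ (ZS _ hv) hdy).
  have hvy : v - d y \in ssZ r p (p + q) by apply: subB => //; apply: ZS.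
  move=> /(ssBP hvy)[z [z1 z2 z3 z4]]; exists (y + z); rewrite linearD opprD addrA.
  rewrite -(bideg_total hb) in hy1; rewrite subnK // in hy3.
  split=> //; rewrite rpredD //; by apply: hfil_le z2; rewrite leq_sub2r.
by exists N => _; split=> // x hx; apply: NE.
Qed.
Definition page_next r p q := sval (cid (page_next_exists r p q)).

Lemma page_next_bij r p q : (2 <= r)%N -> bijective (page_next r p q).
Proof. by move=> h; rewrite /page_next; case: cid => N /= /(_ h)[]. Qed.

Lemma page_nextE r p q x : (2 <= r)%N -> x \in ssZ r.+1 p (p + q) ->
  page_next r p q (pcl r.+1 p q x) = cls _ _ (pcl r p q x).
Proof. by move=> h; rewrite /page_next; case: cid => N /= /(_ h)[_]; apply. Qed.

Definition tZ n : {pred tot K} := fun x => (x \in deg K n.+1) && (d x == 0).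
Lemma tZP n x : reflect (x \in deg K n.+1 /\ d x = 0) (x \in tZ n).
Proof. by apply: (iffP andP) => -[h /eqP]; split=> //; apply/eqP. Qed.
Fact tZ_submod n : GRing.submod_closed (tZ n).
Proof.
split; first by apply/tZP; rewrite linear0 rpred0.
move=> a u v /tZP[? h] /tZP[? h']; apply/tZP.
by rewrite linearP h h' scaler0 addr0 rpredD ?rpredZ.
Qed.
HB.instance Definition _ n := GRing.isSubmodClosed.Build k (tot K) (tZ n) (tZ_submod n).

Definition tB n : {pred tot K} := fun x => `[< exists2 y, y \in deg K n & x = d y >].
Fact tB_submod n : GRing.submod_closed (tB n).
Proof.
split; first by apply/asboolP; exists 0; rewrite ?linear0 ?rpred0.
move=> a u v /asboolP[y hy ->] /asboolP[z hz ->]; apply/asboolP.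
by exists (a *: y + z); rewrite ?linearP ?rpredD ?rpredZ.
Qed.
HB.instance Definition _ n := GRing.isSubmodClosed.Build k (tot K) (tB n) (tB_submod n).

Definition tH n : lmodType k := subquo (tZ n) (tB n).

(** * Convergence, with the abutment and the second page given up to isomorphism *)

Section Abutment.
Variables (A : nat -> lmodType k) (ab : forall n, {linear tH n -> A n}).
Hypothesis abb : forall n, bijective (ab n).
Notation tcl n := (cls (tZ n) (tB n)).

Definition afil_spec n p (a : A n) (z : tot K) : Prop :=
  [/\ z \in tZ n, z \in hfil K p & a = ab n (tcl n z)].
Definition afil n p : {pred A n} := fun a => `[< exists z, afil_spec p a z >].
Lemma afil_spec_linear n p : linrel (@afil_spec n p).
Proof.
move=> c a a' z z' [h1 h2 ->] [h1' h2' ->]; split; rewrite ?rpredD ?rpredZ //.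
by rewrite clsL // linearP.
Qed.
Fact afil_submod n p : GRing.submod_closed (@afil n p).
Proof.
split; first by apply/asboolP; exists 0; split; rewrite ?rpred0 // cls0 linear0.
move=> c a a' /asboolP[z hz] /asboolP[z' hz']; apply/asboolP.
by exists (c *: z + z'); apply: afil_spec_linear.
Qed.
HB.instance Definition _ n p := GRing.isSubmodClosed.Build k (A n) (@afil n p)
  (@afil_submod n p).

Lemma afil0 n v : v \in @afil n 0.
Proof.
have [g _ gK] := abb n; have [z hz e] := cls_surj (g v).
by apply/asboolP; exists z; split; rewrite ?hfil0 // -e gK.
Qed.

Lemma afilS n p v : v \in @afil n p.+1 -> v \in @afil n p.
Proof. by move=> /asboolP[z [h1 h2 e]]; apply/asboolP; exists z; split=> //; apply: hfilS. Qed.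

Lemma afil_end n v : v \in @afil n n.+1 -> v = 0.
Proof.
move=> /asboolP[z [/tZP[h1 _] h2 ->]].
by rewrite (hfil_end h1 h2) cls0 linear0.
Qed.

(** At r = p+q+2 nothing moves any more: a boundary of degree p+q+1 in level p+r is 0, and the level
    p+1-r required of a primitive is no condition. *)
Lemma page_gr_exists p q : exists2 G : {linear
    subquo (@afil (p + q) p) (@afil (p + q) p.+1) -> page (p + q).+2 p q}, bijective G &
  forall a z, a \in @afil (p + q) p -> afil_spec p a z ->
    G (cls _ _ a) = pcl (p + q).+2 p q z.
Proof.
apply: subquo_rel_bij => [|a /asboolP//|w /ssZP[h1 h2 h3]|a z [/tZP[h1 h2] h3 _]|a z _].
- exact: afil_spec_linear.
- have dw : d w = 0.
    apply: (@hfil_end _ _ (p + q).+2); first exact: deg_td.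
    by apply: hfil_le h3; rewrite leq_addl.
  have hw : w \in tZ (p + q) by apply/tZP.
  by exists (ab _ (tcl _ w)) => //; apply/asboolP; exists w.
- by apply/ssZP; rewrite h2 rpred0.
move=> [hz hzp ->].
have /tZP[hz1 hz2] := hz.
have hzZ : z \in ssZ (p + q).+2 p (p + q) by apply/ssZP; rewrite hz2 rpred0.
split=> [/asboolP[z' [hz' hzp' /(bij_inj (abb _))]]|/(ssBP hzZ)[y [y1 y2 y3 y4]]].
  move=> /(clsP _ hz hz') /asboolP[y hy e]; apply/(ssBP hzZ); exists y; split=> //.
  - apply: hfil_le (hfil0 y); rewrite leqn0 subn_eq0.
    by rewrite ltnS -addnS leq_addr.
  - by rewrite -e subB // hfilS.
  by rewrite -e opprB addrC subrK.
have hzy : z - d y \in tZ (p + q).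
  by apply/tZP; rewrite linearB td_sq hz2 subr0 subB // deg_td.
apply/asboolP; exists (z - d y); split=> //; congr (ab _ _).
by apply/(clsP _ hz hzy); rewrite opprB addrC subrK; apply/asboolP; exists y.
Qed.
Definition page_gr p q := s2val (cid2 (page_gr_exists p q)).

Lemma page_gr_bij p q : bijective (page_gr p q).
Proof. by rewrite /page_gr; case: cid2. Qed.

Lemma page_grE p q a z : afil_spec p a z ->
  page_gr p q (cls (@afil (p + q) p) (@afil (p + q) p.+1) a) = pcl (p + q).+2 p q z.
Proof.
move=> h; rewrite /page_gr; case: cid2 => G /= _; apply=> //.
by apply/asboolP; exists z.
Qed.

Variables (E2 : nat -> nat -> lmodType k).
Variable e2 : forall p q, {linear page 2 p q -> E2 p q}.
Hypothesis e2b : forall p q, bijective (e2 p q).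

Definition tot_ss : spectral_sequence E2 A :=
  @SpectralSequence k E2 A page page_d (fun r p q p' q' _ h v => page_d0 v h)
    (fun r p q p' q' p'' q'' v _ => @page_d_sq r p q p' q' p'' q'' v)
    page_next page_next_bij e2 e2b afil afil0 afilS afil_end page_gr page_gr_bij.
End Abutment.
End Pages.
Arguments ssZ : clear implicits.
Arguments ssB : clear implicits.
Arguments page : clear implicits.
Arguments tZ : clear implicits.
Arguments tB : clear implicits.
Arguments tH : clear implicits.
Arguments page_next : clear implicits.
Arguments page_d : clear implicits.

(** * Functoriality for filtered maps of total complexes *)

Section Naturality.
Variables (K K' : dcplx k) (phi : {linear tot K -> tot K'}).
Hypothesis phid : forall x, phi (td K x) = td K' (phi x).
Hypothesis phideg : forall n x, x \in deg K n -> phi x \in deg K' n.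
Hypothesis phifil : forall m x, x \in hfil K m -> phi x \in hfil K' m.

Lemma ssZ_map r p n x : x \in ssZ K r p n -> phi x \in ssZ K' r p n.
Proof.
by move=> /ssZP[h1 h2 h3]; apply/ssZP; rewrite -phid phideg ?phifil.
Qed.
Lemma ssB_map r p n x : x \in ssB K r p n -> phi x \in ssB K' r p n.
Proof.
move=> h; have hZ := ssB_ssZ h.
have [y [y1 y2 y3 y4]] := (ssBP hZ).1 h; apply/(ssBP (ssZ_map hZ)).
by exists (phi y); rewrite -phid -linearB !phifil ?phideg.
Qed.
Lemma tZ_map n x : x \in tZ K n -> phi x \in tZ K' n.
Proof. by move=> /tZP[h1 h2]; apply/tZP; rewrite -phid h2 linear0 phideg. Qed.

Definition page_map r p q : {linear page K r p q -> page K' r p q} :=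
  subquo_map (g := phi) (@ssZ_map r p (p + q)) (@ssB_map r p (p + q)).

Lemma page_mapE r p q x : x \in ssZ K r p (p + q) ->
  page_map r p q (cls _ _ x) = cls (ssZ K' r p (p + q)) (ssB K' r p (p + q)) (phi x).
Proof. by move=> h; rewrite /page_map /= subquo_mapE. Qed.

Lemma page_map_d r p q p' q' v :
  page_map r p' q' (page_d K r p q p' q' v) = page_d K' r p q p' q' (page_map r p q v).
Proof.
have [h|h] := pselect (bideg r p q p' q'); last by rewrite !page_d0 // linear0.
have [x hx ->] := cls_surj v.
rewrite page_dE // page_mapE ?(ssZ_d h hx) // page_mapE // page_dE ?ssZ_map //.
by rewrite phid.
Qed.

Lemma page_map_next r p q w v : (2 <= r)%N ->
  v \in kerp (page_d K r p q (p + r)%N (q.+1 - r)%N) ->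
  page_next K r p q w = cls _ _ v ->
  page_next K' r p q (page_map r.+1 p q w) = cls _ _ (page_map r p q v).
Proof.
move=> h hv; have [x hx ->] := cls_surj w.
rewrite (page_mapE hx) (page_nextE h hx) (page_nextE h (ssZ_map hx)).
have ZS (L : dcplx k) y : y \in ssZ L r.+1 p (p + q) -> y \in ssZ L r p (p + q).
  move=> /ssZP[h1 h2 h3]; apply/ssZP; split=> //.
  by apply: hfil_le h3; rewrite leq_add2l.
rewrite -(page_mapE (ZS _ _ hx)).
have dk y : y \in kerp (page_d K r p q (p + r)%N (q.+1 - r)%N) ->
    page_map r p q y \in kerp (page_d K' r p q (p + r)%N (q.+1 - r)%N).
  by move=> /eqP hy; apply/eqP; rewrite -page_map_d hy linear0.
have hx' : cls _ _ x \in kerp (page_d K r p q (p + r)%N (q.+1 - r)%N).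
  apply/eqP; have [hb|hb] := pselect (bideg r p q (p + r) (q.+1 - r)); last by rewrite page_d0.
  rewrite page_dE ?ZS //; have hdz := ssZ_d hb (ZS _ _ hx).
  apply/(cls_eq0 _ hdz)/in_ssB => //; have /ssZP[_ _] := hx.
  by rewrite -addnS.
move=> /(clsP _ hx' hv) /asboolP[z ez]; apply/(clsP _ (dk _ hx') (dk _ hv)).
rewrite -linearB ez.
by apply/asboolP; exists (page_map r _ _ z); rewrite page_map_d.
Qed.

Variables (A A' : nat -> lmodType k) (ab : forall n, {linear tH K n -> A n})
  (ab' : forall n, {linear tH K' n -> A' n}).
Hypotheses (abb : forall n, bijective (ab n)) (abb' : forall n, bijective (ab' n)).
Variables (E2 E2' : nat -> nat -> lmodType k)
  (e2 : forall p q, {linear page K 2 p q -> E2 p q})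
  (e2' : forall p q, {linear page K' 2 p q -> E2' p q}).
Hypotheses (e2b : forall p q, bijective (e2 p q)) (e2b' : forall p q, bijective (e2' p q)).
Variables (a : forall p q, {linear E2 p q -> E2' p q}) (b : forall n, {linear A n -> A' n}).
Hypothesis e2a : forall p q x, x \in ssZ K 2 p (p + q) ->
  e2' p q (cls _ _ (phi x)) = a p q (e2 p q (cls _ _ x)).
Hypothesis abbb : forall n x, x \in tZ K n ->
  ab' n (cls _ _ (phi x)) = b n (ab n (cls _ _ x)).

Lemma afil_spec_map n p v z : afil_spec ab p v z -> afil_spec ab' p (b n v) (phi z).
Proof. by move=> [h1 h2 ->]; split; rewrite ?tZ_map ?phifil ?abbb. Qed.

Lemma tot_ss_morphism :
  ss_morphism (S := tot_ss abb e2b) (S' := tot_ss abb' e2b') a b page_map.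
Proof.
split.
- by move=> r p q p' q' v _; apply: page_map_d.
- by move=> r p q w v; apply: page_map_next.
- move=> p q v; have [x hx ->] := cls_surj v.
  by rewrite page_mapE // e2a.
- move=> n p v /asboolP[z hz]; apply/asboolP; exists (phi z).
  exact: afil_spec_map.
- move=> p q v /asboolP[z hz]; rewrite (page_grE abb hz).
  rewrite (page_grE abb' (afil_spec_map hz)) page_mapE //.
  have [/tZP[h1 h2] h3 _] := hz.
  by apply/ssZP; rewrite h2 rpred0.
Qed.
End Naturality.
End TotalSpectralSequence.
Arguments ssZ {k} K.
Arguments ssB {k} K.
Arguments page {k} K.
Arguments tZ {k} K.
Arguments tB {k} K.
Arguments tH {k} K.
Arguments page_next {k} K.
Arguments page_d {k} K.

(** * Injective bimodules *)

Section Bimodules.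
Variables (k : fieldType) (D : klcat k).

Lemma bilin0l (U V W : lmodType k) (f : U -> V -> W) : bilin f -> forall v, f 0 v = 0.
Proof.
move=> fb v; have := bilinl fb (-1) 0 0 v.
by rewrite scaler0 addr0 scaleN1r addNr.
Qed.
Lemma bilin0r (U V W : lmodType k) (f : U -> V -> W) : bilin f -> forall u, f u 0 = 0.
Proof.
move=> fb u; have := bilinr fb (-1) u 0 0.
by rewrite scaler0 addr0 scaleN1r addNr.
Qed.
Lemma bilinDl (U V W : lmodType k) (f : U -> V -> W) : bilin f ->
  forall u u' v, f (u + u') v = f u v + f u' v.
Proof. by move=> fb u u' v; rewrite -[u]scale1r (bilinl fb) !scale1r. Qed.
Lemma bilinDr (U V W : lmodType k) (f : U -> V -> W) : bilin f ->
  forall u v v', f u (v + v') = f u v + f u v'.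
Proof. by move=> fb u v v'; rewrite -[v]scale1r (bilinr fb) !scale1r. Qed.
Lemma bilinZl (U V W : lmodType k) (f : U -> V -> W) : bilin f ->
  forall a u v, f (a *: u) v = a *: f u v.
Proof. by move=> fb a u v; rewrite -[a *: u]addr0 (bilinl fb) (bilin0l fb) addr0. Qed.
Lemma bilinZr (U V W : lmodType k) (f : U -> V -> W) : bilin f ->
  forall a u v, f u (a *: v) = a *: f u v.
Proof. by move=> fb a u v; rewrite -[a *: v]addr0 (bilinr fb) (bilin0r fb) addr0. Qed.
Lemma bilinBl (U V W : lmodType k) (f : U -> V -> W) : bilin f ->
  forall u u' v, f (u - u') v = f u v - f u' v.
Proof. by move=> fb u u' v; rewrite (bilinDl fb) -scaleN1r (bilinZl fb) scaleN1r. Qed.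
Lemma bilinBr (U V W : lmodType k) (f : U -> V -> W) : bilin f ->
  forall u v v', f u (v - v') = f u v - f u v'.
Proof. by move=> fb u v v'; rewrite (bilinDr fb) -scaleN1r (bilinZr fb) scaleN1r. Qed.

Definition bhid (M : bimod D) : bimod_hom M M :=
  @BimodHom k D M M (fun x y => idfun : {linear M x y -> M x y})
    (fun _ _ _ _ _ => erefl) (fun _ _ _ _ _ => erefl).


Section Composition.
Variables (M N P : bimod D) (g : bimod_hom N P) (f : bimod_hom M N).
Fact bhcomp_linear x y : linear (fun m => g x y (f x y m)).
Proof. by move=> a u v; rewrite !linearP. Qed.
Fact bhcomp_bl x y z (h : hom y z) (m : M x y) :
  mklin (@bhcomp_linear x z) (bl h m) = bl h (mklin (@bhcomp_linear x y) m).
Proof. by rewrite !mklinE !bhom_bl. Qed.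
Fact bhcomp_br w x y (m : M x y) (h : hom w x) :
  mklin (@bhcomp_linear w y) (br m h) = br (mklin (@bhcomp_linear x y) m) h.
Proof. by rewrite !mklinE !bhom_br. Qed.
Definition bhcomp : bimod_hom M P := BimodHom bhcomp_bl bhcomp_br.
Lemma bhcompE x y m : bhcomp x y m = g x y (f x y m).
Proof. exact: mklinE. Qed.
End Composition.

Section Quotients.
Variables (M : bimod D) (S : forall x y, submodClosed (M x y)).
Hypothesis Sl : forall x y z (f : hom y z) m, m \in S x y -> bl f m \in S x z.
Hypothesis Sr : forall w x y m (f : hom w x), m \in S x y -> br m f \in S w y.

Definition qsp x y : lmodType k := quom (S x y).
Definition qpi x y : {linear M x y -> qsp x y} := quom_pi (S x y).
Definition qbl x y z (f : hom y z) (m : qsp x y) : qsp x z := qpi x z (bl f (quom_repr m)).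
Definition qbr w x y (m : qsp x y) (f : hom w x) : qsp w y := qpi w y (br (quom_repr m) f).

Lemma qpi_surj x y (q : qsp x y) : exists m, q = qpi x y m.
Proof. by exists (quom_repr q); rewrite /qpi /= quom_reprK. Qed.
Lemma qpi_eq0 x y m : qpi x y m = 0 <-> m \in S x y.
Proof. by rewrite -(linear0 (qpi x y)) quom_eq subr0. Qed.
Lemma qpi_repr x y m : quom_repr (qpi x y m) - m \in S x y.
Proof. by apply/quom_eq; rewrite quom_reprK. Qed.

Lemma qblE x y z (f : hom y z) m : qbl f (qpi x y m) = qpi x z (bl f m).
Proof.
apply/quom_eq; rewrite -(bilinBr (@bl_bilin _ _ M _ _ _)).
exact/Sl/qpi_repr.
Qed.
Lemma qbrE w x y m (f : hom w x) : qbr (qpi x y m) f = qpi w y (br m f).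
Proof.
apply/quom_eq; rewrite -(bilinBl (@br_bilin _ _ M _ _ _)).
exact/Sr/qpi_repr.
Qed.

Fact qbl_bilin x y z : bilin (@qbl x y z).
Proof.
split=> [f a u v|u a f g].
  have [m ->] := qpi_surj u; have [n ->] := qpi_surj v.
  by rewrite -linearP !qblE (bilinr (@bl_bilin _ _ M _ _ _)) linearP.
have [m ->] := qpi_surj u.
by rewrite !qblE (bilinl (@bl_bilin _ _ M _ _ _)) linearP.
Qed.
Fact qbr_bilin x y z : bilin (@qbr x y z).
Proof.
split=> [u a f g|f a u v].
  have [m ->] := qpi_surj u.
  by rewrite !qbrE (bilinr (@br_bilin _ _ M _ _ _)) linearP.
have [m ->] := qpi_surj u; have [n ->] := qpi_surj v.
by rewrite -linearP !qbrE (bilinl (@br_bilin _ _ M _ _ _)) linearP.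
Qed.
Fact qblA w x y z (f : hom y z) (g : hom x y) (u : qsp w x) :
  qbl f (qbl g u) = qbl (comp f g) u.
Proof. by have [m ->] := qpi_surj u; rewrite !qblE blA. Qed.
Fact qbrA v w x y (u : qsp x y) (f : hom w x) (g : hom v w) :
  qbr (qbr u f) g = qbr u (comp f g).
Proof. by have [m ->] := qpi_surj u; rewrite !qbrE brA. Qed.
Fact qbl1 x y (u : qsp x y) : qbl (idm y) u = u.
Proof. by have [m ->] := qpi_surj u; rewrite !qblE bl1. Qed.
Fact qbr1 x y (u : qsp x y) : qbr u (idm x) = u.
Proof. by have [m ->] := qpi_surj u; rewrite !qbrE br1. Qed.
Fact qblr w x y z (f : hom y z) (u : qsp x y) (g : hom w x) :
  qbl f (qbr u g) = qbr (qbl f u) g.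
Proof. by have [m ->] := qpi_surj u; rewrite !(qblE, qbrE) blr. Qed.

Definition qbimod : bimod D :=
  Bimod qbl_bilin qbr_bilin qblA qbrA qbl1 qbr1 qblr.

Definition qhom : bimod_hom M qbimod :=
  @BimodHom k D M qbimod qpi (fun _ _ _ f m => esym (qblE f m))
    (fun _ _ _ m f => esym (qbrE m f)).

Section Lift.
Variables (N : bimod D) (f : bimod_hom M N).
Hypothesis fS : forall x y m, m \in S x y -> f x y m = 0.
Definition qlift_fun x y (u : qsp x y) : N x y := f x y (quom_repr u).
Lemma qlift_funE x y m : qlift_fun (qpi x y m) = f x y m.
Proof. by apply/eqP; rewrite -subr_eq0 -linearB; apply/eqP/fS/qpi_repr. Qed.
Fact qlift_linear x y : linear (@qlift_fun x y).
Proof.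
move=> a u v; have [m ->] := qpi_surj u; have [n ->] := qpi_surj v.
by rewrite -linearP !qlift_funE linearP.
Qed.
Fact qlift_bl x y z (h : hom y z) (u : qbimod x y) :
  mklin (@qlift_linear x z) (bl h u) = bl h (mklin (@qlift_linear x y) u).
Proof.
by have [m ->] := qpi_surj u; rewrite !mklinE qlift_funE -bhom_bl /= qblE qlift_funE.
Qed.
Fact qlift_br w x y (u : qbimod x y) (h : hom w x) :
  mklin (@qlift_linear w y) (br u h) = br (mklin (@qlift_linear x y) u) h.
Proof.
by have [m ->] := qpi_surj u; rewrite !mklinE qlift_funE -bhom_br /= qbrE qlift_funE.
Qed.
Definition qlift : bimod_hom qbimod N := BimodHom qlift_bl qlift_br.
Lemma qliftE x y m : qlift x y (qpi x y m) = f x y m.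
Proof. by rewrite /= mklinE qlift_funE. Qed.
End Lift.
End Quotients.

(** Both maps factor through the quotient by the kernel of [f], on which [f] becomes injective. In
    the comparison of resolutions [f] is a differential rather than an embedding. *)
Lemma ext_along (A B J : bimod D) (f : bimod_hom A B) (g : bimod_hom A J) :
  injective_bimod J -> (forall x y m, f x y m = 0 -> g x y m = 0) ->
  exists h : bimod_hom B J, forall x y m, h x y (f x y m) = g x y m.
Proof.
move=> Ji fg.
have Sl x y z (h : hom y z) m : m \in kerp (f x y) -> bl h m \in kerp (f x z).
  by move=> /eqP e; apply/eqP; rewrite bhom_bl e (bilin0r (@bl_bilin _ _ B _ _ _)).
have Sr w x y m (h : hom w x) : m \in kerp (f x y) -> br m h \in kerp (f w y).
  by move=> /eqP e; apply/eqP; rewrite bhom_br e (bilin0l (@br_bilin _ _ B _ _ _)).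
have f0 x y m : m \in kerp (f x y) -> f x y m = 0 by move/eqP.
have g0 x y m : m \in kerp (f x y) -> g x y m = 0 by move=> /f0; apply: fg.
have [|h hE] := Ji _ _ (qlift Sl Sr f0) (qlift Sl Sr g0).
  move=> x y u v; have [m ->] := qpi_surj u; have [n ->] := qpi_surj v.
  rewrite !qliftE => e; apply/eqP; rewrite -subr_eq0 -linearB; apply/eqP/qpi_eq0/eqP.
  by rewrite linearB e subrr.
exists h => x y m; have := hE x y (qpi (fun x y => kerp (f x y)) x y m).
by rewrite !qliftE.
Qed.

(** * Cofree bimodules *)

Section Cofree.
Variable V : D -> D -> lmodType k.

Definition cofamily (x y : D) : lmodType k :=
  dprod (fun a => dprod (fun b => dprod (fun _ : hom y b => dprod (fun _ : hom a x => V a b)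
   : lmodType k) : lmodType k) : lmodType k).

Definition cofp x y : {pred cofamily x y} := fun p =>
  `[< forall a b, bilin (fun (g : hom y b) (f : hom a x) => p a b g f) >].
Fact cofp_submod x y : GRing.submod_closed (@cofp x y).
Proof.
split.
  by apply/asboolP => a b; split=> [u c v w|u c v w]; rewrite scaler0 addr0.
move=> c p q /asboolP hp /asboolP hq; apply/asboolP => a b.
split=> [u d v w|u d v w].
  rewrite -![(c *: p + q) a b _ _]/(c *: p a b _ _ + q a b _ _).
  rewrite (bilinr (hp a b)) (bilinr (hq a b)) !scalerDr !scalerA mulrC.
  by rewrite -!addrA; congr (_ + _); rewrite addrCA.
rewrite -![(c *: p + q) a b _ _]/(c *: p a b _ _ + q a b _ _).
rewrite (bilinl (hp a b)) (bilinl (hq a b)) !scalerDr !scalerA mulrC.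
by rewrite -!addrA; congr (_ + _); rewrite addrCA.
Qed.
HB.instance Definition _ x y :=
  GRing.isSubmodClosed.Build k (cofamily x y) (@cofp x y) (@cofp_submod x y).

Definition cof x y : lmodType k := subm (@cofp x y).

Lemma cof_bilin x y (p : cof x y) a b :
  bilin (fun (g : hom y b) (f : hom a x) => val p a b g f).
Proof. by have /asboolP := valP p; apply. Qed.

Lemma cofP x y (p q : cof x y) :
  (forall a b g f, val p a b g f = val q a b g f) -> p = q.
Proof.
move=> h; apply: val_inj; apply: dprodP => a; apply: dprodP => b.
by apply: dprodP => g; apply: dprodP => f; apply: h.
Qed.

Lemma cof_lin x y c (p q : cof x y) a b g f :
  val (c *: p + q) a b g f = c *: val p a b g f + val q a b g f.
Proof. by []. Qed.

Lemma cofZ x y c (p : cof x y) a b g f : val (c *: p) a b g f = c *: val p a b g f.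
Proof. by []. Qed.

Fact mkcof_subproof x y (p : forall a b, hom y b -> hom a x -> V a b) :
  (forall a b, bilin (p a b)) -> (p : cofamily x y) \in @cofp x y.
Proof. by move=> h; apply/asboolP. Qed.
Definition mkcof x y (p : forall a b, hom y b -> hom a x -> V a b)
  (h : forall a b, bilin (p a b)) : cof x y := exist _ (p : cofamily x y) (mkcof_subproof h).

Fact cof_bl_subproof x y z (f : hom y z) (p : cof x y) a b :
  bilin (fun (g : hom z b) (h : hom a x) => val p a b (comp g f) h).
Proof.
split=> [u c v w|u c v w]; first exact: (bilinr (cof_bilin p a b)).
rewrite (bilinl (@comp_bilin _ _ _ _ _)).
exact: (bilinl (cof_bilin p a b)).
Qed.
Definition cof_bl x y z (f : hom y z) (p : cof x y) : cof x z :=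
  mkcof (cof_bl_subproof f p).
Fact cof_br_subproof w x y (p : cof x y) (f : hom w x) a b :
  bilin (fun (g : hom y b) (h : hom a w) => val p a b g (comp f h)).
Proof.
split=> [u c v t|u c v t]; last exact: (bilinl (cof_bilin p a b)).
rewrite (bilinr (@comp_bilin _ _ _ _ _)).
exact: (bilinr (cof_bilin p a b)).
Qed.
Definition cof_br w x y (p : cof x y) (f : hom w x) : cof w y :=
  mkcof (cof_br_subproof p f).

Fact cof_bl_bilin x y z : bilin (@cof_bl x y z).
Proof.
split=> [f c p q|p c f f']; apply: cofP => a b g h; rewrite cof_lin //=.
rewrite (bilinr (@comp_bilin _ _ _ _ _)).
exact: (bilinl (cof_bilin p a b)).
Qed.
Fact cof_br_bilin w x y : bilin (@cof_br w x y).
Proof.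
split=> [p c f f'|f c p q]; apply: cofP => a b g h; rewrite cof_lin //=.
rewrite (bilinl (@comp_bilin _ _ _ _ _)).
exact: (bilinr (cof_bilin p a b)).
Qed.
Fact cof_blA w x y z (f : hom y z) (g : hom x y) (p : cof w x) :
  cof_bl f (cof_bl g p) = cof_bl (comp f g) p.
Proof. by apply: cofP => a b u v /=; rewrite compA. Qed.
Fact cof_brA v w x y (p : cof x y) (f : hom w x) (g : hom v w) :
  cof_br (cof_br p f) g = cof_br p (comp f g).
Proof. by apply: cofP => a b u t /=; rewrite compA. Qed.
Fact cof_bl1 x y (p : cof x y) : cof_bl (idm y) p = p.
Proof. by apply: cofP => a b u t /=; rewrite compm1. Qed.
Fact cof_br1 x y (p : cof x y) : cof_br p (idm x) = p.
Proof. by apply: cofP => a b u t /=; rewrite comp1m. Qed.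
Fact cof_blr w x y z (f : hom y z) (p : cof x y) (g : hom w x) :
  cof_bl f (cof_br p g) = cof_br (cof_bl f p) g.
Proof. by apply: cofP. Qed.

(* The D-bimodule cofreely generated by V: Hom_D^e(M, cofree) is the product
   of the Hom_k(M a b, V a b). *)
Definition cofree : bimod D :=
  Bimod cof_bl_bilin cof_br_bilin cof_blA cof_brA cof_bl1 cof_br1 cof_blr.

Section ToCofree.
Variables (M : bimod D) (f : forall a b, {linear M a b -> V a b}).
Fact to_cof_bilin x y (m : M x y) a b :
  bilin (fun (g : hom y b) (h : hom a x) => f a b (bl g (br m h))).
Proof.
split=> [u c v w|u c v w].
  rewrite (bilinr (@br_bilin _ _ M _ _ _)) (bilinr (@bl_bilin _ _ M _ _ _)).
  exact: linearP.
by rewrite (bilinl (@bl_bilin _ _ M _ _ _)) linearP.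
Qed.
Definition to_cof x y (m : M x y) : cof x y := mkcof (to_cof_bilin m).
Fact to_cof_linear x y : linear (@to_cof x y).
Proof.
move=> c m n; apply: cofP => a b g h; rewrite cof_lin /=.
rewrite (bilinl (@br_bilin _ _ M _ _ _)) (bilinr (@bl_bilin _ _ M _ _ _)).
exact: linearP.
Qed.
Fact to_cofree_bl x y z (h : hom y z) (m : M x y) :
  mklin (@to_cof_linear x z) (bl h m) = @bl k D cofree x y z h (mklin (@to_cof_linear x y) m).
Proof. by rewrite !mklinE; apply: cofP => a b u t /=; rewrite -blr blA. Qed.
Fact to_cofree_br w x y (m : M x y) (h : hom w x) :
  mklin (@to_cof_linear w y) (br m h) = @br k D cofree w x y (mklin (@to_cof_linear x y) m) h.
Proof. by rewrite !mklinE; apply: cofP => a b u t /=; rewrite brA. Qed.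
Definition to_cofree : bimod_hom M cofree :=
  @BimodHom k D M cofree (fun x y => mklin (@to_cof_linear x y)) to_cofree_bl to_cofree_br.
Lemma to_cofreeE x y m a b g h : val (to_cofree x y m) a b g h = f a b (bl g (br m h)).
Proof. by rewrite /= mklinE. Qed.
End ToCofree.

(** A morphism to [cofree] is determined by its components evaluated at identities, and these are
    arbitrary linear maps; to extend one, a linear retraction of each [i a b] is enough. *)
Lemma cofree_injective : injective_bimod cofree.
Proof.
move=> M N i f iinj.
have h a b : exists g : {linear N a b -> M a b}, cancel (i a b) g.
  exact: gen_inverse_inj (iinj a b).
pose g a b := sval (cid (h a b)).
have gK a b : cancel (i a b) (g a b) by rewrite /g; case: cid.
have fl a b : linear (fun m : N a b => val (f a b (g a b m)) a b (idm b) (idm a)).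
  by move=> c u v; rewrite !linearP.
exists (to_cofree (fun a b => mklin (fl a b))) => x y m.
apply: cofP => a b u v; rewrite to_cofreeE mklinE -bhom_br -bhom_bl gK.
by rewrite bhom_bl bhom_br /= comp1m compm1.
Qed.
End Cofree.

Definition emb (M : bimod D) : bimod_hom M (cofree M) :=
  to_cofree (fun a b => idfun : {linear M a b -> M a b}).

Lemma embE (M : bimod D) x y (m : M x y) a b g h :
  val (emb M x y m) a b g h = bl g (br m h).
Proof. exact: to_cofreeE. Qed.

Lemma emb_inj (M : bimod D) x y : injective (emb M x y).
Proof.
move=> m n e; have := congr1 (fun p => val p x y (idm y) (idm x)) e.
by rewrite /= -/(emb M) !embE !bl1 !br1.
Qed.

(** * Injective resolutions and their comparison *)

Section Resolutions.
Fact coker_bl (M N : bimod D) (f : bimod_hom M N) x y z (h : hom y z) m :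
  m \in imp (f x y) -> bl h m \in imp (f x z).
Proof. by move=> /asboolP[v ->]; apply/asboolP; exists (bl h v); rewrite bhom_bl. Qed.
Fact coker_br (M N : bimod D) (f : bimod_hom M N) w x y m (h : hom w x) :
  m \in imp (f x y) -> br m h \in imp (f w y).
Proof. by move=> /asboolP[v ->]; apply/asboolP; exists (br v h); rewrite bhom_br. Qed.

Definition cosyzygy (M : bimod D) : bimod D :=
  qbimod (@coker_bl _ _ (emb M)) (@coker_br _ _ (emb M)).
Definition cosyzygy_pi (M : bimod D) : bimod_hom (cofree M) (cosyzygy M) :=
  qhom (@coker_bl _ _ (emb M)) (@coker_br _ _ (emb M)).

Lemma cosyzygy_pi_eq0 M x y p : cosyzygy_pi M x y p = 0 <-> exists m, p = emb M x y m.
Proof. by rewrite [_ = 0]qpi_eq0; split=> [/asboolP|h]; last exact/asboolP. Qed.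
Lemma cosyzygy_pi_surj M x y u : exists p, u = cosyzygy_pi M x y p.
Proof. exact: qpi_surj. Qed.

Definition cosyzygies (M : bimod D) j := iter j cosyzygy M.

Definition cosyzygy_diff (M : bimod D) : bimod_hom (cofree M) (cofree (cosyzygy M)) :=
  bhcomp (emb (cosyzygy M)) (cosyzygy_pi M).

Lemma emb_eq0 (M : bimod D) x y m : emb M x y m = 0 -> m = 0.
Proof. by move=> h; apply: (@emb_inj M x y); rewrite h linear0. Qed.

Lemma cofree_res_exact0 (M : bimod D) x y : exact_at 0 (emb M x y) (cosyzygy_diff M x y).
Proof.
move=> b; rewrite bhcompE; split=> [/emb_eq0/cosyzygy_pi_eq0//|h].
by rewrite (cosyzygy_pi_eq0 b).2 // linear0.
Qed.

Lemma cofree_res_exactS (M : bimod D) x y :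
  exact_at 0 (cosyzygy_diff M x y) (cosyzygy_diff (cosyzygy M) x y).
Proof.
move=> b; rewrite bhcompE; split=> [/emb_eq0/cosyzygy_pi_eq0[m ->]|[a ->]].
  by have [p ->] := cosyzygy_pi_surj m; exists p; rewrite bhcompE.
rewrite (cosyzygy_pi_eq0 _).2 ?linear0 //.
by exists (cosyzygy_pi M x y a); rewrite bhcompE.
Qed.

Definition cofree_res (M : bimod D) : injres M.
Proof.
apply: (@InjRes k D M (fun j => cofree (cosyzygies M j))
  (fun j => cofree_injective (V := cosyzygies M j)) (emb M)
  (fun j => cosyzygy_diff (cosyzygies M j))).
- exact: emb_inj.
- exact: cofree_res_exact0.
- by move=> j; exact: cofree_res_exactS.
Qed.

Record injres_map (M N : bimod D) (phi : bimod_hom M N) (I : injres M) (J : injres N) :=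
  InjresMap {
  irm :> forall j, bimod_hom (I j) (J j);
  irm_aug : forall x y m, irm 0%N x y (ir_aug I x y m) = ir_aug J x y (phi x y m);
  irm_diff : forall j x y m, irm j.+1 x y (ir_diff I j x y m) = ir_diff J j x y (irm j x y m)
}.

Lemma injres_map_exists (M N : bimod D) (phi : bimod_hom M N) (I : injres M) (J : injres N) :
  inhabited (injres_map phi I J).
Proof.
have h0 : exists f : bimod_hom (I 0%N) (J 0%N), forall x y m,
    f x y (ir_aug I x y m) = ir_aug J x y (phi x y m).
  have [|x y m h|f fE] := @ext_along _ _ _ (ir_aug I) (bhcomp (ir_aug J) phi).
  - exact: ir_injective.
  - rewrite bhcompE; suff -> : m = 0 by rewrite !linear0.
    by apply: (@ir_aug_inj _ _ _ I); rewrite h linear0.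
  by exists f => x y m; rewrite fE bhcompE.
(* The property carried along the recursion; it is what [ext_along] requires in the next degree. *)
pose good j (f : bimod_hom (I j) (J j)) := forall x y m,
  ir_diff I j x y m = 0 -> ir_diff J j x y (f x y m) = 0.
have hS j (f : bimod_hom (I j) (J j)) : good j f ->
    exists g : bimod_hom (I j.+1) (J j.+1), good j.+1 g /\
      forall x y m, g x y (ir_diff I j x y m) = ir_diff J j x y (f x y m).
  move=> hf; have [|x y m h|g gE] := @ext_along _ _ _ (ir_diff I j) (bhcomp (ir_diff J j) f).
  - exact: ir_injective.
  - by rewrite bhcompE; apply: hf.
  have gE' x y m : g x y (ir_diff I j x y m) = ir_diff J j x y (f x y m).
    by rewrite gE bhcompE.
  exists g; split=> // x y m /(ir_exactS)[a ->]; rewrite gE'.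
  by apply/ir_exactS; exists (f x y a).
have [f0 f0E] := h0.
have g0 : good 0%N f0.
  by move=> x y m /ir_exact0[a ->]; rewrite f0E; apply/ir_exact0; exists (phi x y a).
pose step j (s : {f : bimod_hom (I j) (J j) | good j f}) :
    {f : bimod_hom (I j.+1) (J j.+1) | good j.+1 f} :=
  exist _ (sval (cid (hS j (sval s) (svalP s)))) (svalP (cid (hS j (sval s) (svalP s)))).1.
pose fix F j : {f : bimod_hom (I j) (J j) | good j f} :=
  if j is j'.+1 then step j' (F j') else exist _ f0 g0.
split; exists (fun j => sval (F j)) => // j x y m.
by rewrite /= ; case: cid => g [? /= gE].
Qed.

End Resolutions.
End Bimodules.

(** * Coinduced bimodules and acyclicity *)

Arguments inner_faces : simpl never.
Arguments last_face : simpl never.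

Section Acyclicity.
Variables (k : fieldType) (C : klcat k).

Lemma chain0_case (P : forall x z, chain 0 x z -> Prop) :
  (forall x : C, P x x (cnil x)) -> forall x z (c : chain 0 x z), P x z c.
Proof.
move=> h x z c; move: P h.
refine (match c as c0 in chain m x0 z0 return
  (match m as m return chain m x0 z0 -> Prop with
   | 0%N => fun c0 => forall P : forall x z, chain 0 x z -> Prop,
      (forall x : C, P x x (cnil x)) -> P x0 z0 c0
   | _ => fun _ => True end c0) with
  | cnil x => _ | ccons _ _ _ _ _ _ => I end).
by move=> P; apply.
Qed.

Lemma chainS_case n (P : forall x z, chain n.+1 x z -> Prop) :
  (forall (x y z : C) (f : hom y z) (c : chain n x y), P x z (ccons f c)) ->
  forall x z (c : chain n.+1 x z), P x z c.
Proof.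
move=> h x z c; move: P h.
refine (match c as c0 in chain m x0 z0 return
  (match m as m return chain m x0 z0 -> Prop with
   | 0%N => fun _ => True
   | m'.+1 => fun c0 => forall P : forall x z, chain m'.+1 x z -> Prop,
      (forall (x y z : C) (f : hom y z) (c : chain m' x y), P x z (ccons f c)) -> P x0 z0 c0
   end c0) with
  | cnil x => I | ccons _ _ _ _ f c => _ end).
by move=> P; apply.
Qed.

Fixpoint crcons n (x z : C) (c : chain n x z) : forall w, hom w x -> chain n.+1 w z :=
  match c in chain n x z return forall w, hom w x -> chain n.+1 w z with
  | cnil x => fun w g => ccons g (cnil w)
  | ccons _ _ _ _ f c' => fun w g => ccons f (crcons c' g)
  end.

Lemma crcons_slot a n (x z : C) (c c' c'' : chain n x z) w (g : hom w x) :
  slot_comb a c c' c'' -> slot_comb a (crcons c g) (crcons c' g) (crcons c'' g).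
Proof. by move=> h; elim: h w g => *; [exact: slot_here | apply: slot_there; auto]. Qed.

Lemma crcons_slotr a n (x z : C) (c : chain n x z) w (g g' : hom w x) :
  slot_comb a (crcons c g) (crcons c g') (crcons c (a *: g + g')).
Proof. by elim: c w g g' => *; [exact: slot_here | apply: slot_there; auto]. Qed.

Lemma last_face_crcons (V : zmodType) n (x z : C) (c : chain n x z) w (g : hom w x)
    (K : forall y, chain n y z -> hom w y -> V) :
  last_face (crcons c g) K = K _ c g.
Proof.
elim: c w g K => [y|m x1 y1 z1 f c IH] w g K //=.
case: c f g IH K => [y|m' x' y' z' f' c'] f g IH K //=.
by rewrite last_face2 IH.
Qed.

(** A single inner face touches [g]: it composes the last entry of [c] with [g]. That entry is
    exposed by [last_face], whence the last term and its sign. *)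
Lemma inner_faces_crcons (V : lmodType k) n (x z : C) (c : chain n.+1 x z) w (g : hom w x)
    (K : chain n.+1 w z -> V) :
  inner_faces (crcons c g) K = inner_faces c (fun c' => K (crcons c' g)) +
   (-1) ^+ n.+1 *: last_face c (fun y c' h => K (crcons c' (comp h g))).
Proof.
elim: n x z c w g K => [|n IH]; apply: chainS_case => x y z f c.
  move: x y c f; apply: chain0_case => y f w g K /=.
  by rewrite inner_faces2 /inner_faces /last_face subr0 add0r expr1 scaleN1r.
move: x y c f. apply: chainS_case => x y z' f' c f w g K /=.
rewrite !inner_faces2 last_face2 -[ccons f' (crcons c g)]/(crcons (ccons f' c) g) IH.
by rewrite opprD addrA [in RHS]exprS mulN1r scaleNr.
Qed.

Section Coinduction.
Variable N : bimod C.

Definition coindfam (x z : C) : lmodType k :=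
  dprod (fun w => dprod (fun _ : hom w x => N w z) : lmodType k).
Definition coindp x z : {pred coindfam x z} :=
  fun p => `[< forall w, linear (fun g : hom w x => p w g) >].
Fact coindp_submod x z : GRing.submod_closed (@coindp x z).
Proof.
split; first by apply/asboolP => w a u v; rewrite scaler0 addr0.
move=> c p q /asboolP hp /asboolP hq; apply/asboolP => w a u v.
rewrite -![(c *: p + q) w _]/(c *: p w _ + q w _) hp hq.
rewrite !scalerDr !scalerA mulrC -!addrA; congr (_ + _).
by rewrite addrCA.
Qed.
HB.instance Definition _ x z :=
  GRing.isSubmodClosed.Build k (coindfam x z) (@coindp x z) (@coindp_submod x z).
Definition coind x z : lmodType k := subm (@coindp x z).

Lemma coindP x z (p q : coind x z) : (forall w g, val p w g = val q w g) -> p = q.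
Proof. by move=> h; apply: val_inj; apply: dprodP => w; apply: dprodP => g; apply: h. Qed.
Lemma coind_linear x z (p : coind x z) w : linear (fun g : hom w x => val p w g).
Proof. by have /asboolP := valP p; apply. Qed.
Lemma coind_lin x z c (p q : coind x z) w g :
  val (c *: p + q) w g = c *: val p w g + val q w g.
Proof. by []. Qed.
Fact mkcoind_subproof x z (p : forall w, hom w x -> N w z) :
  (forall w, linear (p w)) -> (p : coindfam x z) \in @coindp x z.
Proof. by move=> h; apply/asboolP. Qed.
Definition mkcoind x z (p : forall w, hom w x -> N w z) (h : forall w, linear (p w)) :
  coind x z := exist _ (p : coindfam x z) (mkcoind_subproof h).

Fact coind_bl_subproof x y z (f : hom y z) (p : coind x y) w :
  linear (fun g : hom w x => bl f (val p w g)).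
Proof. by move=> c g h; rewrite coind_linear (bilinr (@bl_bilin _ _ N _ _ _)). Qed.
Definition coind_bl x y z (f : hom y z) (p : coind x y) : coind x z :=
  mkcoind (coind_bl_subproof f p).
Fact coind_br_subproof w x y (p : coind x y) (f : hom w x) v :
  linear (fun g : hom v w => val p v (comp f g)).
Proof. by move=> c g h; rewrite (bilinr (@comp_bilin _ _ _ _ _)) coind_linear. Qed.
Definition coind_br w x y (p : coind x y) (f : hom w x) : coind w y :=
  mkcoind (coind_br_subproof p f).

Fact coind_bl_bilin x y z : bilin (@coind_bl x y z).
Proof.
split=> [f c p q|p c f f']; apply: coindP => w g; rewrite coind_lin /=.
  exact: (bilinr (@bl_bilin _ _ N _ _ _)).
exact: (bilinl (@bl_bilin _ _ N _ _ _)).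
Qed.
Fact coind_br_bilin w x y : bilin (@coind_br w x y).
Proof.
split=> [p c f f'|f c p q]; apply: coindP => v g; rewrite coind_lin /=.
  by rewrite (bilinl (@comp_bilin _ _ _ _ _)) coind_linear.
by [].
Qed.
Fact coind_blA w x y z (f : hom y z) (g : hom x y) (p : coind w x) :
  coind_bl f (coind_bl g p) = coind_bl (comp f g) p.
Proof. by apply: coindP => v h /=; rewrite blA. Qed.
Fact coind_brA v w x y (p : coind x y) (f : hom w x) (g : hom v w) :
  coind_br (coind_br p f) g = coind_br p (comp f g).
Proof. by apply: coindP => u h /=; rewrite compA. Qed.
Fact coind_bl1 x y (p : coind x y) : coind_bl (idm y) p = p.
Proof. by apply: coindP => u h /=; rewrite bl1. Qed.
Fact coind_br1 x y (p : coind x y) : coind_br p (idm x) = p.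
Proof. by apply: coindP => u h /=; rewrite comp1m. Qed.
Fact coind_blr w x y z (f : hom y z) (p : coind x y) (g : hom w x) :
  coind_bl f (coind_br p g) = coind_br (coind_bl f p) g.
Proof. exact: coindP. Qed.

(* Hom_k(C, N) *)
Definition coindr : bimod C :=
  Bimod coind_bl_bilin coind_br_bilin coind_blA coind_brA coind_bl1 coind_br1 coind_blr.

Lemma coindr_blE x y z (f : hom y z) (p : coind x y) w (g : hom w x) :
  val (@bl k C coindr x y z f p) w g = bl f (val p w g).
Proof. by []. Qed.

Fact to_coindr_subproof x z (m : N x z) w : linear (fun g : hom w x => br m g).
Proof. by move=> c g h; rewrite (bilinr (@br_bilin _ _ N _ _ _)). Qed.
Definition to_coind x z (m : N x z) : coind x z := mkcoind (to_coindr_subproof m).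
Fact to_coind_linear x z : linear (@to_coind x z).
Proof.
move=> c m n; apply: coindP => w g; rewrite coind_lin /=.
exact: (bilinl (@br_bilin _ _ N _ _ _)).
Qed.
Fact to_coindr_bl x y z (f : hom y z) (m : N x y) :
  mklin (@to_coind_linear x z) (bl f m) =
  @bl k C coindr x y z f (mklin (@to_coind_linear x y) m).
Proof. by rewrite !mklinE; apply: coindP => w g /=; rewrite blr. Qed.
Fact to_coindr_br w x y (m : N x y) (f : hom w x) :
  mklin (@to_coind_linear w y) (br m f) =
  @br k C coindr w x y (mklin (@to_coind_linear x y) m) f.
Proof. by rewrite !mklinE; apply: coindP => v g /=; rewrite brA. Qed.
Definition to_coindr : bimod_hom N coindr :=
  @BimodHom k C N coindr (fun x z => mklin (@to_coind_linear x z)) to_coindr_bl to_coindr_br.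
Lemma to_coindrE x z m w g : val (to_coindr x z m) w g = br m g.
Proof. by rewrite /= mklinE. Qed.
Lemma to_coindr_inj x z : injective (to_coindr x z).
Proof.
move=> m n e; have := congr1 (fun p => val p x (idm x)) e.
by rewrite !to_coindrE !br1.
Qed.
End Coinduction.

Definition acyclic (N : bimod C) :=
  forall n (F : coch n.+1 N), diff F = 0 -> exists G, F = diff G.

Lemma acyclic_retract (N N' : bimod C) (i : bimod_hom N N') (r : bimod_hom N' N) :
  (forall x y m, r x y (i x y m) = m) -> acyclic N' -> acyclic N.
Proof.
move=> ri ac n F dF; have [|G eG] := ac n (coch_map i F); first by rewrite diff_coch_map dF linear0.
exists (coch_map r G); rewrite diff_coch_map -eG.
by apply: cochP => x z c /=; rewrite ri.
Qed.

Section Shift.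
Variables (N : bimod C) (n : nat) (F : coch n.+1 N).

Fact shift_linear x z (c : chain n x z) w : linear (fun g : hom w x => F w z (crcons c g)).
Proof. by move=> a g h; apply: (cofunP F); apply: crcons_slotr. Qed.
Fact shift_multilinear :
  multilinear (fun x z (c : chain n x z) => mkcoind (@shift_linear x z c) : coindr N x z).
Proof.
move=> a x z c c' c'' h; apply: coindP => w g; rewrite coind_lin /=.
by apply: (cofunP F); apply: crcons_slot.
Qed.
Definition shift : coch n (coindr N) := Coch shift_multilinear.
Lemma shiftE x z (c : chain n x z) w (g : hom w x) :
  val (shift x z c) w g = F w z (crcons c g).
Proof. by []. Qed.
End Shift.

(** By [inner_faces_crcons], the faces of [crcons c g] are the faces of [c] with coinduced
    coefficients, except for the last one: it gives [br (F x z c) g], the value at [g] of the image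
    of [F x z c] under [to_coindr]. *)
Lemma shift_diff (N : bimod C) n (F : coch n.+1 N) :
  shift (diff F) = diff (shift F) + (-1) ^+ n *: coch_map (to_coindr N) F.
Proof.
apply: cochP => x z c; apply: coindP => w g; rewrite shiftE.
rewrite -[RHS]/(val (diff (shift F) x z c) w g +
  (-1) ^+ n *: val (to_coindr N x z (F x z c)) w g) to_coindrE.
have evl x' z' (w' : C) (g' : hom w' x') :
    linear (fun p : coindr N x' z' => val p w' g') by move=> a p q.
pose ev := mklin (evl x z w g).
have -> : val (diff (shift F) x z c) w g = ev (diff (shift F) x z c) by rewrite mklinE.
rewrite /= /diff_fun !linearD linearZ /=.
rewrite -(@first_face_map _ _ _ _ ev _ _ _ c _
  (fun y f c' => bl f (F w y (crcons c' g)))); last by move=> y f c'; rewrite mklinE.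
rewrite -(@inner_faces_map _ _ _ _ ev _ _ _ c _
  (fun c' => F w z (crcons c' g))); last by move=> c'; rewrite mklinE.
rewrite -(@last_face_map _ _ _ _ ev _ _ _ c _
  (fun y c' f => F w z (crcons c' (comp f g)))); last by move=> y c' f; rewrite mklinE.
rewrite last_face_crcons inner_faces_crcons.
have -> : first_face (crcons c g) (fun y f c' => bl f (F w y c')) =
    first_face c (fun y f c' => bl f (F w y (crcons c' g))).
  by move: x z c g {ev}; apply: chainS_case => x1 y1 z1 f c g.
by rewrite addrA [(-1) ^+ n.+2]exprS [(-1) ^+ n.+1 in X in _ + X = _]exprS mulrA mulrNN !mul1r.
Qed.

Lemma acyclic_coindr (N : bimod C) (r : bimod_hom (coindr N) N) :
  (forall x y m, r x y (to_coindr N x y m) = m) -> acyclic N.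
Proof.
(* For a cocycle, [shift_diff] says that [diff (shift F)] is (-1)^(n+1) times the image of [F] under
   [to_coindr]; the same sign in the witness cancels it. *)
move=> rK n F dF; exists ((-1) ^+ n.+1 *: coch_map r (shift F)).
rewrite linearZ /= diff_coch_map.
have e0 : shift (0 : coch n.+2 N) = 0 by apply: cochP => x z c; apply: coindP.
have := shift_diff F; rewrite dF e0 => /esym /eqP; rewrite addr_eq0 => /eqP->.
rewrite -scaleNr -[X in coch_map r (X *: _)]mulN1r -exprS.
rewrite linearZ /= scalerA -expr2 sqrr_sign scale1r.
by apply: cochP => x z c /=; rewrite rK.
Qed.

Lemma crcons_surj n x z (c : chain n.+1 x z) :
  exists y (c' : chain n y z) (g : hom x y), c = crcons c' g.
Proof.
elim: n x z c => [|n IH]; apply: chainS_case => x y z f c.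
  by move: x y c f; apply: chain0_case => y f; exists z, (cnil z), f.
by have [y' [c' [g ->]]] := IH _ _ c; exists y', (ccons f c'), g.
Qed.

Lemma shift_eq0 (N : bimod C) n (F : coch n.+1 N) : shift F = 0 -> F = 0.
Proof.
move=> h; apply: cochP => x z c; have [y [c' [g ->]]] := crcons_surj c.
by rewrite -shiftE h.
Qed.

Lemma diff0E (M : bimod C) (F : coch 0 M) x y (f : hom x y) :
  diff F x y (ccons f (cnil x)) = bl f (F x x (cnil x)) - br (F y y (cnil y)) f.
Proof. by rewrite /= /diff_fun /inner_faces /last_face /= addr0 expr1 scaleN1r. Qed.

(** Induction on the degree for all coefficients at once: by [shift_diff] used twice, the shift of
    [diff (diff F)] is [diff (diff (shift F))] plus two terms that cancel, and [shift F] has lower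
    degree. Only degree 0 is computed on chains. *)
Lemma diff_diff n (M : bimod C) (F : coch n M) : diff (diff F) = 0.
Proof.
elim: n M F => [|n IH] M F; last first.
  apply: shift_eq0; rewrite shift_diff shift_diff linearD linearZ /= IH add0r.
  by rewrite diff_coch_map exprS mulN1r scaleNr subrr.
apply: cochP; apply: chainS_case => x y z f c; move: x y c f.
apply: chainS_case => w x y g c f; move: w x c g; apply: chain0_case => x g.
rewrite -[LHS]/(bl f (diff F x y (ccons g (cnil x))) +
  inner_faces (ccons f (ccons g (cnil x))) (diff F x z) +
  (-1) ^+ 2 *: last_face (ccons f (ccons g (cnil x))) (fun y c' f => br (diff F y z c') f)).
rewrite inner_faces2 last_face2 /inner_faces subr0 /last_face !diff0E.
rewrite (bilinBr (@bl_bilin _ _ M _ _ _)) (bilinBl (@br_bilin _ _ M _ _ _)).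
rewrite blA blr brA -signr_odd /= expr0 scale1r.
by rewrite opprB [X in X + _]addrC !addrA !subrK subrr.
Qed.

Lemma injective_acyclic (J : bimod C) : injective_bimod J -> acyclic J.
Proof.
move=> Ji; have [r rE] := Ji _ _ (to_coindr J) (bhid J) (@to_coindr_inj J).
by apply: (acyclic_coindr (r := r)) => x y m; rewrite rE.
Qed.
End Acyclicity.

(** * Tensor products *)

Section Tensors.
Variable k : fieldType.

Definition linr (U V W : lmodType k) (f : U -> V -> W) (fb : bilin f) u : {linear V -> W} :=
  mklin (fb.1 u).
Definition linl (U V W : lmodType k) (f : U -> V -> W) (fb : bilin f) v : {linear U -> W} :=
  mklin (fb.2 v).
Lemma linrE (U V W : lmodType k) (f : U -> V -> W) (fb : bilin f) u v : linr fb u v = f u v.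
Proof. exact: mklinE. Qed.
Lemma linlE (U V W : lmodType k) (f : U -> V -> W) (fb : bilin f) u v : linl fb v u = f u v.
Proof. exact: mklinE. Qed.

Section DirectSums.
Variables (I : Type) (M N : I -> lmodType k).

Lemma dtens_ind (P : dtens M N -> Prop) :
  (forall a u v, P u -> P v -> P (a *: u + v)) -> P 0 ->
  (forall i (m : M i) (n : N i), P (dpure m n)) -> forall t, P t.
Proof.
move=> Pl P0 Pp t; rewrite -[t]quom_reprK; move: (quom_repr t) => f.
rewrite [f]monalgE linear_sum; elim: (finmap.enum_fset _) => [|x s IH].
  by rewrite big_nil.
rewrite big_cons; have -> : << f@_x *g x >> = f@_x *: << x >> :> dfree M N.
  by apply/malgP => y; rewrite mcoeffZ !mcoeffU mulrnAr mulr1.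
rewrite linearZ; apply: Pl => //; case: x => i [m n].
exact: Pp.
Qed.

Lemma dlift_map (U W : lmodType k) (L : {linear U -> W}) (g : forall i, M i -> N i -> U) t :
  L (dlift g t) = dlift (fun i m n => L (g i m n)) t.
Proof.
rewrite /dlift /flift linear_sum; apply: eq_bigr => x _.
by rewrite linearZ.
Qed.

Lemma eq_dlift (U : lmodType k) (g g' : forall i, M i -> N i -> U) t :
  (forall i m n, g i m n = g' i m n) -> dlift g t = dlift g' t.
Proof. by move=> e; apply: eq_bigr => x _; rewrite e. Qed.

Lemma dlift_comb (U : lmodType k) a (g g' : forall i, M i -> N i -> U) t :
  dlift (fun i m n => a *: g i m n + g' i m n) t = a *: dlift g t + dlift g' t.
Proof.
rewrite /dlift /flift scaler_sumr -big_split; apply: eq_bigr => x _ /=.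
by rewrite scalerDr !scalerA mulrC.
Qed.
End DirectSums.

Section Tens.
Variables V W : lmodType k.

Lemma tens_eq (U : lmodType k) (f g : {linear tens V W -> U}) :
  (forall v w, f (v ⊗ w) = g (v ⊗ w)) -> forall t, f t = g t.
Proof.
move=> e; apply: (@dtens_ind unit (fun _ => V) (fun _ => W)) => [a u v hu hv||[] m n].
- by rewrite !linearP hu hv.
- by rewrite !linear0.
exact: e.
Qed.

Lemma tlift_linear (U : lmodType k) (g : V -> W -> U) : bilin g ->
  linear (fun t : tens V W => tlift t g).
Proof. by move=> gb; exact: (@dlift_linear k unit (fun _ => V) (fun _ => W)). Qed.

Definition tl (U : lmodType k) (g : V -> W -> U) (gb : bilin g) : {linear tens V W -> U} :=
  mklin (tlift_linear gb).
Lemma tlE (U : lmodType k) (g : V -> W -> U) (gb : bilin g) t : tl gb t = tlift t g.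
Proof. exact: mklinE. Qed.
Lemma tl_pure (U : lmodType k) (g : V -> W -> U) (gb : bilin g) v w : tl gb (v ⊗ w) = g v w.
Proof. by rewrite tlE tlift_pure. Qed.

Lemma tlift_map (U U' : lmodType k) (L : {linear U -> U'}) (g : V -> W -> U) (t : tens V W) :
  L (tlift t g) = tlift t (fun v w => L (g v w)).
Proof. exact: (@dlift_map unit (fun _ => V) (fun _ => W)). Qed.
Lemma eq_tlift (U : lmodType k) (g g' : V -> W -> U) (t : tens V W) :
  (forall v w, g v w = g' v w) -> tlift t g = tlift t g'.
Proof. by move=> e; apply: eq_dlift. Qed.
Lemma tlift_comb (U : lmodType k) a (g g' : V -> W -> U) (t : tens V W) :
  tlift t (fun v w => a *: g v w + g' v w) = a *: tlift t g + tlift t g'.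
Proof. exact: (@dlift_comb unit (fun _ => V) (fun _ => W)). Qed.
Lemma tlift_scale (U : lmodType k) a (g : V -> W -> U) (t : tens V W) :
  tlift t (fun v w => a *: g v w) = a *: tlift t g.
Proof.
rewrite /tlift /dlift /flift scaler_sumr; apply: eq_bigr => x _.
by rewrite !scalerA mulrC.
Qed.
End Tens.

Section Ctens.
Variables (C : klcat k) (M : rmodule C) (N : lmodule C).

Lemma ctens_ind (P : ctens M N -> Prop) :
  (forall a u v, P u -> P v -> P (a *: u + v)) -> P 0 ->
  (forall z (m : M z) (n : N z), P (cpure m n)) -> forall t, P t.
Proof.
move=> Pl P0 Pp t; rewrite -[t]quom_reprK; move: (quom_repr t).
apply: dtens_ind => [a u v hu hv||z m n]; [rewrite linearP; exact: Pl|by rewrite linear0|].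
exact: Pp.
Qed.

Lemma ctens_eq (U : lmodType k) (f g : {linear ctens M N -> U}) :
  (forall z (m : M z) (n : N z), f (cpure m n) = g (cpure m n)) -> forall t, f t = g t.
Proof.
move=> e; apply: ctens_ind => [a u v hu hv||z m n]; last exact: e.
  by rewrite !linearP hu hv.
by rewrite !linear0.
Qed.

Lemma cpure_bilin z : bilin (fun (m : M z) (n : N z) => cpure m n).
Proof.
have [h1 h2] := @dpure_bilin k C M N z.
split=> [m a n n'|n a m m']; rewrite /cpure.
  by rewrite (h1 m a n n') linearP.
by rewrite (h2 n a m m') linearP.
Qed.

Lemma cpure_balanced y z (m : M z) (f : hom y z) (n : N y) :
  cpure (ract m f) n = cpure m (lact f n).
Proof. by apply/quom_eq; apply/asboolP => S; apply; apply: CTensRel. Qed.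

Section Lift.
Variables (U : lmodType k) (g : forall z, M z -> N z -> U).
Hypothesis gb : forall z, bilin (@g z).
Hypothesis gbal : forall y z (m : M z) (f : hom y z) (n : N y),
  g (ract m f) n = g m (lact f n).

Lemma dlift_ctens_rel t : t \in spanp (@ctens_rel k C M N) -> dlift g t = 0.
Proof.
pose L := mklin (dlift_linear gb).
move=> /asboolP /(_ (kerp L)) h; rewrite -(mklinE (dlift_linear gb)); apply/eqP.
apply: h => {t} _ [y z m f n]; apply/eqP.
by rewrite linearB /= !mklinE !dlift_pure // gbal subrr.
Qed.

Lemma clift_pi t : clift (quom_pi (spanp (@ctens_rel k C M N)) t) g = dlift g t.
Proof.
apply/eqP; rewrite -subr_eq0 /clift -!(mklinE (dlift_linear gb)) -linearB mklinE.
by apply/eqP/dlift_ctens_rel/quom_eq; rewrite quom_reprK.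
Qed.

Lemma clift_pure z (m : M z) (n : N z) : clift (cpure m n) g = g m n.
Proof. by rewrite clift_pi dlift_pure. Qed.

Lemma clift_linear : linear (fun t : ctens M N => clift t g).
Proof.
move=> a t u; rewrite -[t]quom_reprK -[u]quom_reprK.
rewrite -[X in clift X _]linearP !clift_pi.
exact: (dlift_linear gb).
Qed.

Definition cl : {linear ctens M N -> U} := mklin clift_linear.
Lemma clE t : cl t = clift t g. Proof. exact: mklinE. Qed.
Lemma cl_pure z (m : M z) (n : N z) : cl (cpure m n) = g m n.
Proof. by rewrite clE clift_pure. Qed.
End Lift.

Lemma clift_map (U W : lmodType k) (L : {linear U -> W}) (g : forall z, M z -> N z -> U) t :
  L (clift t g) = clift t (fun z m n => L (g z m n)).
Proof. exact: dlift_map. Qed.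
Lemma eq_clift (U : lmodType k) (g g' : forall z, M z -> N z -> U) t :
  (forall z m n, g z m n = g' z m n) -> clift t g = clift t g'.
Proof. exact: eq_dlift. Qed.
Lemma clift_comb (U : lmodType k) a (g g' : forall z, M z -> N z -> U) t :
  clift t (fun z m n => a *: g z m n + g' z m n) = a *: clift t g + clift t g'.
Proof. exact: dlift_comb. Qed.
End Ctens.
End Tensors.

(** * The action of H on central families *)

Section Galois.
Variables (k : fieldType) (H : hopf k) (D : comodcat H).
Notation C := (coinv D).

Section CentralFamilies.
Variable M : bimod D.

Definition family : lmodType k := dprod (fun x : D => M x x).
Definition centralp : {pred family} :=
  fun m => `[< forall (x y : D) (f : coinv_hom x y), bl (val f) (m x) = br (m y) (val f) >].
Fact centralp_submod : GRing.submod_closed centralp.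
Proof.
split.
  apply/asboolP => x y f; rewrite !dprod0.
  by rewrite (bilin0r (@bl_bilin _ _ M _ _ _)) (bilin0l (@br_bilin _ _ M _ _ _)).
move=> a m n /asboolP hm /asboolP hn; apply/asboolP => x y f.
rewrite !dprodD !dprodZ (bilinr (@bl_bilin _ _ M _ _ _)) (bilinl (@br_bilin _ _ M _ _ _)).
by rewrite hm hn.
Qed.
HB.instance Definition _ := GRing.isSubmodClosed.Build k family centralp centralp_submod.

(* H^0(C, M) *)
Definition central : lmodType k := subm centralp.
Lemma centralP (m : central) (x y : D) (f : coinv_hom x y) :
  bl (val f) (val m x) = br (val m y) (val f).
Proof. by have /asboolP := valP m; apply. Qed.
Lemma central_eq (m n : central) : (forall x, val m x = val n x) -> m = n.
Proof. by move=> h; apply: val_inj; apply: dprodP. Qed.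
Lemma central_lin a (m n : central) x : val (a *: m + n) x = a *: val m x + val n x.
Proof. by []. Qed.
Lemma centralZ a (m : central) x : val (a *: m) x = a *: val m x.
Proof. by []. Qed.
Fact mkcentral_subproof (m : forall x, M x x) :
  (forall (x y : D) (f : coinv_hom x y), bl (val f) (m x) = br (m y) (val f)) ->
  (m : family) \in centralp.
Proof. by move=> h; apply/asboolP. Qed.
Definition mkcentral (m : forall x, M x x) h : central :=
  exist _ (m : family) (@mkcentral_subproof m h).
End CentralFamilies.

Definition galois_map_fun (x y : D) z (f : contra x z) (g : cov y z) : tens (hom y x) H :=
  tlift (coact y z g) (fun g0 g1 => @comp k D y z x f g0 ⊗ g1).

Lemma galois_map_bilin (x y z : D) : bilin (@galois_map_fun x y z).
Proof.
have tb := @tpure_bilin k (hom y x) H; have cb := @comp_bilin k D y z x.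
rewrite /galois_map_fun; split=> [f a u v|g a u v].
  have gb : bilin (fun (g0 : hom y z) (g1 : H) => comp f g0 ⊗ g1).
    split=> [g0 c p q|g1 c p q]; first by rewrite (bilinr tb).
    by rewrite (bilinr cb) (bilinl tb).
  by rewrite linearP; exact: (tlift_linear gb).
rewrite -tlift_comb; apply: eq_tlift => g0 g1.
by rewrite (bilinl cb) (bilinl tb).
Qed.

Lemma comp_tens_bilin (x y z : D) (f : hom z x) :
  bilin (fun (g0 : hom y z) (g1 : H) => comp f g0 ⊗ g1).
Proof.
have tb := @tpure_bilin k (hom y x) H; have cb := @comp_bilin k D y z x.
split=> [g0 c p q|g1 c p q]; first by rewrite (bilinr tb).
by rewrite (bilinr cb) (bilinl tb).
Qed.

Lemma galois_map_balanced (x y : D) w z (f : contra x z) (c : @hom k C w z) (g : cov y w) :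
  galois_map_fun (ract f c) g = galois_map_fun f (lact c g).
Proof.
rewrite /galois_map_fun.
have /eqP hc : coact w z (val c) == val c ⊗ 1 by exact: (valP c).
rewrite /= coact_comp hc.
have tb := @tpure_bilin k (hom y z) H; have cb := @comp_bilin k D y w z.
rewrite tlift_pure; last first.
  split=> [g0 a u v|g1 a u v]; rewrite -tlift_comb; apply: eq_tlift => a0 a1.
    by rewrite mulrDl -scalerAl (bilinr tb).
  by rewrite (bilinl cb) (bilinl tb).
rewrite -(tlE (comp_tens_bilin y f)) tlift_map; apply: eq_tlift => g0 g1.
by rewrite tl_pure mul1r compA.
Qed.

Definition gmap (x y : D) : {linear ctens (contra x) (cov y) -> tens (hom y x) H} :=
  cl (M := contra x) (N := cov y) (g := @galois_map_fun x y) (@galois_map_bilin x y) (@galois_map_balanced x y).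
Lemma gmapE (x y : D) t : gmap x y t = galois_map t.
Proof. exact: clE. Qed.
Lemma gmap_pure (x y z : D) (f : hom z x) (g : hom y z) :
  gmap x y (@cpure k C (contra x) (cov y) z f g) =
  tlift (coact y z g) (fun g0 g1 => comp f g0 ⊗ g1).
Proof. exact: cl_pure. Qed.

Definition lmul_fun (x y w : D) (f : hom y x) z (a : contra y z) (b : cov w z) :
  ctens (contra x) (cov w) := @cpure k C (contra x) (cov w) z (comp f a) b.
Lemma lmul_bilin (x y w : D) (f : hom y x) z : bilin (@lmul_fun x y w f z).
Proof.
have [h1 h2] := @cpure_bilin k C (contra x) (cov w) z.
split=> [a c u v|b c u v]; first exact: h1.
by rewrite /lmul_fun (bilinr (@comp_bilin k D _ _ _)) -h2.
Qed.
Lemma lmul_balanced (x y w : D) (f : hom y x) u z (a : contra y z) (c : @hom k C u z)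
    (b : cov w u) : lmul_fun f (ract a c) b = lmul_fun f a (lact c b).
Proof. by rewrite /lmul_fun -cpure_balanced /= compA. Qed.
Definition lmul (x y w : D) (f : hom y x) :
  {linear ctens (contra y) (cov w) -> ctens (contra x) (cov w)} :=
  cl (M := contra y) (N := cov w) (g := @lmul_fun x y w f) (@lmul_bilin x y w f) (@lmul_balanced x y w f).

Definition rmul_fun (x y w : D) (f : hom w y) z (a : contra x z) (b : cov y z) :
  ctens (contra x) (cov w) := @cpure k C (contra x) (cov w) z a (comp b f).
Lemma rmul_bilin (x y w : D) (f : hom w y) z : bilin (@rmul_fun x y w f z).
Proof.
have [h1 h2] := @cpure_bilin k C (contra x) (cov w) z.
split=> [a c u v|b c u v]; last exact: h2.
by rewrite /rmul_fun (bilinl (@comp_bilin k D _ _ _)) -h1.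
Qed.
Lemma rmul_balanced (x y w : D) (f : hom w y) u z (a : contra x z) (c : @hom k C u z)
    (b : cov y u) : rmul_fun f (ract a c) b = rmul_fun f a (lact c b).
Proof. by rewrite /rmul_fun cpure_balanced /= compA. Qed.
Definition rmul (x y w : D) (f : hom w y) :
  {linear ctens (contra x) (cov y) -> ctens (contra x) (cov w)} :=
  cl (M := contra x) (N := cov y) (g := @rmul_fun x y w f) (@rmul_bilin x y w f) (@rmul_balanced x y w f).

Lemma gmap_lmul (x y w : D) (f : hom y x) s :
  gmap x w (lmul w f s) = tlift (gmap y w s) (fun a u => comp f a ⊗ u).
Proof.
rewrite -(tlE (comp_tens_bilin w f)); move: s.
apply: (ctens_eq (f := gmap x w \o lmul w f) (g := tl (comp_tens_bilin w f) \o gmap y w)).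
move=> z a b /=; rewrite cl_pure !gmap_pure tlift_map; apply: eq_tlift => g0 g1.
by rewrite tl_pure compA.
Qed.

(** Right multiplication by [f] on D ⊗ H through the coaction; with it the Galois map is right
    D-linear. *)
Definition rtens (x y w : D) (f : hom w y) (a : hom y x) (u : H) : tens (hom w x) H :=
  tlift (coact w y f) (fun f0 f1 => comp a f0 ⊗ (u * f1)).
Lemma rtens_bilin (x y w : D) (f : hom w y) : bilin (@rtens x y w f).
Proof.
have tb := @tpure_bilin k (hom w x) H; have cb := @comp_bilin k D w y x.
split=> [a c u v|u c a b]; rewrite /rtens -tlift_comb; apply: eq_tlift => f0 f1.
  by rewrite mulrDl -scalerAl (bilinr tb).
by rewrite (bilinl cb) (bilinl tb).
Qed.

Lemma gmap_rmul (x y w : D) (f : hom w y) s :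
  gmap x w (rmul x f s) = tlift (gmap x y s) (@rtens x y w f).
Proof.
rewrite -(tlE (@rtens_bilin x y w f)); move: s.
apply: (ctens_eq (f := gmap x w \o rmul x f) (g := tl (@rtens_bilin x y w f) \o gmap x y)).
move=> z a b /=; rewrite cl_pure !gmap_pure coact_comp.
rewrite [in RHS]tlift_map.
rewrite -[LHS](tlE (comp_tens_bilin w a)) tlift_map; apply: eq_tlift => b0 b1.
rewrite tl_pure tlift_map; apply: eq_tlift => f0 f1.
by rewrite tl_pure compA.
Qed.

Hypothesis gal : galois D.

Lemma gmap_bij x y : bijective (gmap x y).
Proof.
have [g gK Kg] := gal x y; exists g => t; first by rewrite gmapE.
by rewrite gmapE Kg.
Qed.

Definition gmap_inv x y := sval (cid (linear_inv (gmap_bij x y))).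
Lemma gmapK x y : cancel (gmap x y) (gmap_inv x y).
Proof. by rewrite /gmap_inv; case: cid => g []. Qed.
Lemma gmap_invK x y : cancel (gmap_inv x y) (gmap x y).
Proof. by rewrite /gmap_inv; case: cid => g []. Qed.

(** The translation map of the Galois extension, that is the sum of the r_i(h) ⊗ l_i(h) which
    defines the action. *)
Definition tau (x : D) (h : H) : ctens (contra x) (cov x) := gmap_inv x x (idm x ⊗ h).
Lemma tau_linear x : linear (tau x).
Proof. by move=> a g h; rewrite /tau (bilinr (@tpure_bilin _ _ _)) linearP. Qed.
Lemma gmap_tau x h : gmap x x (tau x h) = idm x ⊗ h.
Proof. exact: gmap_invK. Qed.

Lemma gmap_inv_pure (x y : D) (f : hom y x) h : gmap_inv x y (f ⊗ h) = lmul y f (tau y h).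
Proof.
apply: (can_inj (@gmapK x y)); rewrite gmap_invK gmap_lmul gmap_tau.
by rewrite tlift_pure ?compm1 //; apply: comp_tens_bilin.
Qed.

Lemma gmap_rmul_tau (x y : D) (f : hom y x) h :
  gmap x y (rmul x f (tau x h)) = tlift (coact y x f) (fun f0 f1 => f0 ⊗ (h * f1)).
Proof.
rewrite gmap_rmul gmap_tau tlift_pure; last exact: rtens_bilin.
by apply: eq_tlift => f0 f1; rewrite comp1m.
Qed.

Lemma tau1 x : tau x 1 = @cpure k C (contra x) (cov x) x (idm x) (idm x).
Proof.
apply: (can_inj (@gmapK x x)); rewrite gmap_tau gmap_pure coact_idm tlift_pure ?compm1 //.
exact: comp_tens_bilin.
Qed.

Section Action.
Variable M : bimod D.
Notation blb := (@bl_bilin k D M _ _ _).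
Notation brb := (@br_bilin k D M _ _ _).

Definition theta_fun (m : central M) (x y : D) z (f : contra x z) (g : cov y z) : M y x :=
  @bl k D M y z x f (br (val m z) (g : hom y z)).
Lemma theta_bilin m x y z : bilin (@theta_fun m x y z).
Proof.
split=> [f a u v|g a u v]; rewrite /theta_fun.
  by rewrite (bilinr brb) (bilinr blb).
by rewrite (bilinl blb).
Qed.
Lemma theta_balanced m (x y : D) w z (f : contra x z) (c : @hom k C w z) (g : cov y w) :
  theta_fun m (ract f c) g = theta_fun m f (lact c g).
Proof. by rewrite /theta_fun /= -blA blr centralP brA. Qed.
(* r (x) l |-> r m l *)
Definition theta (m : central M) (x y : D) : {linear ctens (contra x) (cov y) -> M y x} :=
  cl (M := contra x) (N := cov y) (g := @theta_fun m x y) (@theta_bilin m x y) (@theta_balanced m x y).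
Lemma theta_pure m (x y z : D) (f : hom z x) (g : hom y z) :
  theta m x y (@cpure k C (contra x) (cov y) z f g) = bl f (br (val m z) g).
Proof. exact: cl_pure. Qed.
Lemma thetaE m x y t : theta m x y t = clift t (@theta_fun m x y).
Proof. exact: clE. Qed.

Lemma theta_lmul m (x y w : D) (f : hom y x) s :
  theta m x w (lmul w f s) = bl f (theta m y w s).
Proof.
rewrite -(linrE blb); move: s.
apply: (ctens_eq (f := theta m x w \o lmul w f) (g := linr _ f \o theta m y w)).
by move=> z a b /=; rewrite cl_pure !theta_pure linrE blA.
Qed.
Lemma theta_rmul m (x y w : D) (f : hom w y) s :
  theta m x w (rmul x f s) = br (theta m x y s) f.
Proof.
rewrite -(linlE brb); move: s.
apply: (ctens_eq (f := theta m x w \o rmul x f) (g := linl _ f \o theta m x y)).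
by move=> z a b /=; rewrite cl_pure !theta_pure linlE -blr brA.
Qed.

Definition actfam (m : central M) (h : H) (x : D) : M x x := theta m x x (tau x h).

Lemma actfam_bilin m (x y : D) : bilin (fun (f : hom y x) (h : H) => bl f (actfam m h y)).
Proof.
split=> [f a u v|h a u v]; last by rewrite (bilinl blb).
by rewrite /actfam tau_linear linearP (bilinr blb).
Qed.

(** The preimage of f ⊗ h under the Galois map is f tau(h), and inserting [m] into tau(h) is the
    action of [h]. *)
Lemma theta_gmap m (x y : D) s :
  theta m x y s = tlift (gmap x y s) (fun f h => bl f (actfam m h y)).
Proof.
rewrite -(tlE (@actfam_bilin m x y)) -{1}[s]gmapK; move: (gmap x y s).
apply: (tens_eq (f := theta m x y \o gmap_inv x y)) => f h /=.
by rewrite gmap_inv_pure theta_lmul tl_pure.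
Qed.

(** Right multiplications of m . h are expressed by left ones. For coinvariant [f] the sum reduces
    to a single term, which says that m . h is again central. *)
Lemma actfam_br m (x y : D) (f : hom x y) h :
  br (actfam m h y) f = tlift (coact x y f) (fun f0 f1 => bl f0 (actfam m (h * f1) x)).
Proof.
rewrite -theta_rmul theta_gmap gmap_rmul_tau -(tlE (@actfam_bilin m y x)) tlift_map.
by apply: eq_tlift => f0 f1; rewrite tl_pure.
Qed.

Fact act_subproof m h (x y : D) (f : coinv_hom x y) :
  bl (val f) (actfam m h x) = br (actfam m h y) (val f).
Proof.
have /eqP hf : coact x y (val f) == val f ⊗ 1 by exact: (valP f).
rewrite actfam_br hf tlift_pure ?mulr1 //.
split=> [g a u v|g a u v]; last by rewrite (bilinl blb).
by rewrite mulrDr -scalerAr (bilinr (@actfam_bilin m y x)).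
Qed.
Definition act (m : central M) (h : H) : central M := mkcentral (@act_subproof m h).

Lemma actE m h x : val (act m h) x = actfam m h x. Proof. by []. Qed.

Lemma act_br m (x y : D) (f : hom x y) h :
  br (val (act m h) y) f = tlift (coact x y f) (fun f0 f1 => bl f0 (val (act m (h * f1)) x)).
Proof. exact: actfam_br. Qed.

(** At [s = tau x u] this becomes (m . h) . u = m . (h u). A general [s] is allowed because the
    proof moves the right factor of a pure tensor across m . h by [act_br], whereas tau(u) is only a
    sum of pure tensors. *)
Lemma theta_act m h (x y : D) s :
  theta (act m h) x y s = tlift (gmap x y s) (fun f u => bl f (actfam m (h * u) y)).
Proof.
have gb : bilin (fun (f : hom y x) (u : H) => bl f (actfam m (h * u) y)).
  split=> [f a u v|u a f g]; last by rewrite (bilinl blb).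
  by rewrite mulrDr -scalerAr (bilinr (@actfam_bilin m x y)).
rewrite -(tlE gb); move: s.
apply: (ctens_eq (g := tl gb \o gmap x y)) => z r l /=.
rewrite theta_pure act_br gmap_pure -(linrE blb) !tlift_map; apply: eq_tlift => l0 l1.
by rewrite linrE tl_pure blA.
Qed.

Lemma act_right_action : right_action act.
Proof.
split.
- split=> [m a g h|h a m n]; apply: central_eq => x; rewrite central_lin !actE /actfam.
    by rewrite tau_linear linearP.
  rewrite !thetaE -clift_comb; apply: eq_clift => z f g.
  by rewrite /theta_fun central_lin (bilinl brb) (bilinr blb).
- move=> m g h; apply: central_eq => x; rewrite actE /actfam theta_act gmap_tau.
  rewrite tlift_pure ?bl1 //; split=> [f a u v|u a f f']; last by rewrite (bilinl blb).
  by rewrite mulrDr -scalerAr (bilinr (@actfam_bilin m x x)).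
move=> m; apply: central_eq => x.
by rewrite actE /actfam tau1 theta_pure bl1 br1.
Qed.

(** For invariant [m], [act_br] at h = 1 and the counit axiom move [m] from one side of [f] to the
    other. The converse computes m . h by commuting [m] with the right factor of tau(h). *)
Lemma act_coinv (m : central M) : (forall h, act m h = (eps h : k) *: m) <->
  (forall (x y : D) (f : hom x y), bl f (val m x) = br (val m y) f).
Proof.
split=> [h x y f|hm h].
  have := act_br m f 1; rewrite h eps1 scale1r => ->.
  rewrite -{1}[f]coact_eps -(linlE blb) tlift_map; apply: eq_tlift => f0 f1.
  by rewrite linlE mul1r h (bilinZl blb) -[val (_ *: m) x]/(_ *: val m x) (bilinZr blb).
apply: central_eq => x; rewrite actE /actfam.
have gb : bilin (fun (f : hom x x) (u : H) => bl ((eps u : k) *: f) (val m x)).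
  split=> [f a u v|u a f g].
    by rewrite linearP scalerDl -scalerA (bilinl blb).
  by rewrite scalerDr scalerA mulrC -scalerA (bilinl blb).
(* As [m] commutes with [l], inserting it between [r] and [l] gives (r l) m, and r l is recovered
   from the image of r ⊗ l under the Galois map by applying the counit. *)
have -> s : theta m x x s = tlift (gmap x x s) (fun f u => bl ((eps u : k) *: f) (val m x)).
  rewrite -(tlE gb); move: s; apply: (ctens_eq (g := tl gb \o gmap x x)) => z r l /=.
  rewrite theta_pure gmap_pure -hm blA -{1}[l]coact_eps tlift_map.
  rewrite -(linrE (@comp_bilin k D _ _ _)) -(linlE blb) !tlift_map; apply: eq_tlift => l0 l1.
  by rewrite linlE linrE tl_pure (bilinZr (@comp_bilin k D _ _ _)).
rewrite gmap_tau tlift_pure // (bilinZl blb) bl1.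
by [].
Qed.

End Action.

Section ActionMap.
Variables (M N : bimod D) (phi : bimod_hom M N).
Fact central_map_subproof (m : central M) (x y : D) (f : coinv_hom x y) :
  bl (val f) (phi x x (val m x)) = br (phi y y (val m y)) (val f).
Proof. by rewrite -bhom_bl -bhom_br centralP. Qed.
Definition central_map_fun (m : central M) : central N :=
  mkcentral (@central_map_subproof m).
Lemma central_map_linear : linear central_map_fun.
Proof. by move=> a m n; apply: central_eq => x; rewrite central_lin /= linearP. Qed.
Definition central_map : {linear central M -> central N} := mklin central_map_linear.
Lemma central_mapE m x : val (central_map m) x = phi x x (val m x).
Proof. by rewrite /central_map mklinE. Qed.

Lemma central_map_act m h : central_map (act m h) = act (central_map m) h.
Proof.
apply: central_eq => x; rewrite central_mapE !actE /actfam !thetaE clift_map.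
apply: eq_clift => z f g.
by rewrite /theta_fun bhom_bl bhom_br central_mapE.
Qed.
End ActionMap.
End Galois.

(** * Acyclicity of injective bimodules over the coinvariants and over H *)

Section FlatDual.
Variables (k : fieldType) (H : hopf k) (D : comodcat H).
Notation C := (coinv D).
Variables (a : D) (W : lmodType k).

Section Dual.
Definition dualfam (x : D) : lmodType k := dprod (fun _ : hom a x => W).
Definition dualp x : {pred dualfam x} := fun q => `[< linear (fun f : hom a x => q f) >].
Fact dualp_submod x : GRing.submod_closed (@dualp x).
Proof.
split; first by apply/asboolP => c u v; rewrite scaler0 addr0.
move=> c p q /asboolP hp /asboolP hq; apply/asboolP => d u v.
rewrite -![(c *: p + q) _]/(c *: p _ + q _) hp hq.
by rewrite !scalerDr !scalerA mulrC -!addrA; congr (_ + _); rewrite addrCA.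
Qed.
HB.instance Definition _ x :=
  GRing.isSubmodClosed.Build k (dualfam x) (@dualp x) (@dualp_submod x).
Definition dual x : lmodType k := subm (@dualp x).
Lemma dual_linear x (q : dual x) : linear (fun f : hom a x => val q f).
Proof. by have /asboolP := valP q. Qed.
Lemma dual_eq x (p q : dual x) : (forall f, val p f = val q f) -> p = q.
Proof. by move=> h; apply: val_inj; apply: dprodP. Qed.
Lemma dual_lin x c (p q : dual x) f : val (c *: p + q) f = c *: val p f + val q f.
Proof. by []. Qed.
Fact mkdual_subproof x (p : hom a x -> W) : linear p -> (p : dualfam x) \in @dualp x.
Proof. by move=> h; apply/asboolP. Qed.
Definition mkdual x (p : hom a x -> W) (h : linear p) : dual x :=
  exist _ (p : dualfam x) (mkdual_subproof h).

Fact dual_act_subproof w x (q : dual x) (g : coinv_hom w x) :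
  linear (fun f : hom a w => val q (comp (val g) f)).
Proof. by move=> c u v; rewrite (bilinr (@comp_bilin k D _ _ _)) dual_linear. Qed.
Definition dual_act w x (q : dual x) (g : coinv_hom w x) : dual w :=
  mkdual (dual_act_subproof q g).
Fact dual_act_bilin w x : bilin (@dual_act w x).
Proof.
split=> [q c g h|g c p q]; apply: dual_eq => f; rewrite dual_lin //=.
rewrite -[LHS]/(val q (comp (c *: val g + val h) f)).
by rewrite (bilinl (@comp_bilin k D _ _ _)) dual_linear.
Qed.
Fact dual_actA x y z (q : dual z) (f : coinv_hom y z) (g : coinv_hom x y) :
  dual_act (dual_act q f) g = dual_act q (coinv_cp f g).
Proof. by apply: dual_eq => h /=; rewrite compA. Qed.
Fact dual_act1 x (q : dual x) : dual_act q (coinv_id x) = q.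
Proof. by apply: dual_eq => h /=; rewrite comp1m. Qed.
(* Hom_k(hom a -, W) *)
Definition dualmod : rmodule C :=
  @RModule k C dual (fun w x => @dual_act w x) dual_act_bilin dual_actA dual_act1.
End Dual.

Definition cdfam (x : D) : lmodType k := dprod (fun w : D =>
  dprod (fun _ : coinv_hom w x => dprod (fun _ : hom a w => W) : lmodType k) : lmodType k).
Definition cdp x : {pred cdfam x} :=
  fun q => `[< forall w, bilin (fun (g : coinv_hom w x) (f : hom a w) => q w g f) >].
Fact cdp_submod x : GRing.submod_closed (@cdp x).
Proof.
split.
  by apply/asboolP => w; split=> [u c v t|u c v t]; rewrite scaler0 addr0.
move=> c p q /asboolP hp /asboolP hq; apply/asboolP => w.
split=> [u d v t|u d v t]; rewrite -![(c *: p + q) w _ _]/(c *: p w _ _ + q w _ _).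
  rewrite (bilinr (hp w)) (bilinr (hq w)).
  by rewrite !scalerDr !scalerA mulrC -!addrA; congr (_ + _); rewrite addrCA.
rewrite (bilinl (hp w)) (bilinl (hq w)).
by rewrite !scalerDr !scalerA mulrC -!addrA; congr (_ + _); rewrite addrCA.
Qed.
HB.instance Definition _ x :=
  GRing.isSubmodClosed.Build k (cdfam x) (@cdp x) (@cdp_submod x).
Definition cd x : lmodType k := subm (@cdp x).
Lemma cd_bilin x (q : cd x) w : bilin (fun (g : coinv_hom w x) (f : hom a w) => val q w g f).
Proof. by have /asboolP := valP q; apply. Qed.
Lemma cd_eq x (p q : cd x) : (forall w g f, val p w g f = val q w g f) -> p = q.
Proof.
move=> h; apply: val_inj; apply: dprodP => w; apply: dprodP => g; apply: dprodP => f.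
exact: h.
Qed.
Lemma cd_lin x c (p q : cd x) w g f : val (c *: p + q) w g f = c *: val p w g f + val q w g f.
Proof. by []. Qed.
Fact mkcd_subproof x (p : forall w, coinv_hom w x -> hom a w -> W) :
  (forall w, bilin (p w)) -> (p : cdfam x) \in @cdp x.
Proof. by move=> h; apply/asboolP. Qed.
Definition mkcd x (p : forall w, coinv_hom w x -> hom a w -> W)
  (h : forall w, bilin (p w)) : cd x := exist _ (p : cdfam x) (mkcd_subproof h).

Fact cd_act_subproof v x (q : cd x) (g : coinv_hom v x) w :
  bilin (fun (h : coinv_hom w v) (f : hom a w) => val q w (coinv_cp g h) f).
Proof.
split=> [h c f f'|f c h h']; first exact: (bilinr (cd_bilin q w)).
by rewrite (bilinr (@coinv_cp_bilin _ _ _ _ _ _)) (bilinl (cd_bilin q w)).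
Qed.
Definition cd_act v x (q : cd x) (g : coinv_hom v x) : cd v := mkcd (cd_act_subproof q g).
Lemma cd_actE v x (q : cd x) (g : coinv_hom v x) w (h : coinv_hom w v) f :
  val (cd_act q g) w h f = val q w (coinv_cp g h) f.
Proof. by []. Qed.
Fact cd_act_bilin w x : bilin (@cd_act w x).
Proof.
split=> [q c g h|g c p q]; apply: cd_eq => v f u; rewrite cd_actE [RHS]cd_lin !cd_actE;
  last by rewrite cd_lin.
by rewrite (bilinl (@coinv_cp_bilin _ _ _ _ _ _)) (bilinl (cd_bilin q v)).
Qed.
Fact cd_actA x y z (q : cd z) (f : coinv_hom y z) (g : coinv_hom x y) :
  cd_act (cd_act q f) g = cd_act q (coinv_cp f g).
Proof. by apply: cd_eq => w h u /=; rewrite coinv_cpA. Qed.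
Fact cd_act1 x (q : cd x) : cd_act q (coinv_id x) = q.
Proof. by apply: cd_eq => w h u /=; rewrite coinv_cp1m. Qed.
(* Hom_k(C(-, x), Hom_k(hom a -, W)) *)
Definition cdmod : rmodule C :=
  @RModule k C cd (fun w x => @cd_act w x) cd_act_bilin cd_actA cd_act1.

Fact dual_cd_subproof x (q : dual x) w :
  bilin (fun (g : coinv_hom w x) (f : hom a w) => val q (comp (val g) f)).
Proof.
split=> [g c f f'|f c g g'].
  by rewrite (bilinr (@comp_bilin k D _ _ _)) dual_linear.
rewrite -[LHS]/(val q (comp (c *: val g + val g') f)).
by rewrite (bilinl (@comp_bilin k D _ _ _)) dual_linear.
Qed.
Definition dual_cd_fun x (q : dual x) : cd x := mkcd (dual_cd_subproof q).
Fact dual_cd_linear x : linear (@dual_cd_fun x).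
Proof. by move=> c p q; apply: cd_eq. Qed.
Fact dual_cd_ract (y z : C) (m : dualmod z) (f : hom y z) :
  mklin (@dual_cd_linear y) (ract m f) = @ract k C cdmod y z (mklin (@dual_cd_linear z) m) f.
Proof. by rewrite !mklinE; apply: cd_eq => w g h /=; rewrite compA. Qed.
Definition dual_cd : rmodule_hom dualmod cdmod :=
  @RModuleHom k C dualmod cdmod (fun x => mklin (@dual_cd_linear x)) dual_cd_ract.
Lemma dual_cdE x q : dual_cd x q = dual_cd_fun q.
Proof. exact: mklinE. Qed.

Fact zero_ract (y z : C) (m : dualmod z) (f : hom y z) :
  (\0 : {linear dualmod y -> dualmod y}) (ract m f) =
  @ract k C dualmod y z ((\0 : {linear dualmod z -> dualmod z}) m) f.
Proof. exact: (esym (bilin0l (@ract_bilin k C dualmod y z) f)). Qed.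
(** [lflat] speaks of exactness in the middle of two maps; injectivity of [dual_cd] is such an
    exactness once it is preceded by a zero map. *)
Definition dual_zero : rmodule_hom dualmod dualmod :=
  @RModuleHom k C dualmod dualmod (fun x => \0) zero_ract.

Lemma dual_cd_inj x : injective (dual_cd x).
Proof.
move=> p q; rewrite !dual_cdE => e; apply: dual_eq => f.
by have := congr1 (fun r => val r x (coinv_id x) f) e; rewrite /= comp1m.
Qed.

Definition mapl_fun z (m : dualmod z) (n : cov a z) : ctens cdmod (cov a) :=
  @cpure k C cdmod (cov a) z (dual_cd z m) n.
Lemma mapl_bilin z : bilin (@mapl_fun z).
Proof.
have [h1 h2] := @cpure_bilin k C cdmod (cov a) z.
by split=> [m|n c p q]; [exact: h1 | rewrite /mapl_fun linearP; exact: h2].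
Qed.
Lemma mapl_balanced y z (m : dualmod z) (f : @hom k C y z) (n : cov a y) :
  mapl_fun (ract m f) n = mapl_fun m (lact f n).
Proof. by rewrite /mapl_fun rhom_ract cpure_balanced. Qed.
Definition mapl : {linear ctens dualmod (cov a) -> ctens cdmod (cov a)} :=
  cl (M := dualmod) (N := cov a) (g := mapl_fun) mapl_bilin mapl_balanced.

Lemma mapl_inj : lflat (cov a) -> injective mapl.
Proof.
move=> fl.
have ex z : exact_at 0 (dual_zero z) (dual_cd z).
  move=> q; split=> [h|[p ->]]; last exact: linear0.
  by exists 0; rewrite linear0; apply: dual_cd_inj; rewrite h linear0.
move=> s t e; apply/eqP; rewrite -subr_eq0; apply/eqP.
have := (fl _ _ _ _ _ ex (s - t)).1; case.
  have -> : ctens_mapl dual_cd (s - t) = mapl (s - t) by rewrite /mapl clE.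
  by rewrite linearB e subrr.
move=> u ->; rewrite /ctens_mapl /clift /dlift /flift big1 // => x _.
by rewrite /= (bilin0l (@cpure_bilin _ _ _ _ _)) scaler0.
Qed.

Definition ev_fun z (q : dualmod z) (f : cov a z) : W := val (q : dual z) f.
Lemma ev_bilin z : bilin (@ev_fun z).
Proof. by split=> [q|f c p q //]; exact: dual_linear. Qed.
Lemma ev_balanced y z (m : dualmod z) (f : @hom k C y z) (n : cov a y) :
  ev_fun (ract m f) n = ev_fun m (lact f n).
Proof. by []. Qed.

(* Flatness of cov a says that its dual is an injective right C-module; this is
   the retraction of dual_cd, uncurried. *)
Lemma flat_extension : lflat (cov a) -> exists L : {linear ctens cdmod (cov a) -> W},
  forall x (q : dual x) (f : hom a x),
    L (@cpure k C cdmod (cov a) x (dual_cd_fun q) f) = val q f.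
Proof.
move=> /mapl_inj /gen_inverse_inj[g gK].
exists (cl (M := dualmod) (N := cov a) (g := ev_fun) ev_bilin ev_balanced \o g) => x q f /=.
have := gK (@cpure k C dualmod (cov a) x q f); rewrite /mapl cl_pure /mapl_fun dual_cdE => ->.
by rewrite cl_pure.
Qed.
End FlatDual.

(** * Restrictions of injective bimodules to the coinvariants *)

Section RestrictionAcyclic.
Variables (k : fieldType) (H : hopf k) (D : comodcat H).
Notation C := (coinv D).
Hypothesis fl : left_flat D.

Section Cofree.
Variable V : D -> D -> lmodType k.
Let L a b := sval (cid (flat_extension (V a b) (@fl a))).
Let LE a b x (q : dual a (V a b) x) (f : hom a x) :
  L a b (@cpure k C (cdmod a (V a b)) (cov a) x (dual_cd_fun q) f) = val q f.
Proof. by rewrite /L; case: cid. Qed.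

Notation E := (restr (cofree V)).

Fact inner_subproof (x z : D) (p : coindr E x z) (a b : D) (g : hom z b) (w : D) :
  bilin (fun (c : coinv_hom w x) (f : hom a w) => val (val p w c : cof V w z) a b g f).
Proof.
split=> [c e f f'|f e c c']; first exact: (bilinr (cof_bilin _ a b)).
have := congr1 (fun r : cof V w z => val r a b g f) (@coind_linear k C E x z p w e c c').
by rewrite [X in _ = X -> _]cof_lin.
Qed.
(** For a fixed left argument [g], an element of [coindr E] is a function of a morphism of C and of
    a right argument in [hom a -], that is an element of [cdmod]. The retraction for [E] thus
    reduces to the one for the dual of [hom a -]. *)
Definition inner (x z : D) (p : coindr E x z) (a b : D) (g : hom z b) : cd a (V a b) x :=
  mkcd (@inner_subproof x z p a b g).

Lemma innerE (x z : D) (p : coindr E x z) (a b : D) (g : hom z b) w c f :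
  val (inner p a g) w c f = val (val p w c : cof V w z) a b g f.
Proof. by []. Qed.

Lemma inner_linear (x z : D) (p : coindr E x z) (a b : D) : linear (@inner x z p a b).
Proof.
move=> c g h; apply: cd_eq => w e f /=.
exact: (bilinl (cof_bilin _ a b)).
Qed.

Fact rho_subproof (x z : D) (p : coindr E x z) (a b : D) :
  bilin (fun (g : hom z b) (f : hom a x) =>
    L a b (@cpure k C (cdmod a (V a b)) (cov a) x (inner p a g) f)).
Proof.
have [h1 h2] := @cpure_bilin k C (cdmod a (V a b)) (cov a) x.
split=> [g c f f'|f c g g'] /=.
  by rewrite (h1 _ c f f') linearP.
by rewrite inner_linear (h2 f c _ _) linearP.
Qed.
Definition rho_fun (x z : D) (p : coindr E x z) : cof V x z := mkcof (rho_subproof p).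
Lemma rho_linear (x z : D) : linear (@rho_fun x z).
Proof.
move=> c p q; apply: cofP => a b g f; rewrite cof_lin /=.
have -> : inner (c *: p + q) a g = c *: inner p a g + inner q a g.
  apply: cd_eq => w e h; rewrite [RHS]cd_lin.
  rewrite !innerE; exact: (eq_trans (congr1 (fun r : cof V w z => val r a b g h)
    (@coind_lin k C E x z c p q w e)) (@cof_lin k D V w z c _ _ a b g h)).
have [h1 h2] := @cpure_bilin k C (cdmod a (V a b)) (cov a) x.
by rewrite (h2 f c _ _) linearP.
Qed.
Fact rho_bl (x y z : C) (f : hom y z) (p : coindr E x y) :
  mklin (@rho_linear x z) (bl f p) = @bl k C E x y z f (mklin (@rho_linear x y) p).
Proof. by rewrite !mklinE; apply: cofP => a b g h /=; congr (L _ _ (cpure _ _)); apply: cd_eq. Qed.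
Fact rho_br (w x y : C) (p : coindr E x y) (f : hom w x) :
  mklin (@rho_linear w y) (br p f) = @br k C E w x y (mklin (@rho_linear x y) p) f.
Proof.
rewrite !mklinE; apply: cofP => a b g h.
(* Right C-linearity of the retraction is the balancing of the tensor product on which [L] is
   defined. *)
have := @cpure_balanced k C (cdmod a (V a b)) (cov a) w x (inner p a g) f h.
move=> /(congr1 (L a b)) /= <-; congr (L _ _ (cpure _ _)).
exact: cd_eq.
Qed.
Definition rho : bimod_hom (coindr E) E :=
  @BimodHom k C (coindr E) E (fun x z => mklin (@rho_linear x z)) rho_bl rho_br.

Lemma restr_cofree_acyclic : acyclic E.
Proof.
apply: (acyclic_coindr (r := rho)) => x z p.
rewrite /= mklinE; apply: cofP => a b g f /=.
have ql : linear (fun f : hom a x => val (p : cof V x z) a b g f).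
  exact: (cof_bilin _ a b).1.
rewrite -[RHS](LE (mkdual ql)); congr (L _ _ (cpure _ _)).
apply: cd_eq => w c h.
exact: (congr1 (fun r : cof V w z => val r a b g h) (@to_coindrE k C E x z p w c)).
Qed.
End Cofree.

Lemma restr_acyclic (J : bimod D) : injective_bimod J -> acyclic (restr J).
Proof.
move=> Ji; have [r rE] := Ji _ _ (emb J) (bhid J) (@emb_inj _ _ J).
apply: (@acyclic_retract _ _ _ (restr (cofree J)) (restr_hom (emb J)) (restr_hom r)).
  by move=> x y m; exact: rE.
exact: restr_cofree_acyclic.
Qed.
End RestrictionAcyclic.

(** * Central families of injective bimodules as H-modules *)

Section HopfAcyclic.
Variables (k : fieldType) (H : hopf k) (D : comodcat H).
Hypothesis gal : galois D.

Definition hb (M : bimod D) : bimod (algcat H) := Hbimod (act_right_action gal M).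
Lemma hb_blE (M : bimod D) (x y z : algcat H) (h : hom y z) (m : central M) :
  @bl k (algcat H) (hb M) x y z h m = (eps (h : H) : k) *: m.
Proof. by []. Qed.
Definition hb_hom (M N : bimod D) (phi : bimod_hom M N) : bimod_hom (hb M) (hb N) :=
  Hbimod_hom (act_right_action gal M) (act_right_action gal N) (central_map_act gal phi).

Section Cofree.
Variable V : D -> D -> lmodType k.
Notation N := (hb (cofree V)).
Notation cN := (central (cofree V)).

Section Sigma.
Variable F : H -> cN.
Hypothesis Fl : linear F.

(** For [m] central, m(g, f) = (m f)(g, 1) = sum (m . f_(1))(g f_(0), 1), by [act_br] at h = 1.
    Replacing u |-> m . u by an arbitrary linear [F] in the last expression defines [sigma], which
    therefore retracts the embedding into the coinduced bimodule. *)
Definition sig_fun a b (d : hom a b) (u : H) : V a b :=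
  val (val (F u) a : cof V a a) a b d (idm a).
Lemma sig_bilin a b : bilin (@sig_fun a b).
Proof.
split=> [d c u v|u c d e]; rewrite /sig_fun.
  by rewrite Fl central_lin; exact: cof_lin.
exact: (bilinl (cof_bilin _ a b)).
Qed.
Lemma sig_comp_bilin x a b (g : hom x b) :
  bilin (fun (d : hom a x) (u : H) => sig_fun (comp g d) u).
Proof.
split=> [d c u v|u c d e]; first exact: (bilinr (@sig_bilin a b)).
by rewrite (bilinr (@comp_bilin k D _ _ _)) (bilinl (@sig_bilin a b)).
Qed.

Fact sigma_bilin x a b : bilin (fun (g : hom x b) (f : hom a x) =>
  tlift (coact a x f) (fun f0 f1 => sig_fun (comp g f0) f1)).
Proof.
split=> [g c f f'|f c g g'].
  by rewrite -!(tlE (sig_comp_bilin a g)) !linearP.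
rewrite -tlift_comb; apply: eq_tlift => f0 f1.
by rewrite (bilinl (@comp_bilin k D _ _ _)) (bilinl (@sig_bilin a b)).
Qed.
Definition sigma_fam (x : D) : cofree V x x := mkcof (sigma_bilin x).
Fact sigma_central (x y : D) (c : coinv_hom x y) :
  bl (val c) (sigma_fam x) = br (sigma_fam y) (val c).
Proof.
apply: cofP => a b g f /=.
have /eqP hc : coact x y (val c) == val c ⊗ 1 by exact: (valP c).
rewrite coact_comp hc tlift_pure; last first.
  have tb := @tpure_bilin k (hom a y) H; have cb := @comp_bilin k D a x y.
  split=> [g0 e u v|g1 e u v]; rewrite -tlift_comb; apply: eq_tlift => a0 a1.
    by rewrite mulrDl -scalerAl (bilinr tb).
  by rewrite (bilinl cb) (bilinl tb).
rewrite -[RHS](tlE (sig_comp_bilin a g)) tlift_map; apply: eq_tlift => f0 f1.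
by rewrite tl_pure mul1r compA.
Qed.
Definition sigma : cN := mkcentral sigma_central.

Lemma sigmaE x a b (g : hom x b) (f : hom a x) :
  val (val sigma x : cof V x x) a b g f =
  tlift (coact a x f) (fun f0 f1 => sig_fun (comp g f0) f1).
Proof. by []. Qed.

Lemma sigma_theta x a b (g : hom x b) s :
  val (theta sigma x a s : cof V a x) a b g (idm a) =
  tlift (gmap x a s) (fun d u => sig_fun (comp g d) u).
Proof.
have evl : linear (fun p : cof V a x => val p a b g (idm a)).
  by move=> c p q; exact: cof_lin.
rewrite -(mklinE evl) -(tlE (sig_comp_bilin a g)); move: s.
apply: (ctens_eq (f := mklin evl \o theta sigma x a)
  (g := tl (sig_comp_bilin a g) \o gmap x a)) => z r l /=.
rewrite theta_pure mklinE gmap_pure tlift_map /= compm1.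
by apply: eq_tlift => l0 l1; rewrite tl_pure compA.
Qed.

(** The argument [f] is turned into right multiplication by [f], which tau(h) absorbs by
    [gmap_rmul_tau]. Hence (sigma F) . h is sigma of u |-> F(h u), which gives the right H-linearity
    of [hrho]. *)
Lemma sigma_act h x a b (g : hom x b) (f : hom a x) :
  val (val (act gal sigma h) x : cof V x x) a b g f =
  tlift (coact a x f) (fun f0 f1 => sig_fun (comp g f0) (h * f1)).
Proof.
have -> : val (val (act gal sigma h) x : cof V x x) a b g f =
    val (br (val (act gal sigma h) x) f : cof V a x) a b g (idm a).
  by rewrite /= compm1.
rewrite actE /actfam -theta_rmul sigma_theta gmap_rmul_tau.
rewrite -(tlE (sig_comp_bilin a g)) tlift_map; apply: eq_tlift => f0 f1.
by rewrite tl_pure.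
Qed.
End Sigma.

Definition hrho_fun (x z : unit) (p : coindr N x z) : cN := sigma (@coind_linear k (algcat H) N x z p tt).
Lemma hrho_linear x z : linear (@hrho_fun x z).
Proof.
move=> c p q; apply: central_eq => y; rewrite central_lin; apply: cofP => a b g f.
rewrite cof_lin /= -tlift_comb; apply: eq_tlift => f0 f1.
by [].
Qed.
Fact hrho_bl (x y z : algcat H) (h : hom y z) (p : coindr N x y) :
  mklin (@hrho_linear x z) (bl h p) = @bl k (algcat H) N x y z h (mklin (@hrho_linear x y) p).
Proof.
rewrite !mklinE; apply: central_eq => w; apply: cofP => a b g f.
rewrite hb_blE centralZ [RHS]cofZ.
rewrite !sigmaE -tlift_scale; apply: eq_tlift => f0 f1.
by rewrite /sig_fun coindr_blE hb_blE centralZ; exact: cofZ.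
Qed.
Fact hrho_br (w x y : algcat H) (p : coindr N x y) (h : hom w x) :
  mklin (@hrho_linear w y) (br p h) = @br k (algcat H) N w x y (mklin (@hrho_linear x y) p) h.
Proof.
rewrite !mklinE; apply: central_eq => v; apply: cofP => a b g f.
by rewrite [RHS]sigma_act.
Qed.
Definition hrho : bimod_hom (coindr N) N :=
  @BimodHom k (algcat H) (coindr N) N (fun x z => mklin (@hrho_linear x z)) hrho_bl hrho_br.

Lemma hb_cofree_acyclic : acyclic N.
Proof.
apply: (acyclic_coindr (r := hrho)) => x z m.
rewrite -[LHS]/(mklin (@hrho_linear x z) (to_coindr N x z m)) mklinE; apply: central_eq => y; apply: cofP => a b g f.
rewrite sigmaE.
have := act_br gal m f 1; rewrite (ract_one (act_right_action gal _)).
move=> /(congr1 (fun p : cof V a y => val p a b g (idm a))).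
rewrite -[X in X = _ -> _]/(val (val m y : cof V y y) a b g (comp f (idm a))) compm1 => ->.
have evl : linear (fun p : cof V a y => val p a b g (idm a)).
  by move=> c p q; exact: cof_lin.
rewrite -(mklinE evl) tlift_map; apply: eq_tlift => f0 f1.
by rewrite mklinE /sig_fun to_coindrE /= mul1r.
Qed.
End Cofree.

Lemma hb_acyclic (J : bimod D) : injective_bimod J -> acyclic (hb J).
Proof.
move=> Ji; have [r rE] := Ji _ _ (emb J) (bhid J) (@emb_inj _ _ J).
apply: (@acyclic_retract _ _ _ (hb (cofree J)) (hb_hom (emb J)) (hb_hom r)).
  move=> x y m /=; apply: central_eq => z; rewrite !central_mapE.
  exact: rE.
exact: hb_cofree_acyclic.
Qed.
End HopfAcyclic.

(** * Acyclic resolutions *)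

Section Cochains.
Variables (k : fieldType) (C : klcat k).

Lemma slot_comb_deg a n (x z : C) (c c' c'' : chain n x z) : slot_comb a c c' c'' -> n <> 0%N.
Proof. by case. Qed.

Section DegreeZero.
Variable M : bimod C.

Definition fam_fun (m : forall x, M x x) n (x z : C) (c : chain n x z) : M x z :=
  match c in chain n x z return M x z with
  | cnil x => m x
  | ccons _ _ _ _ _ _ => 0
  end.
Fact fam_multilinear (m : forall x, M x x) :
  multilinear (fun x z (c : chain 0 x z) => fam_fun m c).
Proof. by move=> a x z c c' c'' /slot_comb_deg. Qed.
Definition fam_coch (m : forall x, M x x) : coch 0 M := Coch (fam_multilinear m).

Lemma coch0P (F G : coch 0 M) : (forall x, F x x (cnil x) = G x x (cnil x)) -> F = G.
Proof. by move=> h; apply: cochP; apply: chain0_case. Qed.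

Lemma diff0P (F : coch 0 M) : diff F = 0 <->
  forall (x y : C) (f : hom x y), bl f (F x x (cnil x)) = br (F y y (cnil y)) f.
Proof.
split=> [h x y f|h].
  by apply/eqP; rewrite -subr_eq0 -diff0E h.
apply: cochP; apply: chainS_case => x y z f c; move: x y c f.
by apply: chain0_case => x f; rewrite diff0E h subrr.
Qed.
End DegreeZero.

(** Preimages are chosen by a linear generalized inverse in each component, which preserves
    multilinearity. Hence cochains depend exactly on their coefficients. *)
Lemma coch_lift (A B : bimod C) (f : bimod_hom A B) n (F : coch n B) :
  (forall x z c, exists a, F x z c = f x z a) -> exists G, F = coch_map f G.
Proof.
move=> h.
pose r x y := sval (cid (gen_inverse (f x y))).
have rP x y v : f x y (r x y (f x y v)) = f x y v by rewrite /r; case: cid.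
have Gm : multilinear (fun x z (c : chain n x z) => r x z (F x z c)).
  by move=> a x z c c' c'' hc; rewrite (cofunP F hc) linearP.
exists (Coch Gm); apply: cochP => x z c /=.
by have [a ->] := h x z c; rewrite rP.
Qed.

Lemma coch_exact (A B E : bimod C) (f : bimod_hom A B) (g : bimod_hom B E) n (F : coch n B) :
  (forall x y b, g x y b = 0 -> exists a, b = f x y a) ->
  coch_map g F = 0 -> exists G, F = coch_map f G.
Proof.
move=> ex h; apply: coch_lift => x z c; apply: ex.
exact: (congr1 (fun G : coch n E => G x z c) h).
Qed.

Lemma coch_map_inj (A B : bimod C) (f : bimod_hom A B) n :
  (forall x y, injective (f x y)) -> injective (@coch_map _ _ _ _ f n).
Proof.
move=> fi F G h; apply: cochP => x z c; apply: (fi x z).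
by have := congr1 (fun G : coch n B => G x z c) h.
Qed.

(** Kept transparent, since its entries and differentials must compute to cochain spaces and their
    maps. *)
Definition cdcplx (J : nat -> bimod C) (dJ : forall j, bimod_hom (J j) (J j.+1))
  (ddJ : forall j x y m, dJ j.+1 x y (dJ j x y m) = 0) : dcplx k.
Proof.
refine (@DCplx k (fun i j => coch i (J j)) (fun i j => @diff k C i (J j))
  (fun i j => @coch_map k C _ _ (dJ j) i) _ _ _).
- by move=> i j F; exact: diff_diff.
- by move=> i j F; apply: cochP => x z c; exact: ddJ.
- by move=> i j F; exact: diff_coch_map.
Defined.

Lemma boundP0 (M : bimod C) (F : coch 0 M) : F \in bound 0 M <-> F = 0.
Proof. by split=> [/eqP|h]; last exact/eqP. Qed.
Lemma boundPS n (M : bimod C) (F : coch n.+1 M) :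
  F \in bound n.+1 M <-> exists G, F = diff G.
Proof. by split=> [/asboolP|h]; last exact/asboolP. Qed.

End Cochains.

Section ResolutionComplex.
Variables (k : fieldType) (D : klcat k) (M : bimod D) (I : injres M).

Lemma ir_dd j x y m : ir_diff I j.+1 x y (ir_diff I j x y m) = 0.
Proof. by apply/ir_exactS; exists m. Qed.
End ResolutionComplex.

(** * Cohomology by an acyclic resolution, used over the coinvariants and over D *)

Section AcyclicResolution.
Variables (k : fieldType) (C : klcat k) (M : bimod C).
Variables (J : nat -> bimod C) (dJ : forall j, bimod_hom (J j) (J j.+1)).
Variable aug : bimod_hom M (J 0%N).
Hypothesis ddJ : forall j x y m, dJ j.+1 x y (dJ j x y m) = 0.
Hypothesis aug_inj : forall x y, injective (aug x y).
Hypothesis ex0 : forall x y b, dJ 0%N x y b = 0 <-> exists a, b = aug x y a.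
Hypothesis exS : forall j x y b, dJ j.+1 x y b = 0 <-> exists a, b = dJ j x y a.
Hypothesis ac : forall j, acyclic (J j).

Notation K := (cdcplx ddJ).
Notation augc n := (@coch_map k C M (J 0%N) aug n).

Lemma ar_rows : rows_exact K.
Proof. by move=> p j x; exact: ac. Qed.
Lemma ar_cols : cols_exact K.
Proof. by move=> p j x; apply: coch_exact => x' y' b /exS. Qed.

Let B p : lmodType k := coch p M.
Let dB p : {linear B p -> B p.+1} := @diff k C p M.
Let e p : {linear B p -> K p 0%N} := augc p.

Let edB p (F : coch p M) : augc p.+1 (diff F) = @dh k K p 0 (augc p F).
Proof. by rewrite /= diff_coch_map. Qed.
Let eker p (X : K p 0%N) : dv X = 0 <-> exists F, X = augc p F.
Proof.
split=> [|[F ->]]; first by apply: coch_exact => x y b /ex0.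
by apply: cochP => x z c; apply/ex0; exists (F x z c).
Qed.
Let einj p : injective (augc p). Proof. exact: coch_map_inj. Qed.

(* The class of F in H^n(C, M) corresponds to that of u in the n-th cohomology of
   H^0(C, J). *)
Definition ar_rel n (F : coch n M) (u : coch 0 (J n)) : Prop :=
  diff F = 0 /\ @stair k K n 0 (augc n F) n u.

Lemma ar_rel_linear n a F F' u u' : @ar_rel n F u -> ar_rel F' u' ->
  ar_rel (a *: F + F') (a *: u + u').
Proof.
move=> [h h'] [h1 h1']; split; first by rewrite diff_linear h h1 scaler0 addr0.
by rewrite coch_map_linear; apply: (@stair_linear k K).
Qed.

Lemma ar_rel_total n F : diff F = 0 -> exists u, @ar_rel n F u.
Proof.
move=> h; have [u [hu _ _]] := @stair_aug_exists k K B dB e edB eker n F ar_rows h.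
by exists u.
Qed.

Lemma ar_rel_cocycle n F u : @ar_rel n F u -> diff u = 0 /\ coch_map (dJ n) u = 0.
Proof.
move=> [h hs]; apply: (stair_cocycle hs).
  by rewrite -edB h linear0.
by apply/eker; exists F.
Qed.

Lemma ar_rel_surj n (u : coch 0 (J n)) : diff u = 0 -> coch_map (dJ n) u = 0 ->
  exists F, @ar_rel n F u.
Proof.
move=> h h'.
have [F hF hs] := @stair_surj k K B dB e edB eker einj _ _ _ _ _ ar_cols (@stair0 k K n u) h h'.
by exists F.
Qed.

Lemma ar_rel_bound n F u : @ar_rel n F u -> (F \in bound n M <-> @negligible k K 0 n u).
Proof.
move=> [h hs]; apply: iff_trans (stair_negligible ar_rows ar_cols hs).
case: n F u h hs => [|n] F u h hs.
  exact: iff_trans (boundP0 F) (iff_sym (@negligible_aug0 k K B e einj F)).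
exact: iff_trans (boundPS F) (iff_sym (@negligible_augS k K B dB e edB eker einj n F)).
Qed.
End AcyclicResolution.

Section AcyclicResolutionMap.
Variables (k : fieldType) (C : klcat k) (M M' : bimod C).
Variables (J J' : nat -> bimod C) (dJ : forall j, bimod_hom (J j) (J j.+1))
  (dJ' : forall j, bimod_hom (J' j) (J' j.+1)).
Variables (aug : bimod_hom M (J 0%N)) (aug' : bimod_hom M' (J' 0%N)).
Hypothesis ddJ : forall j x y m, dJ j.+1 x y (dJ j x y m) = 0.
Hypothesis ddJ' : forall j x y m, dJ' j.+1 x y (dJ' j x y m) = 0.
Variables (phi : bimod_hom M M') (Phi : forall j, bimod_hom (J j) (J' j)).
Hypothesis Phi0 : forall x y m, Phi 0%N x y (aug x y m) = aug' x y (phi x y m).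
Hypothesis PhiS : forall j x y m, Phi j.+1 x y (dJ j x y m) = dJ' j x y (Phi j x y m).

Lemma ar_rel_map n (F : coch n M) (u : coch 0 (J n)) : ar_rel aug ddJ F u ->
  ar_rel aug' ddJ' (coch_map phi F) (coch_map (Phi n) u).
Proof.
move=> [h hs]; split; first by rewrite diff_coch_map h linear0.
have -> : coch_map aug' (coch_map phi F) = coch_map (Phi 0%N) (coch_map aug F).
  by apply: cochP => x z c /=; rewrite Phi0.
apply: (@stair_map k (cdcplx ddJ) (cdcplx ddJ')
   (fun i j => @coch_map k C _ _ (Phi j) i) _ _ n 0%N _ n u hs).
- by move=> p j x; rewrite /= diff_coch_map.
- by move=> p j x; apply: cochP => x' z' c /=; rewrite PhiS.
Qed.
End AcyclicResolutionMap.

(** * The derived action *)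

Section Derived.
Variables (k : fieldType) (H : hopf k) (D : comodcat H).
Notation C := (coinv D).
Hypotheses (gal : galois D) (fl : left_flat D).

Definition fcoch (M : bimod D) (m : central M) : coch 0 (restr M) :=
  @fam_coch k C (restr M) (val m).
Lemma fcochE (M : bimod D) (m : central M) x : fcoch m x x (@cnil k C x) = val m x.
Proof. by []. Qed.
Lemma fcoch_linear M : linear (@fcoch M).
Proof. by move=> a m n; apply: coch0P. Qed.
Lemma fcoch_diff (M : bimod D) (m : central M) : diff (fcoch m) = 0.
Proof. by apply/diff0P => x y f; exact: centralP. Qed.
Lemma fcoch_surj (M : bimod D) (u : coch 0 (restr M)) : diff u = 0 -> exists m, u = fcoch m.
Proof.
move=> /diff0P h; exists (mkcentral (M := M) h).
exact: coch0P.
Qed.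
Lemma fcoch_map (M N : bimod D) (phi : bimod_hom M N) m :
  coch_map (restr_hom phi) (fcoch m) = fcoch (central_map phi m).
Proof. by apply: coch0P => x; rewrite fcochE central_mapE. Qed.
Lemma fcoch_inj M : injective (@fcoch M).
Proof.
move=> m n e; apply: central_eq => x.
exact: (congr1 (fun u : coch 0 (restr M) => u x x (@cnil k C x)) e).
Qed.

Section Resolution.
Variables (M : bimod D) (I : injres M).

Definition cdiff q : {linear central (I q) -> central (I q.+1)} :=
  central_map (ir_diff I q).
Lemma cdiff_act q z h : cdiff q (act gal z h) = act gal (cdiff q z) h.
Proof. exact: central_map_act. Qed.

Lemma restr_dd j x y m :
  restr_hom (ir_diff I j.+1) x y (restr_hom (ir_diff I j) x y m) = 0.
Proof. exact: (@ir_dd k D M I j x y m). Qed.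

Definition hmcls_rel q (z : central (I q)) (F : coch q (restr M)) : Prop :=
  ar_rel (restr_hom (ir_aug I)) restr_dd F (fcoch z).

Definition cbound q : central (I q) -> Prop :=
  match q return central (I q) -> Prop with
  | 0%N => fun z => z = 0
  | q'.+1 => fun z => exists z', z = cdiff q' z'
  end.

Lemma cbound0 q : cbound (0 : central (I q)).
Proof. by case: q => [|q] //=; exists 0; rewrite linear0. Qed.

Let aug_inj : forall x y, injective (restr_hom (ir_aug I) x y).
Proof. by move=> x y; exact: ir_aug_inj. Qed.
Let ex0 x y b : restr_hom (ir_diff I 0) x y b = 0 <->
  exists a, b = restr_hom (ir_aug I) x y a.
Proof. exact: (@ir_exact0 k D M I x y b). Qed.
Let exS j x y b : restr_hom (ir_diff I j.+1) x y b = 0 <->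
  exists a, b = restr_hom (ir_diff I j) x y a.
Proof. exact: (@ir_exactS k D M I j x y b). Qed.
Let ac j : acyclic (restr (I j)).
Proof. by apply: restr_acyclic => //; exact: ir_injective. Qed.

Lemma fcoch_negligible q (z : central (I q)) :
  @negligible k (cdcplx restr_dd) 0 q (fcoch z) <-> cbound z.
Proof.
case: q z => [|q] z /=; split.
- by move=> e; apply: fcoch_inj; rewrite e; apply: coch0P.
- by move=> ->; apply: coch0P.
- move=> [y /fcoch_surj[w ->]]; rewrite fcoch_map => /fcoch_inj->.
  by exists w.
- move=> [w ->]; exists (fcoch w); first exact: fcoch_diff.
  by rewrite fcoch_map.
Qed.

Lemma hmcls_rel_linear q a z z' F F' : @hmcls_rel q z F -> hmcls_rel z' F' ->
  hmcls_rel (a *: z + z') (a *: F + F').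
Proof. by move=> h h'; rewrite /hmcls_rel fcoch_linear; exact: ar_rel_linear. Qed.

Lemma hmcls_rel_total q z : cdiff q z = 0 -> exists F, hmcls_rel z F.
Proof.
move=> hz; apply: (@ar_rel_surj _ _ _ _ _ _ (@restr_dd) aug_inj ex0 exS q (fcoch z)).
  exact: fcoch_diff.
rewrite fcoch_map -[central_map _ _]/(cdiff q z) hz.
exact: coch0P.
Qed.

Lemma hmcls_rel_surj q (F : coch q (restr M)) : diff F = 0 ->
  exists2 z, cdiff q z = 0 & hmcls_rel z F.
Proof.
move=> hF; have [u hu] := ar_rel_total restr_dd ex0 ac hF.
have [hu1 hu2] := ar_rel_cocycle ex0 hu; have [z ez] := fcoch_surj hu1.
exists z; last by rewrite /hmcls_rel -ez.
apply: fcoch_inj; rewrite -fcoch_map -ez hu2.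
exact: coch0P.
Qed.

Lemma hmcls_rel_bound q z (F : coch q (restr M)) : hmcls_rel z F -> F \in bound q _ <-> cbound z.
Proof.
move=> h; apply: iff_trans (fcoch_negligible z).
exact: (ar_rel_bound aug_inj ex0 exS ac h).
Qed.

Lemma kerp_diff q (N : bimod C) (F : coch q N) : F \in kerp (@diff k C q N) <-> diff F = 0.
Proof. by split=> [/eqP|h]; last exact/eqP. Qed.

Lemma hmcls_exists q : exists p : {linear central (I q) -> HM q (restr M)},
  forall z F, hmcls_rel z F -> p z = cls _ _ F.
Proof.
have [z|a z z' v v' [F [hF ->]] [F' [hF' ->]]|v [F [hF ->]]|p hp] :=
  @linrel_map k (subm (kerp (cdiff q))) (HM q (restr M))
   (fun z v => exists F, hmcls_rel (val z) F /\ v = cls _ _ F).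
- have /eqP hz := valP z; have [F hF] := hmcls_rel_total hz.
  by exists (cls _ _ F), F.
- exists (a *: F + F'); split.
    by rewrite linearP; exact: hmcls_rel_linear.
  by rewrite clsL //; apply/kerp_diff; [case: hF | case: hF'].
- apply/cls_eq0; first by apply/kerp_diff; case: hF.
  by apply/(hmcls_rel_bound hF); rewrite linear0; exact: cbound0.
have vl : linear (fun z : subm (kerp (cdiff q)) => val z) by move=> a u v; rewrite linearP.
(* A linear retraction of the inclusion of the cocycles extends the map, in an arbitrary way, to all
   of [central (I q)]; it can then be composed with any cochain. *)
have [|g gK] := @gen_inverse_inj k _ _ (mklin vl).
  by move=> u v; rewrite !mklinE => /val_inj.
exists (p \o g) => z F hF /=.
have hz : z \in kerp (cdiff q).
  have [_ h2] := ar_rel_cocycle ex0 hF; apply/eqP/fcoch_inj.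
  by rewrite -fcoch_map h2; apply: coch0P.
have -> : g z = exist _ z hz by rewrite -[RHS]gK mklinE.
by apply/hp; exists F.
Qed.
(* The isomorphism from the q-th cohomology of H^0(C, I) to H^q(C, M); only
   meaningful on the kernel of cdiff q. *)
Definition hmcls q : {linear central (I q) -> HM q (restr M)} := sval (cid (hmcls_exists q)).
Lemma hmclsE q z F : hmcls_rel z F -> hmcls q z = cls _ _ F.
Proof. by rewrite /hmcls; case: cid => p /= h; apply: h. Qed.

Lemma hmcls_spec q z : cdiff q z = 0 -> exists2 F, hmcls_rel z F & hmcls q z = cls _ _ F.
Proof. by move=> /hmcls_rel_total[F hF]; exists F => //; apply: hmclsE. Qed.

Lemma hmcls_surj q (v : HM q (restr M)) : exists2 z, cdiff q z = 0 & hmcls q z = v.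
Proof.
have [F /kerp_diff hF ->] := cls_surj v.
by have [z hz h] := hmcls_rel_surj hF; exists z => //; apply: hmclsE.
Qed.

Lemma hmcls_eq0 q z : cdiff q z = 0 -> hmcls q z = 0 <-> cbound z.
Proof.
move=> /hmcls_spec[F hF ->]; apply: iff_trans (hmcls_rel_bound hF).
by apply: cls_eq0; apply/kerp_diff; case: hF.
Qed.

Lemma cbound_act q (z : central (I q)) h : cbound z -> cbound (act gal z h).
Proof.
case: q z => [|q] z /=.
  by move=> ->; exact: (bilin0l (ract_bil (act_right_action gal _))).
by move=> [w ->]; exists (act gal w h); rewrite cdiff_act.
Qed.

Lemma cdiff_act0 q (z : central (I q)) h : cdiff q z = 0 -> cdiff q (act gal z h) = 0.
Proof.
move=> hz; rewrite cdiff_act hz.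
exact: (bilin0l (ract_bil (act_right_action gal _))).
Qed.

Lemma hmcls_act q (z z' : central (I q)) h : cdiff q z = 0 -> cdiff q z' = 0 ->
  hmcls q z = hmcls q z' -> hmcls q (act gal z h) = hmcls q (act gal z' h).
Proof.
move=> hz hz' e; apply/eqP; rewrite -subr_eq0 -linearB; apply/eqP.
rewrite -(bilinBl (ract_bil (act_right_action gal _))).
have hB : cdiff q (z - z') = 0 by rewrite linearB hz hz' subrr.
apply/hmcls_eq0; first exact: cdiff_act0.
by apply/cbound_act/(hmcls_eq0 hB); rewrite linearB e subrr.
Qed.
End Resolution.

Section ResolutionMap.
Variables (M N : bimod D) (phi : bimod_hom M N) (I : injres M) (J : injres N).
Variable Phi : injres_map phi I J.

Lemma cdiff_map q z : cdiff J q (central_map (Phi q) z) = central_map (Phi q.+1) (cdiff I q z).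
Proof. by apply: central_eq => x; rewrite !central_mapE irm_diff. Qed.

Lemma cdiff_map0 q z : cdiff I q z = 0 -> cdiff J q (central_map (Phi q) z) = 0.
Proof. by move=> hz; rewrite cdiff_map hz linear0. Qed.

Lemma hmcls_rel_map q z F : hmcls_rel (q := q) z F ->
  hmcls_rel (I := J) (central_map (Phi q) z) (coch_map (restr_hom phi) F).
Proof.
move=> h; rewrite /hmcls_rel -fcoch_map.
apply: (@ar_rel_map k C (restr M) (restr N) (fun j => restr (I j)) (fun j => restr (J j)) _ _
  (restr_hom (ir_aug I)) (restr_hom (ir_aug J)) (@restr_dd _ I) (@restr_dd _ J)
  (restr_hom phi) (fun j => restr_hom (Phi j)) _ _ q F (fcoch z)) => //.
- by move=> x y m; exact: (irm_aug Phi).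
- by move=> j x y m; exact: (irm_diff Phi).
Qed.

Lemma hmcls_map q z : cdiff I q z = 0 ->
  hmcls J q (central_map (Phi q) z) = HMmap (restr_hom phi) q (hmcls I q z).
Proof.
move=> /hmcls_spec[F hF ->]; rewrite (hmclsE (hmcls_rel_map hF)) /HMmap /= subquo_mapE //.
by apply/kerp_diff; case: hF.
Qed.
End ResolutionMap.

Lemma HMmap_id q (M : bimod D) (v : HM q (restr M)) : HMmap (restr_hom (bhid M)) q v = v.
Proof.
have [F hF ->] := cls_surj v; rewrite /HMmap /= subquo_mapE //.
by congr (cls _ _ _); apply: cochP.
Qed.

Notation IR M := (cofree_res M).

Definition dact_fun q (M : bimod D) (v : HM q (restr M)) (h : H) : HM q (restr M) :=
  hmcls (IR M) q (act gal (s2val (cid2 (hmcls_surj (IR M) v))) h).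

(** The definition uses the cofree resolution and a chosen representative. A change of
    representative is absorbed by [hmcls_act]; a change of resolution by a lift of the identity,
    which commutes with the action and with [hmcls]. *)
Lemma dact_hmcls q (M : bimod D) (I : injres M) z h : cdiff I q z = 0 ->
  dact_fun (hmcls I q z) h = hmcls I q (act gal z h).
Proof.
have base (y : central (IR M q)) : cdiff (IR M) q y = 0 ->
    dact_fun (hmcls (IR M) q y) h = hmcls (IR M) q (act gal y h).
  by move=> hy; rewrite /dact_fun; case: cid2 => w hw ew; exact: hmcls_act hw hy ew.
move=> hz; have [y hy ey] := hmcls_surj (IR M) (hmcls I q z).
have [Phi] := injres_map_exists (bhid M) (IR M) I.
rewrite -ey base //.
have -> : hmcls I q (act gal z h) = hmcls I q (act gal (central_map (Phi q) y) h).
  apply: hmcls_act => //; first exact: cdiff_map0.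
  by rewrite hmcls_map // HMmap_id.
by rewrite -central_map_act hmcls_map ?HMmap_id // cdiff_act0.
Qed.

Fact dact_fun_action q M : right_action (@dact_fun q M).
Proof.
have RA := act_right_action gal (IR M q).
split.
- split=> [v a g h|h a v w].
    have [z hz <-] := hmcls_surj (IR M) v.
    by rewrite !dact_hmcls // (bilinr (ract_bil RA)) linearP.
  have [z hz <-] := hmcls_surj (IR M) v; have [y hy <-] := hmcls_surj (IR M) w.
  rewrite -linearP !dact_hmcls // ?linearP ?hz ?hy ?scaler0 ?addr0 //.
  by rewrite (bilinl (ract_bil RA)) linearP.
- move=> v g h; have [z hz <-] := hmcls_surj (IR M) v.
  by rewrite !dact_hmcls ?cdiff_act0 // (ract_mul RA).
move=> v; have [z hz <-] := hmcls_surj (IR M) v.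
by rewrite dact_hmcls // (ract_one RA).
Qed.

Fact dact_fun_natural q (M N : bimod D) (phi : bimod_hom M N) (v : HM q (restr M)) h :
  HMmap (restr_hom phi) q (dact_fun v h) = dact_fun (HMmap (restr_hom phi) q v) h.
Proof.
have [z hz <-] := hmcls_surj (IR M) v.
have [Phi] := injres_map_exists phi (IR M) (IR N).
have hz' : cdiff (IR N) q (central_map (Phi q) z) = 0 by exact: cdiff_map0.
rewrite (dact_hmcls h hz) -(hmcls_map Phi hz) -(hmcls_map Phi (cdiff_act0 h hz)).
by rewrite central_map_act (dact_hmcls h hz').
Qed.

Lemma stair_staircase (M : bimod D) (I : injres M) i j (x : coch i (restr (I j))) m u :
  @stair k (cdcplx (@restr_dd M I)) i j x m u -> staircase x u.
Proof.
elim=> {i j x m u} [j u|i j w m u _ IH]; first exact: stair_end.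
exact: stair_step.
Qed.

Fact dact_fun_derived (M : bimod D) (I : injres M) q (v : HM q (restr M)) (h : H) :
    exists (F G : coch q (restr M)) (u u' : coch 0%N (restr (I q))),
      [/\ diff F = 0 /\ diff G = 0,
          v = cls _ _ F /\ dact_fun v h = cls _ _ G,
          staircase (coch_map (restr_hom (ir_aug I)) F) u,
          staircase (coch_map (restr_hom (ir_aug I)) G) u' &
          H0_act u h u'].
Proof.
have [z hz <-] := hmcls_surj I v; rewrite dact_hmcls //.
have [F [hF sF] ->] := hmcls_spec hz; have [G [hG sG] ->] := hmcls_spec (cdiff_act0 h hz).
exists F, G, (fcoch z), (fcoch (act gal z h)); split=> //.
- exact: stair_staircase sF.
- exact: stair_staircase sG.
move=> x; exists (tau gal x h); first by rewrite -gmapE gmap_tau.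
by rewrite /coch0_val fcochE actE /actfam thetaE.
Qed.

Definition derived : derived_action D :=
  @DerivedAction k H D dact_fun dact_fun_action dact_fun_natural
    (fun M => inhabits (IR M)) dact_fun_derived.

Lemma derived_hmcls q (M : bimod D) (I : injres M) z h : cdiff I q z = 0 ->
  dact derived (hmcls I q z) h = hmcls I q (act gal z h).
Proof. exact: dact_hmcls. Qed.
End Derived.

(** * The second page *)

Section Columns.
Variables (k : fieldType) (K : dcplx k).

Definition vbound p q : K p q -> Prop :=
  match q return K p q -> Prop with
  | 0%N => fun X => X = 0
  | q'.+1 => fun X => exists Y, X = dv Y
  end.

Lemma vboundN p q (X : K p q) : vbound X -> vbound (- X).
Proof.
case: q X => [|q] X /=; first by move=> ->; rewrite oppr0.
by move=> [Y ->]; exists (- Y); rewrite linearN.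
Qed.

Lemma vbound_tdv x p q : vbound (tdv x p q : K p q).
Proof. by case: q => [|q] //=; exists ((-1) ^+ p *: x p q); rewrite linearZ. Qed.

Lemma tdh_hfil x p j : x \in hfil K p -> tdh x p j = 0.
Proof. by case: p => [|p] //= /asboolP h; rewrite h ?linear0. Qed.

Lemma hfil_succ x p q : x \in deg K (p + q).+1 -> x \in hfil K p -> x p q = 0 ->
  x \in hfil K p.+1.
Proof.
move=> /asboolP hd /asboolP hf h; apply/asboolP => p' j.
rewrite ltnS leq_eqVlt => /orP[/eqP->|]; last exact: hf.
case: (j =P q) => [->//|hj]; apply: hd => -[/eqP].
by rewrite eqn_add2l => /eqP.
Qed.

(** For q > 0, [t] sits in bidegree (p, q-1), with the sign (-1)^p that undoes the one in the total
    differential. *)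
Lemma vbound_lift p q (X : K p q) : vbound X -> exists t,
  [/\ t \in deg K (p + q), t \in hfil K p & td K t p q = X].
Proof.
case: q X => [|q] X /=.
  by move=> ->; exists 0; rewrite !rpred0 linear0.
move=> [Y ->]; have [t [e h]] := single_exists ((-1) ^+ p *: Y).
have hf : t \in hfil K p.
  by apply/asboolP => p' j hp; apply: h => -[ep _]; rewrite ep ltnn in hp.
exists t; split=> //.
  by apply/asboolP => p' j hpj; apply: h => -[ep ej]; apply: hpj; rewrite ep ej addnS.
rewrite tdE tdh_hfil //= e linearZ /= scalerA -expr2 sqrr_sign scale1r add0r.
by [].
Qed.

Lemma vcocycle_lift p q (X : K p q) : dv X = 0 -> exists t,
  [/\ t \in deg K (p + q).+1, t \in hfil K p, t p q = X,
      td K t \in hfil K p.+1 & td K t p.+1 q = dh X].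
Proof.
move=> hX; have [t [e h]] := single_exists X.
have hf : t \in hfil K p.
  by apply/asboolP => p' j hp; apply: h => -[ep _]; rewrite ep ltnn in hp.
have hd : t \in deg K (p + q).+1.
  by apply/asboolP => p' j hpj; apply: h => -[ep ej]; apply: hpj; rewrite ep ej.
exists t; split=> //.
  apply: (@hfil_succ _ _ q.+1); rewrite ?hfil_td //; first by rewrite addnS deg_td.
  by rewrite tdE tdh_hfil //= e hX scaler0 addr0.
rewrite tdE /= e; case: q X hX e h hd => [|q] X hX e h hd /=; first by rewrite addr0.
by rewrite h ?linear0 ?scaler0 ?addr0 // => -[/eqP]; rewrite eqn_leq ltnn.
Qed.

(** Together with [ssZ_dh]: the corner entry of an element of Z_2 is a cocycle of [dh] with values
    in the cohomology of [dv]. *)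
Lemma ssZ_dv p q x : x \in ssZ K 2 p (p + q) -> dv (x p q) = 0.
Proof.
move=> /ssZP[h1 h2 /asboolP h3].
have := h3 p q.+1; rewrite tdE tdh_hfil // add0r /= => h.
have {}h : (-1) ^+ p *: dv (x p q) = 0 by apply: h; rewrite addn2.
by apply/eqP; move/eqP: h; rewrite scaler_eq0 signr_eq0.
Qed.

Lemma ssZ_dh p q x : x \in ssZ K 2 p (p + q) -> vbound (dh (x p q)).
Proof.
move=> /ssZP[h1 h2 /asboolP h3].
have := h3 p.+1 q; rewrite tdE addn2 => /(_ (ltnSn _)) /eqP.
rewrite addr_eq0 => /eqP /= ->; apply: vboundN.
exact: vbound_tdv.
Qed.
End Columns.

Section Assembly.
Variables (k : fieldType) (H : hopf k) (D : comodcat H).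
Notation C := (coinv D).
Hypotheses (gal : galois D) (fl : left_flat D).
Notation R := (derived gal fl).

Section Resolution.
Variables (M : bimod D) (I : injres M).

Lemma cdiff_cdiff q z : cdiff I q.+1 (cdiff I q z) = 0.
Proof.
by apply: central_eq => x; rewrite /cdiff !central_mapE ir_dd.
Qed.

Lemma hb_dd j x y m :
  hb_hom gal (ir_diff I j.+1) x y (hb_hom gal (ir_diff I j) x y m) = 0.
Proof. exact: cdiff_cdiff. Qed.

Definition hcplx : dcplx k :=
  @cdcplx k (algcat H) (fun j => hb gal (I j)) (fun j => hb_hom gal (ir_diff I j)) hb_dd.

Lemma hcplx_rows : rows_exact hcplx.
Proof. by move=> p j x; apply: hb_acyclic; exact: ir_injective. Qed.

Notation hH q := (Hbimod (dactP R q M)).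
Notation hN q := (hb gal (I q)).

Fact push_subproof p q (X : coch p (hN q)) :
  multilinear (fun x z c => hmcls fl I q (X x z c) : hH q x z).
Proof. by move=> a x z c c' c'' h; rewrite (cofunP X h) linearP. Qed.
Definition push p q (X : coch p (hN q)) : coch p (hH q) := Coch (push_subproof X).
Lemma pushE p q (X : coch p (hN q)) x z c : push X x z c = hmcls fl I q (X x z c).
Proof. by []. Qed.
Lemma push_linear p q : linear (@push p q).
Proof. by move=> a X Y; apply: cochP => x z c; rewrite pushE linearP. Qed.

Lemma dv_cdiff p q (X : hcplx p q) : dv X = 0 <-> forall x z c, cdiff I q ((X : coch p (hN q)) x z c) = 0.
Proof.
split=> [h x z c|h]; last by apply: cochP => x z c; exact: h.
exact: (congr1 (fun G : coch p (hN q.+1) => G x z c) h).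
Qed.

(** The last face involves the action of H, which [hmcls] respects on the cocycles of [cdiff]; the
    hypothesis says that [X] takes its values there. *)
Lemma push_diff p q (X : coch p (hN q)) : @dv k hcplx p q X = 0 ->
  diff (push X) = push (diff X).
Proof.
move=> /dv_cdiff hX; apply: cochP => x z c; rewrite pushE /= /diff_fun !linearD linearZ /=.
rewrite (@first_face_map _ _ _ _ (hmcls fl I q) _ _ _ c (fun y f c' => bl f (X x y c')));
  last by move=> y f d; rewrite hb_blE linearZ.
rewrite (@inner_faces_map _ _ _ _ (hmcls fl I q) _ _ _ c (X x z)) //.
rewrite (@last_face_map _ _ _ _ (hmcls fl I q) _ _ _ c (fun y c' f => br (X y z c') f)) //.
by move=> y d f; exact: (derived_hmcls gal fl f (hX _ _ d)).
Qed.

Lemma push_eq0 p q (X : coch p (hN q)) : @dv k hcplx p q X = 0 ->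
  push X = 0 <-> @vbound k hcplx p q X.
Proof.
move=> /dv_cdiff hX; split=> [h|].
  have hb x z c : cbound (X x z c : central (I q)).
    apply/(hmcls_eq0 fl (hX x z c)); rewrite -pushE.
    by rewrite h.
  case: q X hX h hb => [|q] X hX h hb /=.
    by apply: cochP => x z c; exact: hb.
  by apply: (coch_lift (f := hb_hom gal (ir_diff I q))) => x z c; exact: hb.
move=> hv; apply: cochP => x z c; apply/(hmcls_eq0 fl (hX x z c)).
case: q X hX hv => [|q] X hX /= hv; first by rewrite hv.
by have [Y ->] := hv; exists (Y x z c).
Qed.

(** Representing cocycles are chosen by a linear generalized inverse, so that the choice composed
    with [P] is again a cochain. *)
Lemma push_surj p q (P : coch p (hH q)) :
  exists2 X : coch p (hN q), @dv k hcplx p q X = 0 & push X = P.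
Proof.
have fl' : linear (fun z : subm (kerp (cdiff I q)) => hmcls fl I q (val z)).
  by move=> a u v; rewrite !linearP.
have [g gP] := gen_inverse (mklin fl').
have gK v : hmcls fl I q (val (g v)) = v.
  have [z /eqP hz <-] := hmcls_surj fl I v.
  by have := gP (exist _ z hz); rewrite !mklinE.
have Xm : multilinear (fun x z (c : chain p x z) => val (g (P x z c)) : hN q x z).
  by move=> a x z c c' c'' h; rewrite (cofunP P h) linearP linearP.
exists (Coch Xm); last by apply: cochP => x z c; rewrite pushE gK.
by apply/dv_cdiff => x z c /=; have /eqP := valP (g (P x z c)).
Qed.

Definition e2_rel p q (x : tot hcplx) (P : coch p (hH q)) : Prop :=
  x \in ssZ hcplx 2 p (p + q) /\ P = push (x p q).

(** A class on the second page is read at the corner entry [x p q]; the other entries are recovered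
    up to the denominator by the lifting lemmas for columns. *)
Lemma e2_exists p q : exists2 e : {linear page hcplx 2 p q -> E2 R M p q}, bijective e &
  forall x, x \in ssZ hcplx 2 p (p + q) -> e (cls _ _ x) = cls _ _ (push (x p q)).
Proof.
have kerE (P : coch p (hH q)) : P \in kerp (@diff _ _ p (hH q)) <-> diff P = 0.
  by split=> [/eqP|h]; last exact/eqP.
have pd x : x \in ssZ hcplx 2 p (p + q) -> diff (push (x p q)) = 0.
  move=> hx; rewrite push_diff; last exact: ssZ_dv hx.
  have := ssZ_dh hx.
  have h0 : @dv k hcplx p.+1 q (dh (x p q)) = 0 by rewrite -dhv (ssZ_dv hx) linear0.
  by move=> h; apply/(push_eq0 h0).
have [|x hx|P /kerE hP|x _ [hx ->]|x _ hx [_ ->]|e eb eE] :=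
  @subquo_rel_bij k (tot hcplx) (coch p (hH q)) (ssZ hcplx 2 p (p + q))
    (ssB hcplx 2 p (p + q)) (kerp (@diff _ _ p (hH q))) (bound p (hH q)) (@e2_rel p q).
- move=> a x x' _ _ [hx ->] [hx' ->]; split; first by rewrite rpredD ?rpredZ.
  by rewrite -push_linear.
- by exists (push (x p q)).
- have [X hX eP] := push_surj P.
  have [t [t1 t2 t3 t4 t5]] := vcocycle_lift hX.
  have h0 : @dv k hcplx p.+1 q (@dh k hcplx p q X) = 0 by rewrite -dhv hX linear0.
  (* [td t] is only known to lie in level [p.+1], while Z_2 asks for one more. Its entry [dh X] at
     (p+1, q) is a boundary of [dv] because [P] is a cocycle, and [s] cancels it without changing
     the entry at (p, q). *)
  have [|s [s1 s2 s3]] := @vbound_lift k hcplx p.+1 q (@dh k hcplx p q X).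
    by apply/(push_eq0 h0); rewrite -(push_diff hX) eP.
  have hts : t - s \in ssZ hcplx 2 p (p + q).
    apply/ssZP; split; rewrite ?subB //; first exact: hfilS.
    rewrite addn2; apply: (@hfil_succ _ _ _ _ q).
    - by rewrite addSn; apply: deg_td; rewrite subB.
    - by rewrite linearB subB // hfil_td.
    by rewrite linearB totD totN t5 s3 subrr.
  exists (t - s) => //; split=> //; rewrite totD totN t3.
  have -> : s p q = 0 by move/asboolP: s2; apply.
  by rewrite subr0.
- exact/kerE/pd.
- have /ssZP[x1 x2 x3] := hx; have hdv := ssZ_dv hx.
  split=> [/(ssBP hx)[y [y1 y2 y3 /asboolP y4]]|hB].
    rewrite subn2 /= in y2.
    have exy : x p q = td hcplx y p q.
      by apply/eqP; rewrite -subr_eq0 -totN -totD y4.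
    case: p y1 y2 y3 y4 exy hdv {pd hx x1 x2 x3 kerE} => [|p] y1 y2 y3 y4 exy hdv.
      apply/boundP0/(push_eq0 hdv); rewrite exy tdE /= dprod0 add0r.
      exact: vbound_tdv.
    have hy : @dv k hcplx p q (y p q) = 0.
      move/asboolP: y3 => /(_ p q.+1 (ltnSn _)); rewrite tdE tdh_hfil // add0r /=.
      by move=> /eqP; rewrite scaler_eq0 signr_eq0 => /eqP.
    (* The corner entry of [y] is a cocycle of [dv], and its [dh] differs from the corner entry of
       [x] by a boundary of [dv], which [push] kills. *)
    apply/boundPS; exists (push (y p q)); rewrite (push_diff hy).
    apply/eqP; rewrite -subr_eq0; apply/eqP.
    have -> : push (x p.+1 q) - push (diff (y p q)) = push (tdv y p.+1 q).
      rewrite -scaleN1r addrC -push_linear scaleN1r exy tdE /= addrA addNr add0r.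
      by [].
    apply/push_eq0; last exact: vbound_tdv.
    have -> : tdv y p.+1 q = x p.+1 q - dh (y p q) by rewrite exy tdE /= addrAC subrr add0r.
    by rewrite linearB hdv -dhv hy linear0 subr0.
  apply/(ssBP hx); rewrite subn2 /=.
  case: p hdv hB hx x1 x2 x3 {kerE pd} => [|p] hdv hB hx x1 x2 x3.
    move/boundP0/(push_eq0 hdv)/vbound_lift: hB => [t [t1 t2 t3]].
    exists t; split; [exact: t1 | exact: hfil0 | exact: hfil0 |].
    apply: (@hfil_succ _ _ _ _ q); [by rewrite subB // deg_td | exact: hfil0 |].
    by rewrite totD totN t3 subrr.
  move/boundPS: hB => [P hP]; have [Y hY eY] := push_surj P.
  (* [t] accounts for the part [dh Y] of the corner entry of [x]; the rest is a boundary of [dv],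
     produced by [s]. *)
  have [t [t1 t2 t3 t4 t5]] := vcocycle_lift hY.
  have h0 : @dv k hcplx p.+1 q (x p.+1 q - @dh k hcplx p q Y) = 0 by rewrite linearB hdv -dhv hY linear0 subrr.
  have /(push_eq0 h0)/vbound_lift[s [s1 s2 s3]] : push (x p.+1 q - @dh k hcplx p q Y) = 0.
    rewrite -[X in push X]addrC -scaleN1r push_linear scaleN1r hP -eY (push_diff hY).
    by rewrite addNr.
  exists (t + s); have hd : t + s \in deg hcplx (p.+1 + q) by rewrite rpredD.
  have hf : td hcplx (t + s) \in hfil hcplx p.+1 by rewrite linearD rpredD // hfil_td.
  split; [exact: hd | by apply: rpredD => //; exact: hfilS | exact: hf |].
  apply: (@hfil_succ _ _ _ _ q); rewrite ?subB ?deg_td //.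
  by rewrite linearD totD totN totD t5 s3 addrCA subrr addr0 subrr.
by exists e => // x hx; apply: eE.
Qed.
Definition e2 p q := s2val (cid2 (e2_exists p q)).
Lemma e2_bij p q : bijective (e2 p q).
Proof. by rewrite /e2; case: cid2. Qed.
Lemma e2E p q x : x \in ssZ hcplx 2 p (p + q) -> e2 p q (cls _ _ x) = cls _ _ (push (x p q)).
Proof. by rewrite /e2; case: cid2 => e /= _; apply. Qed.
End Resolution.
End Assembly.

(** * The abutment *)

Section Abutment.
Variables (k : fieldType) (H : hopf k) (D : comodcat H).
Notation C := (coinv D).
Hypotheses (gal : galois D) (fl : left_flat D).

(** * The identification of H^0(H, H^0(C, M)) with H^0(D, M) *)

Section Invariants.
Variable M : bimod D.
Notation N := (hb gal M).

Definition wval (w : coch 0 N) : central M := w tt tt (@cnil k (algcat H) tt).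
Lemma wval_eq (w w' : coch 0 N) : wval w = wval w' -> w = w'.
Proof. by move=> h; apply: coch0P => -[]. Qed.
Lemma wval_lin a (w w' : coch 0 N) : wval (a *: w + w') = a *: wval w + wval w'.
Proof. by []. Qed.

(* u in H^0(D, M) corresponds to w in H^0(H, H^0(C, M)) *)
Definition same_inv (u : coch 0 M) (w : coch 0 N) : Prop :=
  forall x, val (wval w) x = u x x (cnil x).

Lemma same_inv_linear a u u' w w' : same_inv u w -> same_inv u' w' ->
  same_inv (a *: u + u') (a *: w + w').
Proof. by move=> h h' x; rewrite wval_lin central_lin h h'. Qed.

Lemma wval_diff (w : coch 0 N) :
  diff w = 0 <-> forall h, act gal (wval w) h = (eps h : k) *: wval w.
Proof.
split=> [/diff0P hw h|h]; first exact: esym (hw tt tt h).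
by apply/diff0P => -[] [] f; exact: esym (h f).
Qed.

Lemma same_inv_diff u w : same_inv u w -> diff u = 0 <-> diff w = 0.
Proof.
move=> h; split=> [/diff0P hu|/wval_diff/act_coinv hw].
  by apply/wval_diff/act_coinv => x y f; rewrite !h.
by apply/diff0P => x y f; rewrite -!h.
Qed.

Lemma same_inv_right u : diff u = 0 -> exists w, same_inv u w.
Proof.
move=> /diff0P hu.
exists (@fam_coch k (algcat H) N (fun _ => mkcentral (M := M)
  (fun x y (f : coinv_hom x y) => hu x y (val f)))).
by [].
Qed.

Lemma same_inv_left w : exists u, same_inv u w.
Proof. by exists (@fam_coch k D M (val (wval w))). Qed.

Lemma same_inv_injr u w w' : same_inv u w -> same_inv u w' -> w = w'.
Proof. by move=> h h'; apply/wval_eq/central_eq => x; rewrite h h'. Qed.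
Lemma same_inv_injl u u' w : same_inv u w -> same_inv u' w -> u = u'.
Proof. by move=> h h'; apply: coch0P => x; rewrite -h -h'. Qed.
Lemma same_inv0 : same_inv 0 0. Proof. by []. Qed.
End Invariants.

Lemma same_inv_map (M N : bimod D) (phi : bimod_hom M N) u w : same_inv (M := M) u w ->
  same_inv (coch_map phi u) (coch_map (hb_hom gal phi) w).
Proof. by move=> h x; rewrite /= -h -central_mapE. Qed.

Section Resolution.
Variables (M : bimod D) (I : injres M).
Notation K := (hcplx gal I).

Definition inv_rel n (F : coch n M) (u : coch 0 (I n)) := ar_rel (ir_aug I) (@ir_dd k D M I) F u.

Let ac j : acyclic (I j).
Proof. by apply: injective_acyclic; exact: ir_injective. Qed.
Let ex0 := @ir_exact0 k D M I.
Let exS := @ir_exactS k D M I.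
Let aug_inj := @ir_aug_inj k D M I.

Lemma same_inv_negligible n (u : coch 0 (I n)) (w : K 0%N n) : same_inv u w ->
  @negligible k (cdcplx (@ir_dd k D M I)) 0 n u <-> negligible w.
Proof.
case: n u w => [|n] u w h /=; split.
- by move=> e; rewrite e in h; exact: same_inv_injr h (same_inv0 _).
- by move=> e; rewrite e in h; exact: same_inv_injl h (same_inv0 _).
- move=> [y hy e]; have [v hv] := same_inv_right hy.
  exists v; first exact/(same_inv_diff hv).
  by rewrite e in h; exact: same_inv_injr h (same_inv_map _ hv).
- move=> [v hv e]; have [y hy] := same_inv_left v.
  exists y; first exact/(same_inv_diff hy).
  by rewrite e in h; exact: same_inv_injl h (same_inv_map _ hy).
Qed.

(** The comparison passes through column 0: [t] is moved there by a total boundary, its entry [w] is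
    read as a family [u] in I^n, and a staircase over D relates [u] to [F]. *)
Definition ab_rel n (t : tot K) (F : coch n M) : Prop := exists u (w : K 0%N n) s y,
  [/\ inv_rel F u, same_inv u w, is_col0 w s, y \in deg K n & t = s + td K y].

Lemma ab_rel_linear n : linrel (@ab_rel n).
Proof.
move=> a t t' F F' [u [w [s [y [h1 h2 h3 h4 ->]]]]] [u' [w' [s' [y' [h1' h2' h3' h4' ->]]]]].
exists (a *: u + u'), (a *: w + w'), (a *: s + s'), (a *: y + y'); split.
- exact: ar_rel_linear.
- exact: same_inv_linear.
- exact: is_col0_linear.
- by rewrite rpredD ?rpredZ.
by rewrite linearP scalerDr addrACA.
Qed.

Lemma ab_rel_total n t : t \in tZ K n -> exists F, @ab_rel n t F.
Proof.
move=> /tZP[ht dt]; have [y [w [hy hs] [hw vw]]] := collapse_cocycle (@hcplx_rows _ _ _ _ _ I) ht dt.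
have [u hu] := same_inv_left w; have du := (same_inv_diff hu).2 hw.
have [|F hF] := @ar_rel_surj k D M I (@ir_diff k D M I) (ir_aug I) (@ir_dd k D M I)
  aug_inj ex0 exS n u du.
  by apply: (same_inv_injl (same_inv_map (ir_diff I n) hu)); rewrite [X in same_inv _ X]vw.
exists F, u, w, (t - td K y), y; split=> //.
by rewrite subrK.
Qed.

Lemma ab_exists n : exists2 a : {linear tH K n -> HM n M}, bijective a &
  forall t F, t \in tZ K n -> ab_rel t F -> a (cls _ _ t) = cls _ _ F.
Proof.
apply: subquo_rel_bij => [|t|F /eqP hF|t F [u [w [s [y [h _ _ _ _]]]]]|t F ht].
- exact: ab_rel_linear.
- exact: ab_rel_total.
- have [u hu] := ar_rel_total (@ir_dd k D M I) ex0 ac hF.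
  have [du vu] := ar_rel_cocycle ex0 hu.
  have [w hw] := same_inv_right du.
  have [s hs] := @single_exists k K 0 n w.
  exists s; last by exists u, w, s, 0; rewrite rpred0 linear0 addr0.
  apply/tZP; split; first exact: is_col0_deg hs.
  apply: (is_col0_cocycle hs); first exact/(same_inv_diff hw).
  by apply: (same_inv_injr (same_inv_map (ir_diff I n) hw)); rewrite vu.
- by apply/eqP; case: h.
move=> [u [w [s [y [h1 h2 h3 h4 e]]]]].
(* Being a boundary is followed from [F] to [u], then to [w], then to the column 0 element [s] of
   the total complex. *)
apply: iff_trans (iff_sym (ar_rel_bound aug_inj ex0 exS ac h1)).
apply: iff_trans (iff_sym (same_inv_negligible h2)).
apply: iff_trans (iff_sym (is_col0_negligible (@hcplx_rows _ _ _ _ _ I) h3)).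
split=> [/asboolP[z hz ez]|[z hz ez]].
  exists (z - y); first exact: subB.
  by rewrite linearB -ez e addrK.
by apply/asboolP; exists (z + y); rewrite ?rpredD // linearD -ez.
Qed.
Definition ab n := s2val (cid2 (ab_exists n)).
Lemma ab_bij n : bijective (ab n).
Proof. by rewrite /ab; case: cid2. Qed.
Lemma abE n t F : t \in tZ K n -> ab_rel t F -> ab n (cls _ _ t) = cls _ _ F.
Proof. by rewrite /ab; case: cid2 => a /= _; apply. Qed.

Definition hs_ss : spectral_sequence (E2 (derived gal fl) M) (fun n => HM n M) :=
  tot_ss ab_bij (e2_bij gal fl I).
End Resolution.

(** * Naturality in the bimodule *)

Section ResolutionMap.
Variables (M N : bimod D) (phi : bimod_hom M N) (I : injres M) (J : injres N).
Variable Phi : injres_map phi I J.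
Notation K := (hcplx gal I).
Notation L := (hcplx gal J).
Notation R := (derived gal fl).

Definition hmap p j : {linear K p j -> L p j} := @coch_map k (algcat H) _ _ (hb_hom gal (Phi j)) p.

Lemma hmap_dh p j (x : K p j) : hmap p.+1 j (dh x) = dh (hmap p j x).
Proof. exact: esym (diff_coch_map _ _). Qed.
Lemma hmap_dv p j (x : K p j) : hmap p j.+1 (dv x) = dv (hmap p j x).
Proof. by apply: cochP => s t c; exact: esym (cdiff_map Phi _). Qed.

Lemma hs_e2_map p q x : x \in ssZ K 2 p (p + q) ->
  e2 gal fl J p q (cls _ _ (tmap hmap x)) = E2map R phi p q (e2 gal fl I p q (cls _ _ x)).
Proof.
move=> hx; have hx' : tmap hmap x \in ssZ L 2 p (p + q).
  by apply: ssZ_map hx => *; [exact: tmap_td hmap_dh hmap_dv _ | exact: tmap_deg | exact: tmap_hfil].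
rewrite (e2E fl hx) (e2E fl hx') /E2map /HMmap /= subquo_mapE.
  congr (cls _ _ _); apply: cochP => s t c; rewrite tmapE /=.
  have /dv_cdiff hX := ssZ_dv hx.
  exact: (hmcls_map fl Phi (hX s t c)).
apply/eqP; rewrite /= push_diff; last exact: ssZ_dv hx.
have h0 : @dv k K p.+1 q (dh (x p q)) = 0 by rewrite -dhv (ssZ_dv hx) linear0.
exact/(push_eq0 fl h0)/(ssZ_dh hx).
Qed.

Lemma ab_rel_map n t F : ab_rel (n := n) t F -> ab_rel (tmap hmap t) (coch_map phi F).
Proof.
move=> [u [w [s [y [h1 h2 h3 h4 ->]]]]].
exists (coch_map (Phi n) u), (hmap 0 n w), (tmap hmap s), (tmap hmap y); split.
- apply: ar_rel_map h1; [exact: (irm_aug Phi) | exact: (irm_diff Phi)].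
- exact: same_inv_map.
- exact: tmap_is_col0.
- exact: tmap_deg.
by rewrite linearD (tmap_td hmap_dh hmap_dv).
Qed.

Lemma hs_ab_map n t : t \in tZ K n ->
  ab J n (cls _ _ (tmap hmap t)) = HMmap phi n (ab I n (cls _ _ t)).
Proof.
move=> ht; have [F hF] := ab_rel_total ht.
have ht' : tmap hmap t \in tZ L n.
  by apply: tZ_map ht => *; [exact: tmap_td hmap_dh hmap_dv _ | exact: tmap_deg].
rewrite (abE ht hF) (abE ht' (ab_rel_map hF)) /HMmap /= subquo_mapE //.
by have [u [w [s [y [[h _] _ _ _ _]]]]] := hF; apply/eqP.
Qed.

Lemma hs_ss_morphism : exists f : forall r p q,
    {linear ss_page (hs_ss I) r p q -> ss_page (hs_ss J) r p q},
  ss_morphism (E2map R phi) (HMmap phi) f.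
Proof.
have tm := tmap_td hmap_dh hmap_dv.
exists (page_map tm (fun n x => @tmap_deg k K L hmap n x) (fun n x => @tmap_hfil k K L hmap n x)).
apply: tot_ss_morphism => [p q x hx|n x hx]; [exact: hs_e2_map | exact: hs_ab_map].
Qed.
End ResolutionMap.
End Abutment.

Theorem theorem3p14 (k : fieldType) (H : hopf k) (D : comodcat H) :
  galois D -> left_flat D -> right_flat D ->
  exists (R : derived_action D)
    (S : forall M : bimod D, spectral_sequence (E2 R M) (fun n => HM n M)),
    forall (M N : bimod D) (phi : bimod_hom M N),
      exists f : forall r p q, {linear ss_page (S M) r p q -> ss_page (S N) r p q},
        ss_morphism (E2map R phi) (HMmap phi) f.
Proof.
move=> gal fl _; exists (derived gal fl), (fun M => hs_ss gal fl (cofree_res M)) => M N phi.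
(* The resolution is fixed for each bimodule; any lift of [phi] to the resolutions induces the
   morphism. *)
have [Phi] := injres_map_exists phi (cofree_res M) (cofree_res N).
exact: hs_ss_morphism.
Qed.
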